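(* Let $(\pi,V)$ be an irreducible generic non-supercuspidal representation of $G$ which is not isomorphic to the Steinberg representation of $G$, with conductor $N_\pi$. Let $\mu_1$ be a quasi-character of $E^\times$ and $\mu_2$ a character of $E^1$ such that $\pi$ is a subrepresentation of $\mathrm{Ind}_B^G(\mu_1\otimes\mu_2)$. Then the function $f_{N_\pi,\,N_\pi-c(\mu_1)}$ is a newform for $\pi$, i.e. a non-zero element of $V(N_\pi)$.
   Context: $F$ is a non-archimedean local field of characteristic zero with odd residual characteristic; $E$ is the unramified quadratic extension of $F$, with ring of integers $\mathfrak{o}_E$, maximal ideal $\mathfrak{p}_E$ and normalized absolute value $|\cdot|_E$; $\varpi$ is a uniformizer of $F$ (hence of $E$); $x\mapsto\overline{x}$ is the non-trivial element of $\mathrm{Gal}(E/F)$. $G=\{g\in \mathrm{GL}_3(E) : {}^t\overline{g}Jg=J\}$ with $J=\begin{pmatrix}0&0&1\\0&1&0\\1&0&0\end{pmatrix}$. $E^1$ is the norm-one subgroup of $E^\times$. $B$ is the group of upper triangular elements of $G$, $T$ its diagonal subgroup, $U$ its unipotent radical, consisting of $u(x,y)=\begin{pmatrix}1&x&y\\0&1&-\overline{x}\\0&0&1\end{pmatrix}$ with $y+\overline{y}+x\overline{x}=0$. $\mu=\mu_1\otimes\mu_2$ is the quasi-character $\mathrm{diag}(a,b,\overline{a}^{-1})\mapsto\mu_1(a)\mu_2(b)$ of $T$, extended to $B$ trivially on $U$. $\mathrm{Ind}_B^G\mu$ is the space of locally constant $f:G\to\mathbf{C}$ with $f(bg)=\delta_B(b)^{1/2}\mu(b)f(g)$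 for $b\in B$, $g\in G$ (right translation action), where $\delta_B(\mathrm{diag}(a,b,\overline{a}^{-1}))=|a|_E^2$. The Steinberg representation is the unique irreducible subrepresentation of $\mathrm{Ind}_B^G(|\cdot|_E\otimes1)$. $c(\mu_1)=\min\{n\ge0: \mu_1|_{(1+\mathfrak{p}_E^n)\cap\mathfrak{o}_E^\times}=1\}$, and $c(\mu_2)=\min\{n\ge0:\mu_2|_{E^1_n}=1\}$ where $E^1_0=E^1$, $E^1_n=E^1\cap(1+\mathfrak{p}_E^n)$ for $n\geq1$. A smooth representation $\pi$ is generic if $\mathrm{Hom}_U(\pi,\psi)\ne\{0\}$, where $\psi(u(x,y))=\psi_E(x)$ for a fixed non-trivial additive character $\psi_E$ of $E$ with conductor $\mathfrak{o}_E$. For $n\ge 0$ let \[K_n=\begin{pmatrix}\mathfrak{o}_E&\mathfrak{o}_E&\mathfrak{p}_E^{-n}\\ \mathfrak{p}_E^n&1+\mathfrak{p}_E^n&\mathfrak{o}_E\\ \mathfrak{p}_E^n&\mathfrak{p}_E^n&\mathfrak{o}_E\end{pmatrix}\cap G .\] For a smooth representation $(\pi,V)$, $V(n)$ is the space of $K_n$-fixed vectors; if some $V(n)$ is non-zero (known for irreducible generic $\pi$), the conductor is $N_\pi=\min\{n\ge0: V(n)\neq\{0\}\}$ and $V(N_\pi)$ is the space of newforms. For an integer $i$, $\gamma_i=\begin{pmatrix}1&&\\ \varpi^i&1&\\ -\varpi^{2i}/2&-\varpi^i&1\end{pmatrix}\in G$. For $\lceil n/2\rceil\le i\le n$, $f_{n,i}$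 denotes the $K_n$-fixed function in $\mathrm{Ind}_B^G(\mu_1\otimes\mu_2)$ with $f_{n,i}(\gamma_i)=1$ and $\mathrm{supp}\, f_{n,i}=B\gamma_iK_n$; it is well defined exactly when $c(\mu_2)\le 2i-n$ and $c(\mu_1)\le n-i$. *)

(* Defs.v *)
From HB Require Import structures.
From mathcomp Require Import all_boot all_order all_algebra all_field.
From mathcomp Require Import complex.
From mathcomp Require Import boolp classical_sets functions reals.

Set Implicit Arguments.
Unset Strict Implicit.
Unset Printing Implicit Defensive.

Import Order.TTheory GRing.Theory Num.Theory.

Local Open Scope ring_scope.
Local Open Scope complex_scope.
Local Open Scope classical_set_scope.

(** A field complete for a normalized discrete valuation with finite residue
    field.  The value of [lval] at 0 and that of [lred] outside the valuation
    ring are irrelevant: the ideals p^n are given by [in_ideal]. *)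

Definition val_ideal (K : fieldType) (v : K -> int) (n : int) (x : K) : bool :=
  (x == 0) || (n <= v x).

Record local_struct (K : fieldType) := LocalStruct {
  lval : K -> int;
  lvalM : forall x y, x != 0 -> y != 0 -> lval (x * y) = lval x + lval y;
  lvalD : forall x y, x != 0 -> y != 0 -> x + y != 0 ->
    Num.min (lval x) (lval y) <= lval (x + y);
  lval_onto : exists2 x, x != 0 & lval x = 1;
  lcomplete : forall u : nat -> K,
    (forall n : int, exists N : nat, forall i j : nat, (N <= i)%N -> (N <= j)%N ->
       val_ideal lval n (u i - u j)) ->
    exists l : K, forall n : int, exists N : nat, forall i : nat, (N <= i)%N ->
       val_ideal lval n (u i - l);
  lres : finFieldType;
  lred : K -> lres;
  lred1 : lred 1 = 1;
  lredD : forall x y, val_ideal lval 0 x -> val_ideal lval 0 y ->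
    lred (x + y) = lred x + lred y;
  lredM : forall x y, val_ideal lval 0 x -> val_ideal lval 0 y ->
    lred (x * y) = lred x * lred y;
  lred_ker : forall x, val_ideal lval 0 x ->
    (lred x == 0) = val_ideal lval 1 x;
  lred_onto : forall a : lres, exists2 x, val_ideal lval 0 x & lred x = a
}.

(** F is a non-archimedean local field of characteristic zero with odd residual
    characteristic and E is its unramified quadratic extension: a uniformizer
    of F is one of E, i.e. the normalized valuation of E extends that of F
    (separability of the residue extension is automatic, as it is finite). *)
Record unramified_quadratic := UnramifiedQuadratic {
  uqF : fieldType;
  uqF_local : local_struct uqF;
  uqF_char0 : [pchar uqF] =i pred0;
  uqF_odd : forall p : nat, p \in [pchar (lres uqF_local)] -> odd p;
  uqE : fieldExtType uqF;
  uqE_local : local_struct uqE;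
  uqE_quadratic : \dim {:uqE} = 2;
  uqE_unramified : forall x : uqF, x != 0 ->
    lval uqE_local x%:A = lval uqF_local x;
  uq_conj : {lrmorphism uqE -> uqE};
  uq_conj_neq_id : exists x, uq_conj x != x
}.

Definition mx3 (K : nzRingType) (a b c d e f g h k : K) : 'M[K]_3 :=
  \matrix_(i < 3, j < 3)
    (nth [::] [:: [:: a; b; c]; [:: d; e; f]; [:: g; h; k]] i)`_j.

Section Unitary.
Context (D : unramified_quadratic).
Local Notation F := (uqF D).
Local Notation E := (uqE D).
Local Notation conj := (@uq_conj D).

Definition in_ideal (n : int) (x : E) : bool := val_ideal (lval (uqE_local D)) n x.

Fact ideal_le n m (x : E) : m <= n -> in_ideal n x -> in_ideal m x.
Proof.
move=> mn /orP[x0|nx]; apply/orP; [by left|right; exact: le_trans mn nx].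
Qed.

Fact ideal_add n (x y : E) :
  in_ideal n x -> in_ideal n y -> in_ideal n (x + y).
Proof.
rewrite /in_ideal /val_ideal; have [->|x0] := eqVneq x 0; first by rewrite add0r.
have [->|y0] := eqVneq y 0; first by rewrite addr0 (negPf x0).
have [//|xy0] := eqVneq (x + y) 0; rewrite /= => nx ny.
by apply: le_trans (lvalD _ x0 y0 xy0); rewrite le_min nx ny.
Qed.

Fact ideal_sum n (I : Type) (r : seq I) (u : I -> E) :
  (forall i, in_ideal n (u i)) -> in_ideal n (\sum_(i <- r) u i).
Proof.
move=> h; apply: (big_ind (in_ideal n)) => //; first by rewrite /in_ideal /val_ideal eqxx.
by move=> ? ?; apply: ideal_add.
Qed.

Fact ideal_mul n (x y : E) :
  in_ideal n x -> y != 0 -> in_ideal (n + lval (uqE_local D) y) (x * y).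
Proof.
rewrite /in_ideal /val_ideal; have [->|x0] := eqVneq x 0.
  by rewrite mul0r eqxx.
by move=> /= nx y0; rewrite lvalM // lerD2r nx orbT.
Qed.

Definition is_uniformizer (w : F) : Prop :=
  w != 0 /\ lval (uqF_local D) w = 1.

Definition u3J : 'M[E]_3 := mx3 0 0 1 0 1 0 1 0 0.

Definition u3_pred : pred 'M[E]_3 :=
  fun g => (g \in unitmx) && ((map_mx conj g)^T *m u3J *m g == u3J).

Record u3 := U3 { u3_mx :> 'M[E]_3; u3P : u3_pred u3_mx }.

HB.instance Definition _ := [isSub for u3_mx].
HB.instance Definition _ := [Choice of u3 by <:].

Fact u3_one_subproof : u3_pred 1%:M.
Proof.
by rewrite /u3_pred unitmx1 map_mx1 trmx1 mul1mx mulmx1 eqxx.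
Qed.

Fact u3_mul_subproof (g h : u3) : u3_pred (g *m h).
Proof.
case: g h => [g pg] [h ph] /=.
case/andP: pg => ug /eqP Jg; case/andP: ph => uh /eqP Jh.
rewrite /u3_pred unitmx_mul ug uh /= map_mxM trmx_mul.
by apply/eqP; rewrite -[RHS]Jh -[in RHS]Jg !mulmxA.
Qed.

Fact u3_inv_subproof (g : u3) : u3_pred (invmx g).
Proof.
case: g => [g pg] /=; case/andP: pg => ug /eqP Jg.
rewrite /u3_pred unitmx_inv ug /= map_invmx trmx_inv -{1}Jg.
apply/eqP; rewrite -!mulmxA mulmxV // mulmx1 mulKmx //.
by rewrite unitmx_tr map_unitmx.
Qed.

Definition u3_one := U3 u3_one_subproof.
Definition u3_mul g h := U3 (u3_mul_subproof g h).
Definition u3_inv g := U3 (u3_inv_subproof g).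

Fact u3_mulA : associative u3_mul.
Proof. by move=> a b c; apply: val_inj; apply: mulmxA. Qed.
Fact u3_mul1g : left_id u3_one u3_mul.
Proof. by move=> a; apply: val_inj; apply: mul1mx. Qed.
Fact u3_mulg1 : right_id u3_one u3_mul.
Proof. by move=> a; apply: val_inj; apply: mulmx1. Qed.
Fact u3_mulVg : left_inverse u3_one u3_inv u3_mul.
Proof.
by move=> [a ua]; apply: val_inj; apply: mulVmx; case/andP: (ua).
Qed.
Fact u3_mulgV : right_inverse u3_one u3_inv u3_mul.
Proof.
by move=> [a ua]; apply: val_inj; apply: mulmxV; case/andP: (ua).
Qed.

HB.instance Definition _ :=
  isGroup.Build u3 u3_mulA u3_mul1g u3_mulg1 u3_mulVg u3_mulgV.

Definition borel : set u3 :=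
  [set g | forall i j : 'I_3, (j < i)%N -> u3_mx g i j = 0].

Definition u_mx (x y : E) : 'M[E]_3 := mx3 1 x y 0 1 (- conj x) 0 0 1.

Definition unip : set u3 :=
  [set g | exists x y, y + conj y + x * conj x = 0 /\ u3_mx g = u_mx x y].

Definition Kgrp (n : nat) : set u3 := [set g | let g := u3_mx g in
  [/\ [/\ in_ideal 0 (g 0 0), in_ideal 0 (g 0 1) & in_ideal (- n%:Z) (g 0 2)],
      [/\ in_ideal n (g 1 0), in_ideal n (g 1 1 - 1) & in_ideal 0 (g 1 2)] &
      [/\ in_ideal n (g 2 0), in_ideal n (g 2 1) & in_ideal 0 (g 2 2)]]].

Definition gamma_mx (w : F) (i : int) : 'M[E]_3 :=
  let x : E := w%:A ^ i in
  mx3 1         0     0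
      x         1     0
      (- (x ^+ 2 / 2)) (- x) 1.

Fact gamma_subproof w i : u3_pred (gamma_mx w i).
Proof.
have n2 : (2 : E) != 0.
  have := uqF_char0 D 2; rewrite !inE /= => /negbT n2.
  by rewrite -(rmorph_nat (in_alg E)) fmorph_eq0.
have cx : conj (w%:A ^ i) = w%:A ^ i.
  by rewrite fmorphXz; congr (_ ^ i); apply: rmorph_alg.
rewrite /u3_pred; apply/andP; split.
  rewrite unitmxE (expand_det_row _ ord0) !big_ord_recl big_ord0.
  rewrite !mxE /= !mul0r !addr0 mul1r /cofactor /= addn0 expr0 mul1r.
  rewrite (expand_det_row _ ord0) !big_ord_recl big_ord0 !mxE /= mul0r !addr0.
  by rewrite mul1r /cofactor /= expr0 mul1r det_mx11 !mxE unitr1.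
apply/eqP/matrixP => r s; rewrite !mxE !big_ord_recl !big_ord0 !mxE.
rewrite !big_ord_recl !big_ord0 !mxE /=.
move: (w%:A ^ i) cx => x cx.
have c2 : conj (- (x ^+ 2 / 2)) = - (x ^+ 2 / 2).
  by rewrite rmorphN rmorphM fmorphV rmorph_nat rmorphXn /= cx.
have h2 : x ^+ 2 / 2 + x ^+ 2 / 2 = x ^+ 2.
  by rewrite -mulr2n -(mulr_natr (_ / _)) mulfVK.
case: r s => [[|[|[|r]]] hr] [[|[|[|s]]] hs] //=;
  rewrite ?rmorph0 ?rmorph1 ?c2 ?rmorphN ?cx
    ?(mulr0, mul0r, mulr1, mul1r, addr0, add0r) //.
- by rewrite addrCA -expr2 -opprD h2 subrr.
- by rewrite subrr.
- by apply/eqP; rewrite addrC subr_eq0; apply/eqP; exact: esym cx.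
Qed.

Definition gamma w i := U3 (gamma_subproof w i).

End Unitary.

Section Characters.
Context (R : realType) (D : unramified_quadratic).
Local Notation E := (uqE D).
Local Notation C := R[i].

Definition absE (x : E) : R :=
  if x == 0 then 0 else #|lres (uqE_local D)|%:R ^ (- lval (uqE_local D) x).

Definition continuous_on (A : set E) (chi : E -> C) : Prop :=
  forall x, A x -> forall eps : R, 0 < eps ->
  exists n : int, forall y, A y -> in_ideal n (y - x) ->
    `|chi y - chi x| < eps%:C.

(** Continuous homomorphisms into the units of C; values outside the group are irrelevant. *)
Definition mul_char_on (A : set E) (chi : E -> C) : Prop :=
  [/\ forall x, A x -> chi x != 0,
      forall x y, A x -> A y -> chi (x * y) = chi x * chi y
    & continuous_on A chi].

Definition Estar : set E := [set x | x != 0].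
Definition E1 : set E := [set x | x * uq_conj D x = 1].

Definition add_char (psi : E -> C) : Prop :=
  [/\ forall x, psi x != 0,
      forall x y, psi (x + y) = psi x * psi y
    & continuous_on setT psi].

Definition add_conductor_oE (psi : E -> C) : Prop :=
  forall n : int, (forall x, in_ideal n x -> psi x = 1) <-> 0 <= n.

Definition is_least (P : set nat) (n : nat) : Prop :=
  P n /\ forall m, P m -> (n <= m)%N.

(** The minimum exists as soon as [chi] is a quasi-character of the units of E (no small
    subgroups in GL_1(C)); the default value 0 is then irrelevant. *)
Definition cond_mu1 (chi : E -> C) : nat :=
  xget 0%N (is_least [set n : nat | forall x : E,
    x != 0 -> lval (uqE_local D) x = 0 -> in_ideal n (x - 1) -> chi x = 1]).

End Characters.

Section Representations.
Context (R : realType) (D : unramified_quadratic).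
Local Notation F := (uqF D).
Local Notation E := (uqE D).
Local Notation C := R[i].
Local Notation G := (u3 D).

Record rep := Rep {
  rep_sort :> lmodType C;
  act : G -> {linear rep_sort -> rep_sort};
  act1 : forall v, act 1%g v = v;
  actM : forall g h v, act (g * h)%g v = act g (act h v)
}.

Arguments act {r} g : rename.

Record subrep (rho : rep) := Subrep {
  subrep_set :> rho -> Prop;
  subrep0 : subrep_set 0;
  subrepP : forall (a : C) u v,
    subrep_set u -> subrep_set v -> subrep_set (a *: u + v);
  subrep_act : forall g v, subrep_set v -> subrep_set (act g v)
}.

Section SubrepRep.
Context (rho : rep) (W : subrep rho).

Definition subrep_pred : {pred rho} := fun v => `[< W v >].

Fact subrep_predP v : reflect (W v) (v \in subrep_pred).
Proof. exact: asboolP. Qed.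

Fact subrep_closed : submod_closed subrep_pred.
Proof.
split=> [|a u v /subrep_predP Wu /subrep_predP Wv]; apply/subrep_predP.
  exact: subrep0.
exact: subrepP.
Qed.

HB.instance Definition _ :=
  GRing.isSubmodClosed.Build C rho subrep_pred subrep_closed.

Record subrep_sort :=
  SubrepElt { subrep_val :> rho; subrep_valP : subrep_val \in subrep_pred }.

HB.instance Definition _ := [isSub for subrep_val].
HB.instance Definition _ := [Choice of subrep_sort by <:].
HB.instance Definition _ := [SubChoice_isSubLmodule of subrep_sort by <:].

Fact subrep_act_subproof g (v : subrep_sort) :
  act g (subrep_val v) \in subrep_pred.
Proof.
by case: v => v /= /subrep_predP Wv; apply/subrep_predP/subrep_act.
Qed.

Definition subrep_action g (v : subrep_sort) : subrep_sort :=
  SubrepElt (subrep_act_subproof g v).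

Fact subrep_action_linear g : linear (subrep_action g).
Proof. by move=> a u v; apply: val_inj; rewrite /= linearP. Qed.

HB.instance Definition _ g := GRing.isLinear.Build C subrep_sort subrep_sort
  *:%R (subrep_action g) (subrep_action_linear g).

Fact subrep_action1 v : subrep_action 1%g v = v.
Proof. by apply: val_inj; apply: act1. Qed.

Fact subrep_actionM g h v :
  subrep_action (g * h)%g v = subrep_action g (subrep_action h v).
Proof. by apply: val_inj; apply: actM. Qed.

Definition subrep_rep : rep :=
  @Rep subrep_sort subrep_action subrep_action1 subrep_actionM.

End SubrepRep.

Definition intertwining (rho sigma : rep) (f : rho -> sigma) : Prop :=
  forall g v, f (act g v) = act g (f v).

Definition rep_iso (rho sigma : rep) : Prop :=
  exists f : {linear rho -> sigma}, bijective f /\ intertwining f.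

Definition smooth (rho : rep) : Prop :=
  forall v : rho, exists n : int, forall g : G,
    (forall i j, in_ideal n ((u3_mx g - 1%:M) i j)) -> act g v = v.

Definition irreducible (rho : rep) : Prop :=
  (exists v : rho, v != 0) /\
  forall W : subrep rho, (forall v, W v -> v = 0) \/ (forall v, W v).

Definition generic (psi : E -> C) (rho : rep) : Prop :=
  exists l : {linear rho -> C^o},
    (exists v, l v != 0) /\
    forall (u : G) x y v, unip u -> u3_mx u = u_mx x y ->
      l (act u v) = psi x * l v.

(** Vanishing of the Jacquet module along B, which up to conjugacy is the only
    proper parabolic subgroup of G. *)
Definition supercuspidal (rho : rep) : Prop :=
  forall v : rho, exists s : seq (G * rho),
    (forall p, p \in s -> unip p.1) /\
    v = \sum_(p <- s) (act p.1 p.2 - p.2).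

Definition fixed (rho : rep) (n : nat) : set rho :=
  [set v | forall k, Kgrp n k -> act k v = v].

Arguments fixed : clear implicits.

Definition has_conductor (rho : rep) (N : nat) : Prop :=
  is_least [set n | exists2 v : rho, fixed rho n v & v != 0] N.

Definition rtrans (g : G) (f : G -> C^o) : G -> C^o := fun x => f (x * g)%g.

Fact rtrans_linear g : linear (rtrans g).
Proof. by move=> a f1 f2; apply/funext. Qed.

HB.instance Definition _ g :=
  GRing.isLinear.Build C (G -> C^o) (G -> C^o) *:%R (rtrans g) (rtrans_linear g).

Fact rtrans1 f : rtrans 1%g f = f.
Proof. by apply/funext => x; rewrite /rtrans mulg1. Qed.

Fact rtransM g h f : rtrans (g * h)%g f = rtrans g (rtrans h f).
Proof. by apply/funext => x; rewrite /rtrans mulgA. Qed.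

Definition function_rep : rep := @Rep (G -> C^o) rtrans rtrans1 rtransM.

Definition locally_constant (f : G -> C) : Prop :=
  forall g : G, exists n : int, forall h : G,
    (forall i j, in_ideal n ((u3_mx h - u3_mx g) i j)) -> f h = f g.

Fact rtrans_locally_constant (f : G -> C) g :
  locally_constant f -> locally_constant (rtrans g f).
Proof.
move=> lf x; have [n hn] := lf (x * g)%g.
have [m hm] : exists m : int, forall (y : E) i j,
    in_ideal m y -> in_ideal n (y * u3_mx g i j).
  pose vg (p : 'I_3 * 'I_3) := `|lval (uqE_local D) (u3_mx g p.1 p.2)|%N.
  exists (n + (\sum_p vg p)%N%:Z) => y i j my.
  have [->|g0] := eqVneq (u3_mx g i j) 0.
    by rewrite mulr0 /in_ideal /val_ideal eqxx.
  apply: ideal_le (ideal_mul my g0).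
  rewrite -addrA lerDl; set w := lval _ _.
  have lew : (`|w|%N <= \sum_p vg p)%N.
    by rewrite (bigD1 (i, j)) //= leq_addr.
  rewrite -lerBlDr sub0r; apply: (@le_trans _ _ `|w|%N%:Z); last by rewrite lez_nat.
  by rewrite abszE; apply: le_trans (ler_norm _) _; rewrite normrN.
exists m => y hy; rewrite /rtrans; apply: hn => i j.
have -> : u3_mx (y * g)%g - u3_mx (x * g)%g = (u3_mx y - u3_mx x) *m u3_mx g.
  by rewrite mulmxBl.
by rewrite mxE; apply: ideal_sum => k; apply: hm.
Qed.

Definition delta_B (b : G) : R := absE R (u3_mx b 0 0) ^+ 2.

Section Ind.
Context (mu1 mu2 : E -> C).

Definition mu_B (b : G) : C := mu1 (u3_mx b 0 0) * mu2 (u3_mx b 1 1).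

Definition ind_set : set function_rep := [set f : G -> C |
  locally_constant f /\
  forall b g, borel b ->
    f (b * g)%g = (Num.sqrt (delta_B b))%:C * mu_B b * f g].

Fact ind0 : ind_set 0.
Proof.
by split=> [g|b g _]; [exists 0 => // | rewrite /GRing.zero /= mulr0].
Qed.

Fact indP (a : C) (u v : function_rep) :
  ind_set u -> ind_set v -> ind_set (a *: u + v).
Proof.
move=> [lu hu] [lv hv]; split.
  move=> g; have [n hn] := lu g; have [m hm] := lv g.
  exists (Num.max n m) => h hh.
  have -> : (a *: u + v) h = a * u h + v h by [].
  have -> : (a *: u + v) g = a * u g + v g by [].
  rewrite hn ?hm // => i j; apply: ideal_le (hh i j);
    by rewrite le_max lexx ?orbT.
move=> b g Bb.
have E1 x : (a *: u + v) x = a * u x + v x by [].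
by rewrite !E1 hu // hv // mulrDr mulrCA.
Qed.

Fact ind_act g (v : function_rep) : ind_set v -> ind_set (act g v).
Proof.
move=> [lv hv]; split; first exact: rtrans_locally_constant.
move=> b x Bb; have /= := hv b (x * g)%g Bb; rewrite mulgA; exact.
Qed.

Definition ind_subrep : subrep function_rep := Subrep ind0 indP ind_act.

Definition ind : rep := subrep_rep ind_subrep.

Definition ind_fun (f : ind) : G -> C := subrep_val f.

(** [uphalf n] is the ceiling of n / 2. *)
Definition is_fni (w : F) (n : nat) (i : int) (f : ind) : Prop :=
  [/\ (uphalf n)%:Z <= i <= n%:Z,
      fixed ind n f,
      ind_fun f (gamma w i) = 1
    & forall g, ind_fun f g != 0 <->
        exists b k, [/\ borel b, Kgrp n k & g = (b * gamma w i * k)%g]].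

End Ind.

(** The irreducible subrepresentation [W] is unique. *)
Definition is_steinberg (rho : rep) : Prop :=
  exists W : subrep (ind (fun x => (absE R x)%:C) (fun=> 1)),
    irreducible (subrep_rep W) /\ rep_iso rho (subrep_rep W).

End Representations.

Arguments fixed {R D} rho n _.

(* Main.v *)
(** The fixed vectors of Ind(mu1 (x) mu2) under K_n are determined by their values
    a_i at the gamma_i, ceil(n/2) <= i <= n, because G is the union of the cells
    B gamma_i K_n; a cell is read off the bottom row of a matrix.  A non-zero a_i
    forces c(mu1) <= n - i, so it suffices to show that a vector of pi fixed by
    K_n, n = N_pi, has a_i = 0 for i < n - c(mu1).

    By minimality of n, the averages of this vector over K_(n-1) and over the
    conjugate of K_(n-2) by diag(w^-1, 1, w), which contains K_n, vanish.  For
    i <= n - 2 the second average takes the value a_i at gamma_i, up to a non-zero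
    factor.  The remaining case is c(mu1) = 0, i = n - 1; there the two averages
    give two linear equations in a_(n-1) and a_n whose only degenerate case is
    n = 2, mu2 = 1 and mu1 = |.|, that is, pi is Steinberg. *)

(* A non-zero a_i makes mu1 trivial on the units of 1 + p^(n-i) and mu2 trivial on E^1_(2i-n). If
   moreover i < n - c(mu1), then mu1 is trivial already on the units of 1 + p^(n-1-i), and this one
   extra step serves twice. The obstacle to explicit averages is the middle entry, which must be 1
   modulo p^n in K_n but only modulo p^(n-1) or p^(n-2) in the larger groups. Scalars of E^1
   congruent to 1 modulo p^(n-2) act by mu1 mu2, which the extra step makes trivial on them; so the
   vector is fixed by K_n with a relaxed middle entry, and cosets are represented by unipotent
   elements, with residue classes as digits, and by Weyl elements. Translating gamma_i by such a
   representative then alters the relevant entry of its bottom row by a factor in 1 + p^(n-1-i),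
   where mu1 is trivial. For i <= n - 2 this factor is always a unit, whence a multiple of a_i
   alone. For i = n - 1 it need not be one, and a_n = f(1) enters. The coefficients then involve the
   number tau of trace-zero residue classes, and tau ^ 2 = q is what turns the degenerate case into
   q mu1(w) = 1. *)
From HB Require Import structures.
Require Import Defs.
From mathcomp Require Import all_boot all_order all_algebra all_field.
From mathcomp Require Import complex.
From mathcomp Require Import boolp classical_sets functions reals.
From mathcomp Require Import zify ring.
Import Order.TTheory GRing.Theory Num.Theory.
Local Open Scope ring_scope.

Set Implicit Arguments.
Unset Strict Implicit.
Unset Printing Implicit Defensive.

(** * Valuations and residues *)

Section Valuation.
Context (K : fieldType) (s : local_struct K).
Implicit Types (x y c : K) (m n : int).

Lemma lval1 : lval s 1 = 0.
Proof.
have := lvalM s (oner_neq0 K) (oner_neq0 K); rewrite mulr1.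
by move: (lval s 1) => x; lia.
Qed.

Lemma lvalV x : x != 0 -> lval s x^-1 = - lval s x.
Proof.
move=> x0; have xV0 : x^-1 != 0 by rewrite invr_neq0.
by have := lvalM s x0 xV0; rewrite mulfV // lval1; lia.
Qed.

Lemma lvalN x : x != 0 -> lval s (- x) = lval s x.
Proof.
move=> x0; have N0 : (-1 : K) != 0 by rewrite oppr_eq0 oner_neq0.
have := lvalM s N0 N0; rewrite mulrNN mulr1 lval1 => h.
by rewrite -mulN1r lvalM //; lia.
Qed.

Lemma lvalXz x (k : int) : x != 0 -> lval s (x ^ k) = k * lval s x.
Proof.
move=> x0; have hX (n : nat) : lval s (x ^+ n) = n%:Z * lval s x.
  elim: n => [|n IH]; first by rewrite expr0 lval1; lia.
  by rewrite exprS lvalM ?expf_neq0 // IH; lia.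
case: k => n; first exact: hX.
by rewrite NegzE -exprnN lvalV ?expf_neq0 // hX; lia.
Qed.

Lemma val_ideal0 n : val_ideal (lval s) n 0.
Proof. by rewrite /val_ideal eqxx. Qed.

Lemma val_idealE n x : x != 0 -> val_ideal (lval s) n x = (n <= lval s x).
Proof. by rewrite /val_ideal => /negPf ->. Qed.

Lemma val_ideal_le n m x :
  m <= n -> val_ideal (lval s) n x -> val_ideal (lval s) m x.
Proof.
move=> mn /orP[x0|nx]; apply/orP; [by left|right; exact: le_trans mn nx].
Qed.

Lemma val_idealD n x y : val_ideal (lval s) n x -> val_ideal (lval s) n y ->
  val_ideal (lval s) n (x + y).
Proof.
rewrite /val_ideal; have [->|x0] := eqVneq x 0; first by rewrite add0r.
have [->|y0] := eqVneq y 0; first by rewrite addr0 (negPf x0).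
have [//|xy0] := eqVneq (x + y) 0; rewrite /= => nx ny.
by apply: le_trans (lvalD _ x0 y0 xy0); rewrite le_min nx ny.
Qed.

Lemma val_idealN n x : val_ideal (lval s) n (- x) = val_ideal (lval s) n x.
Proof.
rewrite /val_ideal oppr_eq0; have [//|x0] := eqVneq x 0.
by rewrite lvalN.
Qed.

Lemma val_idealB n x y : val_ideal (lval s) n x -> val_ideal (lval s) n y ->
  val_ideal (lval s) n (x - y).
Proof. by move=> hx hy; apply: val_idealD => //; rewrite val_idealN. Qed.

Lemma val_idealM m n k x y : val_ideal (lval s) m x ->
  val_ideal (lval s) n y -> k <= m + n -> val_ideal (lval s) k (x * y).
Proof.
rewrite /val_ideal mulf_eq0; have [//|x0] := eqVneq x 0.
have [//|y0] := eqVneq y 0; rewrite /= lvalM // => ? ? ?; lia.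
Qed.

Lemma val_ideal_all0 x : (forall n : nat, val_ideal (lval s) n x) -> x = 0.
Proof.
move=> h; apply/eqP/negP => /negP x0.
by have := h (`|lval s x|%N.+1); rewrite val_idealE //; lia.
Qed.

Lemma lval_addl x y : x != 0 -> y != 0 -> lval s x < lval s y ->
  x + y != 0 /\ lval s (x + y) = lval s x.
Proof.
move=> x0 y0 xy; have xy0 : x + y != 0.
  apply/eqP => /eqP; rewrite addr_eq0 => /eqP xE.
  by move: xy; rewrite xE lvalN // ltxx.
have Ny0 : - y != 0 by rewrite oppr_eq0.
split=> //; have h1 := lvalD s x0 y0 xy0.
have := lvalD s xy0 Ny0; rewrite addrK lvalN // => /(_ x0) h2.
move: h1 h2; rewrite !ge_min => /orP h1 /orP h2.
by move: (lval s x) (lval s y) (lval s (x + y)) xy h1 h2 => *; lia.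
Qed.

(** The map l |-> l ^+ 2 + c contracts the maximal ideal: a difference gets multiplied by the sum of
    the two points, which lies in that ideal. Completeness gives the fixed point. *)
Lemma hensel_quadratic c : val_ideal (lval s) 1 c ->
  exists l, l = l ^+ 2 + c.
Proof.
move=> hc; pose a k := iter k (fun l => l ^+ 2 + c) 0.
have a1 k : val_ideal (lval s) 1 (a k).
  elim: k => [|k IH]; first exact: val_ideal0.
  by apply: val_idealD => //; rewrite expr2; apply: (val_idealM IH IH).
have step k : val_ideal (lval s) k.+1 (a k.+1 - a k).
  elim: k => [|k IH]; first by rewrite subr0; apply: a1.
  have -> : a k.+2 - a k.+1 = (a k.+1 - a k) * (a k.+1 + a k).
    by rewrite /=; ring.
  by apply: (val_idealM IH (val_idealD (a1 _) (a1 _))); lia.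
have diff (k j : nat) : val_ideal (lval s) k (a (k + j)%N - a k).
  elim: j => [|j IH]; first by rewrite addn0 subrr val_ideal0.
  rewrite addnS; have -> : a (k + j).+1 - a k =
    (a (k + j).+1 - a (k + j)%N) + (a (k + j)%N - a k) by ring.
  by apply: val_idealD IH; apply: val_ideal_le (step _); lia.
have [n|l hl] := lcomplete (l := s) (u := a).
  exists `|n|%N => i j hi hj; have -> : a i - a j =
    (a i - a `|n|%N) - (a j - a `|n|%N) by ring.
  apply: (@val_ideal_le `|n|%N); first lia.
  by rewrite -(subnKC hi) -(subnKC hj); apply: val_idealB.
exists l; apply/eqP; rewrite -subr_eq0; apply/eqP/val_ideal_all0 => n.
have [M hM] := hl n.
(* As a M.+1 = a M ^+ 2 + c, the defect of the limit is expressed by the errors of a M and a M.+1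
   alone. *)
have -> : l - (l ^+ 2 + c) =
    - (a M.+1 - l) + (a M - l) * ((a M - l) + l *+ 2) by rewrite /=; ring.
apply: val_idealD; first by rewrite val_idealN; apply: hM.
have l0 : val_ideal (lval s) 0 l.
  have [M' hM'] := hl 0; rewrite -[l](subKr (a M')).
  apply: val_idealB; last exact: hM'.
  exact: val_ideal_le (a1 _).
apply: (val_idealM (hM M _) (n := 0)); [lia| |lia].
apply: val_idealD; last by rewrite mulr2n; apply: val_idealD.
exact: val_ideal_le (hM M _).
Qed.

End Valuation.

(** * Conjugation on E, its compatibility with the valuation, and lifts to norm one *)

Section QuadraticExtension.
Context (D : unramified_quadratic).
Local Notation F := (uqF D).
Local Notation E := (uqE D).
Local Notation conj := (@uq_conj D).
Local Notation v := (lval (uqE_local D)).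
Implicit Types (x y z : E) (m n : int).

Lemma conj_alg (a : F) : conj a%:A = a%:A.
Proof. exact: rmorph_alg. Qed.

Lemma basis_of_moved x0 : conj x0 != x0 ->
  forall x, exists a b : F, x = a%:A + b *: x0.
Proof.
move=> x0c x; have x01 : x0 \notin 1%VS.
  by apply/negP => /vlineP[k kE]; move: x0c; rewrite kE conj_alg eqxx.
have full : (1 + <[x0]> = fullv :> {vspace E})%VS.
  apply/eqP; rewrite eqEdim subvf uqE_quadratic ltnNge; apply/negP => le1.
  have /eqP e1 : (1 == 1 + <[x0]> :> {vspace E})%VS.
    by rewrite eqEdim addvSl /= dimv1.
  by case/negP: x01; rewrite e1; apply: (subvP (addvSr _ _)); apply: memv_line.
have : x \in (1 + <[x0]>)%VS by rewrite full memvf.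
by case/memv_addP => _ /vlineP[a ->] [_ /vlineP[b ->] ->]; exists a, b.
Qed.

Lemma conj_fixed x : conj x = x -> exists a : F, x = a%:A.
Proof.
move=> xc; have [x0 x0c] := uq_conj_neq_id D.
have [a [b xE]] := basis_of_moved x0c x; exists a.
move: xc; rewrite xE rmorphD /= conj_alg linearZ /= => /addrI/eqP.
by rewrite -subr_eq0 -scalerBr scaler_eq0 subr_eq0 (negPf x0c) orbF =>
  /eqP ->; rewrite scale0r addr0.
Qed.

(** [conj] is only given as a non-identical F-algebra endomorphism. A moved x0 and its conjugate are
    two distinct roots of one polynomial X ^ 2 - b X - a over F, so their sum is b. *)
Lemma conjK : involutive conj.
Proof.
have [x0 x0c] := uq_conj_neq_id D; have base := basis_of_moved x0c.
have [a [b sqE]] := base (x0 ^+ 2).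
have := congr1 conj sqE; rewrite rmorphXn rmorphD /= conj_alg linearZ /= => sqcE.
have sumE : conj x0 = b%:A - x0.
  have d0 : conj x0 - x0 != 0 by rewrite subr_eq0.
  apply: (mulfI d0); have : conj x0 ^+ 2 - x0 ^+ 2 = b *: (conj x0 - x0).
    by rewrite sqcE {1}sqE scalerBr; ring.
  move=> h; apply/eqP; rewrite -subr_eq0; apply/eqP.
  transitivity (conj x0 ^+ 2 - x0 ^+ 2 - b%:A * (conj x0 - x0)); first by ring.
  by rewrite h mulr_algl subrr.
move=> x; have [c [d ->]] := base x.
have lin e u w : conj (e%:A + u *: w) = e%:A + u *: conj w.
  by rewrite rmorphD /= conj_alg linearZ.
by rewrite !lin sumE rmorphB /= conj_alg sumE subKr.
Qed.

Lemma ideal0 n : in_ideal n (0 : E).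
Proof. exact: val_ideal0. Qed.

Lemma idealE n x : x != 0 -> in_ideal n x = (n <= v x).
Proof. exact: val_idealE. Qed.

Lemma idealN n x : in_ideal n (- x) = in_ideal n x.
Proof. exact: val_idealN. Qed.

Lemma idealB n x y : in_ideal n x -> in_ideal n y -> in_ideal n (x - y).
Proof. exact: val_idealB. Qed.

Lemma idealM m n k x y :
  in_ideal m x -> in_ideal n y -> k <= m + n -> in_ideal k (x * y).
Proof. exact: val_idealM. Qed.

(* Otherwise y = x / (x + conj x) has v y > 0, and y, conj y are the roots of
   X ^ 2 - X + y conj y, which has a root in F. *)
Lemma lval_lt_conj x : x != 0 -> ~~ (v (conj x) < v x).
Proof.
move=> x0; apply/negP => lt_v.
have cx0 : conj x != 0 by rewrite fmorph_eq0.
have [t0 vt] := lval_addl cx0 x0 lt_v.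
set t := conj x + x in t0 vt; pose y := x / t.
have ct : conj t = t by rewrite rmorphD /= conjK addrC.
have cy : conj y = conj x / t by rewrite rmorphM fmorphV /= ct.
have sumy : y + conj y = 1.
  by rewrite cy -mulrDl addrC mulfV.
have [c cE] : exists c : F, y * conj y = c%:A.
  by apply: conj_fixed; rewrite rmorphM /= conjK mulrC.
have c0 : c != 0.
  apply/eqP => c0; move/eqP: cE; rewrite c0 scale0r cy.
  by rewrite !mulf_eq0 invr_eq0 (negPf x0) (negPf t0) (negPf cx0).
have vc : val_ideal (lval (uqF_local D)) 1 c.
  rewrite val_idealE // -uqE_unramified // -cE cy.
  rewrite !lvalM ?invr_eq0 ?mulf_neq0 ?invr_eq0 // !lvalV // vt.
  by move: lt_v; move: (v (conj x)) (v x) => *; lia.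
have [l lE] := hensel_quadratic vc.
have LE : l%:A = l%:A ^+ 2 + y * conj y :> E.
  by rewrite cE {1}lE scalerDl -[(l ^+ 2)%:A]/(in_alg E (l ^+ 2)) rmorphXn.
have : (l%:A - y) * (l%:A - conj y) == 0.
  apply/eqP; transitivity (l%:A ^+ 2 - l%:A * (y + conj y) + y * conj y :> E).
    by ring.
  by rewrite sumy mulr1 addrAC -LE subrr.
have yc : conj y = y -> False.
  rewrite cy => /(mulIf (invr_neq0 t0)) xc; move: lt_v.
  by rewrite xc ltxx.
rewrite mulf_eq0 !subr_eq0 => /orP[]/eqP lyE; apply: yc.
  by rewrite -lyE conj_alg.
by rewrite -{2}[y]conjK -lyE conj_alg.
Qed.

Lemma lval_conj x : x != 0 -> v (conj x) = v x.
Proof.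
move=> x0; have := lval_lt_conj x0.
have cx0 : conj x != 0 by rewrite fmorph_eq0.
have := lval_lt_conj cx0; rewrite conjK.
by move: (v (conj x)) (v x) => *; lia.
Qed.

Lemma ideal_conj n x : in_ideal n (conj x) = in_ideal n x.
Proof.
have [->|x0] := eqVneq x 0; first by rewrite rmorph0.
by rewrite !idealE ?fmorph_eq0 // lval_conj.
Qed.

Lemma lval2 : (2 : E) != 0 /\ v 2 = 0.
Proof.
have l2 : lred (uqF_local D) 2 != 0.
  have e2 : lred (uqF_local D) (1 + 1) = 1 + 1.
    by rewrite lredD ?lred1 //; rewrite /val_ideal lval1 lexx orbT.
  apply/negP => l20; suff /uqF_odd : 2%N \in [pchar (lres (uqF_local D))] by [].
  by rewrite inE /= mulr2n -e2 -mulr2n.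
have F2 : (2 : F) != 0.
  by have := uqF_char0 D 2; rewrite !inE /= => /negbT.
have i0 n : n <= 0 -> val_ideal (lval (uqF_local D)) n 1.
  by move=> n0; rewrite /val_ideal lval1 n0 orbT.
have i2 : val_ideal (lval (uqF_local D)) 0 2.
  by rewrite -[2]/(1 + 1); apply: val_idealD; apply: i0.
have E2 : (2 : E) = (2 : F)%:A by rewrite -in_algE rmorph_nat.
rewrite E2 -in_algE fmorph_eq0 F2 in_algE uqE_unramified //; split=> //.
have := lred_ker i2; rewrite (negPf l2) val_idealE // => k1.
move: i2; rewrite val_idealE //.
by move: (lval _ _) k1 => *; lia.
Qed.

Lemma two_neq0 : (2 : E) != 0.
Proof. by case: lval2. Qed.

Lemma lval1E : v 1 = 0.
Proof. exact: lval1. Qed.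

Lemma ideal1 n : n <= 0 -> in_ideal n (1 : E).
Proof. by move=> n0; rewrite idealE ?oner_neq0 // lval1E. Qed.

Definition unitE x := (x != 0) && (v x == 0).

Lemma unit_neq0 x : unitE x -> x != 0.
Proof. by case/andP. Qed.

Lemma unitM x y : unitE x -> unitE y -> unitE (x * y).
Proof.
case/andP=> x0 /eqP vx /andP[y0 /eqP vy].
by rewrite /unitE mulf_neq0 // lvalM // vx vy.
Qed.

Lemma unitV x : unitE x^-1 = unitE x.
Proof.
rewrite /unitE invr_eq0; have [//|x0] := eqVneq x 0.
by rewrite lvalV // oppr_eq0.
Qed.

Lemma unit_conj x : unitE (conj x) = unitE x.
Proof.
rewrite /unitE fmorph_eq0; have [//|x0] := eqVneq x 0.
by rewrite lval_conj.
Qed.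

Lemma unit1 : unitE 1.
Proof. by rewrite /unitE oner_neq0 lval1E. Qed.

Lemma unit2 : unitE 2.
Proof. by rewrite /unitE two_neq0 (lval2).2. Qed.

Lemma unit_ideal x : unitE x = in_ideal 0 x && ~~ in_ideal 1 x.
Proof.
rewrite /unitE; have [->|x0] := eqVneq x 0; first by rewrite !ideal0.
by rewrite !idealE //=; move: (v x) => *; lia.
Qed.

Lemma unit_ideal0 x : unitE x -> in_ideal 0 x.
Proof. by rewrite unit_ideal => /andP[]. Qed.

Lemma unit_near x y : unitE x -> in_ideal 1 (y - x) -> unitE y.
Proof.
rewrite !unit_ideal => /andP[x0 x1] yx; have -> : y = (y - x) + x by ring.
rewrite ideal_add ?(ideal_le _ yx) //=; apply: contra x1 => h.
by have := idealB h yx; have -> : y - x + x - (y - x) = x by ring.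
Qed.

Lemma idealMu n x y : unitE y -> in_ideal n (x * y) = in_ideal n x.
Proof.
move=> uy; apply/idP/idP => h; last first.
  by apply: (idealM h (unit_ideal0 uy)); rewrite addr0.
rewrite -(mulfK (unit_neq0 uy) x); rewrite -unitV in uy.
by apply: (idealM h (unit_ideal0 uy)); rewrite addr0.
Qed.

Lemma idealV n x y : unitE y -> in_ideal n (x / y) = in_ideal n x.
Proof. by move=> uy; rewrite idealMu // unitV. Qed.

Lemma ideal_half n x : in_ideal n (x / 2) = in_ideal n x.
Proof. by rewrite idealV ?unit2. Qed.

(* A class of norm congruent to 1 mod p^n lifts to E^1 by the Cayley-type
   formulas (1 + u) / (1 + conj u) and (u - 1) / (1 - conj u), no
   approximation being needed. *)
Lemma E1_lift (n : int) x : 0 < n -> unitE x ->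
  in_ideal n (x * conj x - 1) ->
  exists b, E1 b /\ in_ideal n (b - x).
Proof.
move=> n0 ux nx.
have cD : conj (1 + x) = 1 + conj x by rewrite rmorphD rmorph1.
have cB : conj (1 - x) = 1 - conj x by rewrite rmorphB rmorph1.
have [u1|] := boolP (unitE (1 + x)).
  have c0 : 1 + conj x != 0 by rewrite -cD fmorph_eq0 unit_neq0.
  exists ((1 + x) / (1 + conj x)); split.
    rewrite /E1 /= rmorphM fmorphV /= -{2}cD conjK cD.
    by field; rewrite c0 unit_neq0.
  have -> : (1 + x) / (1 + conj x) - x = - (x * conj x - 1) / (1 + conj x).
    by field.
  by rewrite idealV ?idealN // -cD unit_conj.
(* Now x is -1 modulo p, so 1 - x is 2 modulo p, a unit since the residual characteristic is odd. *)
rewrite unit_ideal negb_and negbK ideal_add ?ideal1 ?unit_ideal0 //= => i1.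
have u1 : unitE (1 - x).
  apply: (unit_near unit2); have -> : 1 - x - 2 = - (1 + x) by ring.
  by rewrite idealN.
have c0 : 1 - conj x != 0 by rewrite -cB fmorph_eq0 unit_neq0.
exists ((x - 1) / (1 - conj x)); split.
  rewrite /E1 /= -[x - 1]opprB rmorphM fmorphV rmorphN /= -{2}cB conjK cB.
  by field; rewrite c0 unit_neq0.
have -> : (x - 1) / (1 - conj x) - x = (x * conj x - 1) / (1 - conj x).
  by field.
by rewrite idealV // -cB unit_conj.
Qed.

End QuadraticExtension.

(** * Lifts of residue classes, and the classes of trace-zero integers *)

Section Residue.
Context (D : unramified_quadratic).
Local Notation E := (uqE D).
Local Notation conj := (@uq_conj D).
Local Notation v := (lval (uqE_local D)).
Local Notation k := (lres (uqE_local D)).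
Local Notation red := (lred (uqE_local D)).
Implicit Types (x y z : E) (a b : k).

Fact residue_lift_subproof a : exists x, in_ideal 0 x /\ red x = a.
Proof. by have [x ? ?] := lred_onto a; exists x. Qed.

Definition residue_lift a : E := sval (cid (residue_lift_subproof a)).

Lemma residue_lift_ideal a : in_ideal 0 (residue_lift a).
Proof. by rewrite /residue_lift; case: cid => ? []. Qed.

Lemma residue_liftK a : red (residue_lift a) = a.
Proof. by rewrite /residue_lift; case: cid => ? []. Qed.

Lemma redB x y : in_ideal 0 x -> in_ideal 0 y -> red (x - y) = red x - red y.
Proof.
move=> x0 y0; apply/eqP; rewrite -(inj_eq (addIr (red y))) subrK -lredD //.
  by rewrite subrK.
exact: idealB.
Qed.

Lemma red_eq x y : in_ideal 0 x -> in_ideal 0 y ->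
  (red x == red y) = in_ideal 1 (x - y).
Proof.
by move=> x0 y0; rewrite -subr_eq0 -redB // lred_ker //; apply: idealB.
Qed.

Lemma residue_lift_inj a b : in_ideal 1 (residue_lift a - residue_lift b) -> a = b.
Proof.
by rewrite -red_eq ?residue_lift_ideal // !residue_liftK => /eqP.
Qed.

Lemma residue_liftP x : in_ideal 0 x ->
  in_ideal 1 (x - residue_lift (red x)).
Proof.
by move=> x0; rewrite -red_eq ?residue_lift_ideal // residue_liftK.
Qed.

Lemma residue_lift_near0 a : in_ideal 1 (residue_lift a) = (a == 0).
Proof.
by rewrite -{2}[a]residue_liftK; symmetry; apply/lred_ker/residue_lift_ideal.
Qed.

Lemma residue_lift_unit a : a != 0 -> unitE (residue_lift a).
Proof. by rewrite unit_ideal residue_lift_ideal residue_lift_near0. Qed.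

(* A residue is the class of a trace-zero integer iff it is the class of this
   trace-zero part of a lift. *)
Definition skew_lift a : E := (residue_lift a - conj (residue_lift a)) / 2.

Lemma skew_lift_ideal a : in_ideal 0 (skew_lift a).
Proof.
by rewrite ideal_half idealB ?ideal_conj ?residue_lift_ideal.
Qed.

Lemma conj2 : conj 2 = 2.
Proof. exact: rmorph_nat. Qed.

Lemma conj_skew_lift a : conj (skew_lift a) = - skew_lift a.
Proof.
rewrite /skew_lift rmorphM fmorphV /= conj2 rmorphB /= conjK.
by field; exact: two_neq0.
Qed.

Definition skew_residue := {a : k | red (skew_lift a) == a}.

Lemma skew_lift_red (a : skew_residue) : red (skew_lift (val a)) = val a.
Proof. exact/eqP/(valP a). Qed.

Lemma skew_lift_inj (a b : skew_residue) :
  in_ideal 1 (skew_lift (val a) - skew_lift (val b)) -> a = b.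
Proof.
move=> h; apply: val_inj; rewrite -skew_lift_red -[RHS]skew_lift_red.
by apply/eqP; rewrite red_eq ?skew_lift_ideal.
Qed.

Lemma skew_liftP z : in_ideal 0 z -> conj z = - z ->
  exists a : skew_residue, in_ideal 1 (z - skew_lift (val a)).
Proof.
move=> z0 zc; have near : in_ideal 1 (z - skew_lift (red z)).
  have -> : z - skew_lift (red z) =
      ((z - residue_lift (red z)) - conj (z - residue_lift (red z))) / 2.
    by rewrite /skew_lift rmorphB /= zc; field; exact: two_neq0.
  by rewrite ideal_half idealB ?ideal_conj ?residue_liftP.
have za : red (skew_lift (red z)) == red z.
  by rewrite eq_sym red_eq ?skew_lift_ideal.
by exists (exist _ (red z) za).
Qed.

(** For a moved x the difference x - conj x has trace zero. Powers of w are fixed by [conj], and w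
    is a uniformizer of E too, so scaling by one of them gives a unit. *)
Lemma skew_unit (w : uqF D) : is_uniformizer w ->
  exists d : E, unitE d /\ conj d = - d.
Proof.
move=> [w0 vw]; have [x xc] := uq_conj_neq_id D.
have y0 : x - conj x != 0 by rewrite subr_eq0 eq_sym.
have W0 : (w%:A : E) != 0 by rewrite -in_algE fmorph_eq0.
have vW : v (w%:A) = 1 by rewrite uqE_unramified.
exists ((x - conj x) * w%:A ^ (- v (x - conj x))); split.
  rewrite /unitE mulf_neq0 ?expfz_neq0 //= lvalM ?expfz_neq0 //.
  by rewrite lvalXz // vW mulr1 subrr.
rewrite rmorphM fmorphXz rmorphB /= conjK conj_alg.
by rewrite -mulNr opprB.
Qed.

(** The residue field is the direct sum of the trace-zero classes and of d times these classes, d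
    being a trace-zero unit. *)
Lemma card_skew_residue (w : uqF D) : is_uniformizer w ->
  (#|{: skew_residue}| ^ 2 = #|k|)%N.
Proof.
move=> uw; have [d [ud dc]] := skew_unit uw.
have d0 := unit_neq0 ud.
pose g (ab : skew_residue * skew_residue) : k :=
  red (skew_lift (val ab.1) + d * skew_lift (val ab.2)).
have gi (ab : skew_residue * skew_residue) :
    in_ideal 0 (skew_lift (val ab.1) + d * skew_lift (val ab.2)).
  apply: ideal_add; first exact: skew_lift_ideal.
  by rewrite mulrC idealMu ?skew_lift_ideal.
(* Conjugation negates the component u and keeps d * t, so the difference and the sum with the
   conjugate relation separate the two components. *)
have sep u t u' t' : conj u = - u -> conj t = - t -> conj u' = - u' ->
    conj t' = - t' -> in_ideal 1 (u + d * t - (u' + d * t')) ->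
    in_ideal 1 (u - u') /\ in_ideal 1 (t - t').
  move=> cu ct cu' ct' h.
  have hc : in_ideal 1 (- u + d * t - (- u' + d * t')).
    rewrite -ideal_conj; move: h; congr in_ideal.
    by rewrite !(rmorphB, rmorphD, rmorphN, rmorphM) /= dc cu ct cu' ct'; ring.
  split.
    have := idealB h hc; rewrite -ideal_half; congr in_ideal.
    by field; exact: two_neq0.
  have := ideal_add h hc; rewrite -ideal_half -(idealV _ _ ud); congr in_ideal.
  by field; rewrite d0 two_neq0.
have g_inj : injective g.
  move=> [a b] [a' b'] /eqP; rewrite /g red_eq ?gi //= => h.
  have [] := sep _ _ _ _ _ _ _ _ h; try exact: conj_skew_lift.
  by move=> /skew_lift_inj -> /skew_lift_inj ->.
have g_surj (c : k) : exists ab, g ab = c.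
  set x := residue_lift c; have x0 : in_ideal 0 x := residue_lift_ideal c.
  have [||a ha] := @skew_liftP ((x - conj x) / 2).
  - by rewrite ideal_half idealB ?ideal_conj.
  - by rewrite rmorphM fmorphV /= conj2 rmorphB /= conjK; field; exact: two_neq0.
  have [||b hb] := @skew_liftP ((x + conj x) / 2 / d).
  - by rewrite idealV // ideal_half ideal_add ?ideal_conj.
  - rewrite !rmorphM !fmorphV /= conj2 rmorphD /= conjK dc.
    by field; rewrite ?oppr_eq0 d0 two_neq0.
  exists (a, b); rewrite -[c]residue_liftK -/x; apply/eqP.
  rewrite eq_sym red_eq // -[x]/(residue_lift c) -/x /=.
  have := ideal_add ha
    (_ : in_ideal 1 (d * ((x + conj x) / 2 / d - skew_lift (val b)))).
  rewrite [d * _]mulrC idealMu // => /(_ hb); congr in_ideal.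
  by field; rewrite d0 two_neq0.
have g_bij : bijective g.
  have [h hK] := choice g_surj.
  by exists h => // ab; apply: g_inj; rewrite hK.
by rewrite -(bij_eq_card g_bij) card_prod mulnn.
Qed.

End Residue.

(** * The unitary group *)

Lemma ord3P (P : 'I_3 -> Prop) : P 0 -> P 1 -> P 2 -> forall i, P i.
Proof.
move=> h0 h1 h2 [[|[|[|//]]] hi].
- by rewrite (_ : Ordinal hi = 0) //; apply: val_inj.
- by rewrite (_ : Ordinal hi = 1) //; apply: val_inj.
- by rewrite (_ : Ordinal hi = 2) //; apply: val_inj.
Qed.

Lemma sum_ord3 (V : nmodType) (u : 'I_3 -> V) :
  \sum_i u i = u 0 + u 1 + u 2.
Proof.
rewrite !big_ord_recl big_ord0 addr0 addrA.
by congr (_ + u _ + u _); apply: val_inj.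
Qed.

Section Mx3.
Context (K : nzRingType).
Implicit Types a b c d e f g h k : K.

Lemma mx3E a b c d e f g h k : let M := mx3 a b c d e f g h k in
  ((M 0 0 = a) * (M 0 1 = b) * (M 0 2 = c) *
   (M 1 0 = d) * (M 1 1 = e) * (M 1 2 = f) *
   (M 2 0 = g) * (M 2 1 = h) * (M 2 2 = k))%type.
Proof. by rewrite /mx3 !mxE. Qed.

Lemma mx3P (A B : 'M[K]_3) :
  [/\ A 0 0 = B 0 0, A 0 1 = B 0 1 & A 0 2 = B 0 2] ->
  [/\ A 1 0 = B 1 0, A 1 1 = B 1 1 & A 1 2 = B 1 2] ->
  [/\ A 2 0 = B 2 0, A 2 1 = B 2 1 & A 2 2 = B 2 2] -> A = B.
Proof. by move=> [? ? ?] [? ? ?] [? ? ?]; apply/matrixP; do 2! apply: ord3P. Qed.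

End Mx3.

Lemma det_mx3 (K : comNzRingType) (M : 'M[K]_3) : \det M =
  M 0 0 * (M 1 1 * M 2 2 - M 1 2 * M 2 1)
  - M 0 1 * (M 1 0 * M 2 2 - M 1 2 * M 2 0)
  + M 0 2 * (M 1 0 * M 2 1 - M 1 1 * M 2 0).
Proof.
rewrite (expand_det_row _ 0) sum_ord3 /cofactor.
have det2 (A : 'M[K]_2) : \det A = A 0 0 * A 1 1 - A 0 1 * A 1 0.
  rewrite (expand_det_row _ 0) !big_ord_recl big_ord0 /cofactor !det_mx11.
  rewrite !mxE /= expr0 expr1 addr0.
  have l0 : lift 0 0 = 1 :> 'I_2 by apply: val_inj.
  have l1 : lift 1 0 = 0 :> 'I_2 by apply: val_inj.
  by rewrite !ord1 l0 l1; ring.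
rewrite !det2 !mxE /=.
have l00 : lift 0 0 = 1 :> 'I_3 by apply: val_inj.
have l01 : lift 0 1 = 2 :> 'I_3 by apply: val_inj.
have l10 : lift 1 0 = 0 :> 'I_3 by apply: val_inj.
have l11 : lift 1 1 = 2 :> 'I_3 by apply: val_inj.
have l20 : lift 2 0 = 0 :> 'I_3 by apply: val_inj.
have l21 : lift 2 1 = 1 :> 'I_3 by apply: val_inj.
by rewrite !(l00, l01, l10, l11, l20, l21); ring.
Qed.

Section UnitaryGroup.
Context (D : unramified_quadratic).
Local Notation E := (uqE D).
Local Notation conj := (@uq_conj D).
Local Notation G := (u3 D).
Implicit Types (g h : G) (x y z : E).

Lemma u3_ext g h :
  [/\ u3_mx g 0 0 = u3_mx h 0 0, u3_mx g 0 1 = u3_mx h 0 1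
    & u3_mx g 0 2 = u3_mx h 0 2] ->
  [/\ u3_mx g 1 0 = u3_mx h 1 0, u3_mx g 1 1 = u3_mx h 1 1
    & u3_mx g 1 2 = u3_mx h 1 2] ->
  [/\ u3_mx g 2 0 = u3_mx h 2 0, u3_mx g 2 1 = u3_mx h 2 1
    & u3_mx g 2 2 = u3_mx h 2 2] -> g = h.
Proof. by move=> h0 h1 h2; apply: val_inj; apply: mx3P. Qed.

Lemma u3_mulE g h i j : u3_mx (g * h)%g i j =
  u3_mx g i 0 * u3_mx h 0 j + u3_mx g i 1 * u3_mx h 1 j
  + u3_mx g i 2 * u3_mx h 2 j.
Proof. by rewrite [u3_mx _]/= mxE sum_ord3. Qed.

Lemma u3_oneE i j : u3_mx (1%g : G) i j = (i == j)%:R.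
Proof. by rewrite [u3_mx _]/= !mxE. Qed.

Lemma herm_mxE (M N : 'M[E]_3) i j : ((map_mx conj M)^T *m u3J D *m N) i j =
  conj (M 0 i) * N 2 j + conj (M 1 i) * N 1 j + conj (M 2 i) * N 0 j.
Proof.
rewrite mxE sum_ord3 !mxE !sum_ord3 !mxE /=.
by rewrite !(mulr0, mulr1, addr0, add0r); ring.
Qed.

Lemma hermE g i j : conj (u3_mx g 0 i) * u3_mx g 2 j
  + conj (u3_mx g 1 i) * u3_mx g 1 j + conj (u3_mx g 2 i) * u3_mx g 0 j
  = u3J D i j.
Proof.
by rewrite -herm_mxE; case: g => M /= /andP[_ /eqP ->].
Qed.

Lemma u3J_sq : u3J D *m u3J D = 1%:M.
Proof.
by apply: mx3P; split; rewrite !mxE sum_ord3 !mxE /= ?(mulr0, mulr1, addr0, add0r).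
Qed.

(** Since J squares to 1, the Hermitian relation already exhibits a left inverse of M. *)
Lemma u3_predP (M : 'M[E]_3) :
  (forall i j, conj (M 0 i) * M 2 j + conj (M 1 i) * M 1 j
    + conj (M 2 i) * M 0 j = u3J D i j) -> u3_pred M.
Proof.
move=> hM; have JM : (map_mx conj M)^T *m u3J D *m M = u3J D.
  by apply/matrixP => i j; rewrite herm_mxE.
rewrite /u3_pred JM eqxx andbT.
have := congr1 (mulmx (u3J D)) JM; rewrite u3J_sq mulmxA => h.
by case: (mulmx1_unit h).
Qed.

(* The identity if M is not unitary. *)
Definition mk_u3 (M : 'M[E]_3) : G := insubd (1%g : G) M.

Lemma mk_u3E (M : 'M[E]_3) : 
  (forall i j, conj (M 0 i) * M 2 j + conj (M 1 i) * M 1 j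
    + conj (M 2 i) * M 0 j = u3J D i j) -> u3_mx (mk_u3 M) = M.
Proof. by move=> /u3_predP uM; rewrite -[RHS](insubdK (1%g : G) uM). Qed.

Lemma u3_invE g : u3_mx g^-1%g =
  mx3 (conj (u3_mx g 2 2)) (conj (u3_mx g 1 2)) (conj (u3_mx g 0 2))
      (conj (u3_mx g 2 1)) (conj (u3_mx g 1 1)) (conj (u3_mx g 0 1))
      (conj (u3_mx g 2 0)) (conj (u3_mx g 1 0)) (conj (u3_mx g 0 0)).
Proof.
set N := mx3 _ _ _ _ _ _ _ _ _; have NE : N = u3J D *m (map_mx conj g)^T *m u3J D.
  by apply: mx3P; split; rewrite !mxE /= !sum_ord3 !mxE /= !sum_ord3 !mxE /=
     !(mulr0, mulr1, addr0, add0r, mul0r, mul1r).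
have Ng : N *m g = 1%:M.
  rewrite NE -!mulmxA mulmxA; case: (g) => M /= /andP[_ /eqP JM].
  by rewrite -mulmxA [_^T *m _]mulmxA JM u3J_sq.
have ug : u3_mx g \in unitmx by case: (g) => M /= /andP[].
by rewrite [u3_mx _]/= -[invmx _]mul1mx -Ng mulmxK.
Qed.

Lemma herm_rowE g i j : u3_mx g i 0 * conj (u3_mx g j 2)
  + u3_mx g i 1 * conj (u3_mx g j 1) + u3_mx g i 2 * conj (u3_mx g j 0)
  = u3J D i j.
Proof.
have := u3_mulE g g^-1%g i.
rewrite mulgV u3_invE; move: i j; do 2! apply: ord3P; rewrite !mxE /=;
 do ?[by move/(_ 0); rewrite u3_oneE !mxE /= => <-
 | by move/(_ 1); rewrite u3_oneE !mxE /= => <-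
 | by move/(_ 2); rewrite u3_oneE !mxE /= => <-].
Qed.

End UnitaryGroup.

Ltac ilia :=
  repeat match goal with H : context [uqE] |- _ => clear H end; lia.

(** * Subgroups given by valuations of entries, and elementary unitary matrices *)

Section Subgroups.
Context (D : unramified_quadratic).
Local Notation E := (uqE D).
Local Notation conj := (@uq_conj D).
Local Notation G := (u3 D).
Implicit Types (g h : G) (x y z : E).

Lemma ideal_dot3 (k m1 n1 m2 n2 m3 n3 : int) (a1 b1 a2 b2 a3 b3 : E) :
  in_ideal m1 a1 -> in_ideal n1 b1 -> in_ideal m2 a2 -> in_ideal n2 b2 ->
  in_ideal m3 a3 -> in_ideal n3 b3 ->
  k <= m1 + n1 -> k <= m2 + n2 -> k <= m3 + n3 ->
  in_ideal k (a1 * b1 + a2 * b2 + a3 * b3).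
Proof.
move=> *; apply: ideal_add; first apply: ideal_add.
all: by apply: idealM; eassumption.
Qed.

(** Inversion exchanges the entries (0,1) and (1,2), and also (1,0) and (2,1), up to conjugation
    and, hence, these pairs share an exponent. All the compact groups of the proof have this
    shape. *)
Definition block_grp (x z x' z' m : int) : set G := [set g | let g := u3_mx g in
  [/\ [/\ in_ideal 0 (g 0 0), in_ideal x (g 0 1) & in_ideal z (g 0 2)],
      [/\ in_ideal x' (g 1 0), in_ideal m (g 1 1 - 1) & in_ideal x (g 1 2)] &
      [/\ in_ideal z' (g 2 0), in_ideal x' (g 2 1) & in_ideal 0 (g 2 2)]]].

(** These are the inequalities that closure under products asks for, entry by entry; inversion asks
    for none. *)
Definition block_wf (x z x' z' m : int) : Prop :=
  [/\ 0 <= m, z <= x + x & z' <= x' + x'] /\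
  [/\ m <= x + x', 0 <= z + z', x <= z + x' & x' <= x + z'].

Section Closure.
Context (x z x' z' m : int) (wf : block_wf x z x' z' m).

Lemma block_near1 g : block_grp x z x' z' m g -> in_ideal 0 (u3_mx g 1 1).
Proof.
move=> [_ [_ g11 _] _]; rewrite -[u3_mx g 1 1](subrK 1).
case: wf => -[m0 _ _] _.
by apply: ideal_add; [apply: ideal_le g11 | apply: ideal1].
Qed.

Lemma block_grpM g h : block_grp x z x' z' m g -> block_grp x z x' z' m h ->
  block_grp x z x' z' m (g * h)%g.
Proof.
move=> gB hB; have gB11 := block_near1 gB; have hB11 := block_near1 hB.
case: wf gB hB => -[w1 w2 w3] [w4 w5 w6 w7].
move=> [[g00 g01 g02] [g10 g11 g12] [g20 g21 g22]].
move=> [[h00 h01 h02] [h10 h11 h12] [h20 h21 h22]].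
rewrite /block_grp /mkset !u3_mulE.
split; split.
- by apply: (ideal_dot3 g00 h00 g01 h10 g02 h20); ilia.
- by apply: (ideal_dot3 g00 h01 g01 hB11 g02 h21); ilia.
- by apply: (ideal_dot3 g00 h02 g01 h12 g02 h22); ilia.
- by apply: (ideal_dot3 g10 h00 gB11 h10 g12 h20); ilia.
- have h01' : in_ideal m (u3_mx g 1 0 * u3_mx h 0 1).
    by apply: (idealM g10 h01); ilia.
  have h11' : in_ideal m ((u3_mx g 1 1 - 1) * u3_mx h 1 1).
    by apply: (idealM g11 hB11); ilia.
  have h21' : in_ideal m (u3_mx g 1 2 * u3_mx h 2 1).
    by apply: (idealM g12 h21); ilia.
  have := ideal_add (ideal_add h01' h21') (ideal_add h11' h11).
  by congr in_ideal; ring.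
- by apply: (ideal_dot3 g10 h02 gB11 h12 g12 h22); ilia.
- by apply: (ideal_dot3 g20 h00 g21 h10 g22 h20); ilia.
- by apply: (ideal_dot3 g20 h01 g21 hB11 g22 h21); ilia.
- by apply: (ideal_dot3 g20 h02 g21 h12 g22 h22); ilia.
Qed.

Lemma block_grpV g : block_grp x z x' z' m g -> block_grp x z x' z' m g^-1%g.
Proof.
move=> [[g00 g01 g02] [g10 g11 g12] [g20 g21 g22]].
rewrite /block_grp /mkset u3_invE !mx3E !ideal_conj.
by do 2!split=> //; rewrite -(rmorph1 conj) -rmorphB ideal_conj.
Qed.

End Closure.

Lemma KgrpE n : Kgrp n = block_grp 0 (- n%:Z) n n n.
Proof. by []. Qed.

Definition lo x y : G := mk_u3 (mx3 1 0 0 x 1 0 y (- conj x) 1).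
Definition up x y : G := mk_u3 (u_mx x y).
Definition dg x y : G := mk_u3 (mx3 x 0 0 0 y 0 0 0 (conj x)^-1).
Definition weyl x : G := mk_u3 (mx3 0 0 x^-1 0 1 0 x 0 0).

Definition skew_pair x y := y + conj y + x * conj x = 0.

Lemma loE x y : skew_pair x y ->
  u3_mx (lo x y) = mx3 1 0 0 x 1 0 y (- conj x) 1.
Proof.
move=> xy; rewrite mk_u3E //; do 2! apply: ord3P; rewrite !mxE /=
  ?(rmorph0, rmorph1, rmorphN) /= ?conjK; try ring.
by rewrite -xy; ring.
Qed.

Lemma upE x y : skew_pair x y -> u3_mx (up x y) = u_mx x y.
Proof.
move=> xy; rewrite mk_u3E //; do 2! apply: ord3P; rewrite !mxE /=
  ?(rmorph0, rmorph1, rmorphN) /= ?conjK; try ring.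
by rewrite -xy; ring.
Qed.

Lemma dgE x y : x != 0 -> y * conj y = 1 ->
  u3_mx (dg x y) = mx3 x 0 0 0 y 0 0 0 (conj x)^-1.
Proof.
move=> x0 y1; have cx0 : conj x != 0 by rewrite fmorph_eq0.
rewrite mk_u3E //; do 2! apply: ord3P; rewrite !mxE /=
  ?(rmorph0, rmorph1, rmorphN) /= ?fmorphV /= ?conjK; try ring; try by field.
by rewrite -y1; ring.
Qed.

Lemma weylE x : x != 0 -> conj x = x ->
  u3_mx (weyl x) = mx3 0 0 x^-1 0 1 0 x 0 0.
Proof.
move=> x0 cx.
rewrite mk_u3E //; do 2! apply: ord3P; rewrite !mxE /=
  ?(rmorph0, rmorph1, rmorphN) /= ?fmorphV /= ?cx; try ring; try by field.
Qed.

Lemma skew_pair_skew y : conj y = - y -> skew_pair 0 y.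
Proof. by rewrite /skew_pair => ->; rewrite mul0r subrr addr0. Qed.

(** The [conj]-invariant solution y of [skew_pair x y]; all others differ from it by a trace-zero
    element. *)
Definition half_norm x := - (x * conj x) / 2.

Lemma conj_half_norm x : conj (half_norm x) = half_norm x.
Proof.
rewrite /half_norm rmorphM fmorphV /= conj2 rmorphN rmorphM /= conjK.
by rewrite [conj x * _]mulrC.
Qed.

Lemma skew_pair_half_norm x z : conj z = - z -> skew_pair x (half_norm x + z).
Proof.
move=> cz; rewrite /skew_pair rmorphD /= conj_half_norm cz /half_norm.
by field; exact: two_neq0.
Qed.

Lemma skew_pair_split x y : skew_pair x y ->
  exists2 z, conj z = - z & y = half_norm x + z.
Proof.
move=> xy; exists (y - half_norm x); last by rewrite addrC subrK.
have cy : conj y = - y - x * conj x.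
  by apply/eqP; rewrite -subr_eq0; apply/eqP; rewrite -xy; ring.
by rewrite rmorphB /= conj_half_norm cy /half_norm; field; exact: two_neq0.
Qed.

Lemma ideal_half_norm n x : in_ideal n x -> in_ideal (n + n) (half_norm x).
Proof.
move=> nx; rewrite /half_norm ideal_half idealN.
by apply: (idealM nx _ (lexx _)); rewrite ideal_conj.
Qed.

(** The valuation of a norm is even, so an odd lower bound improves by one. *)
Lemma norm_ideal n x : in_ideal (n + n - 1) (x * conj x) -> in_ideal n x.
Proof.
have [->|x0] := eqVneq x 0; first by rewrite ideal0.
by rewrite !idealE ?mulf_neq0 ?fmorph_eq0 // lvalM ?fmorph_eq0 // lval_conj //; lia.
Qed.

Lemma block_grp_lo a b a' b' m x y : 0 <= m -> skew_pair x y ->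
  in_ideal a' x -> in_ideal b' y -> block_grp a b a' b' m (lo x y).
Proof.
move=> m0 xy ax bx; rewrite /block_grp /mkset loE // !mx3E subrr !ideal0 idealN.
by rewrite ideal_conj !ideal1.
Qed.

Lemma block_grp_up a b a' b' m x y : 0 <= m -> skew_pair x y ->
  in_ideal a x -> in_ideal b y -> block_grp a b a' b' m (up x y).
Proof.
move=> m0 xy ax bx; rewrite /block_grp /mkset upE // !mx3E subrr !ideal0 idealN.
by rewrite ideal_conj !ideal1.
Qed.

Lemma block_grp_dg a b a' b' m x y : unitE x -> y * conj y = 1 ->
  in_ideal m (y - 1) -> block_grp a b a' b' m (dg x y).
Proof.
move=> ux y1 my; rewrite /block_grp /mkset dgE ?unit_neq0 // !mx3E !ideal0 my.
by rewrite !unit_ideal0 // unitV unit_conj.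
Qed.

Lemma det_lo x y : skew_pair x y -> \det (u3_mx (lo x y)) = 1.
Proof. by move=> xy; rewrite loE // det_mx3 !mx3E; ring. Qed.

Lemma det_up x y : skew_pair x y -> \det (u3_mx (up x y)) = 1.
Proof. by move=> xy; rewrite upE // det_mx3 !mx3E; ring. Qed.

Lemma det_dg x y : x != 0 -> y * conj y = 1 ->
  \det (u3_mx (dg x y)) = x * y / conj x.
Proof. by move=> x0 y1; rewrite dgE // det_mx3 !mx3E; ring. Qed.

Lemma det_weyl x : x != 0 -> conj x = x -> \det (u3_mx (weyl x)) = -1.
Proof. by move=> x0 cx; rewrite weylE // det_mx3 !mx3E; field. Qed.

Lemma u3_detM g h : \det (u3_mx (g * h)%g) = \det (u3_mx g) * \det (u3_mx h).
Proof. exact: det_mulmx. Qed.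

Lemma u3_det_neq0 g : \det (u3_mx g) != 0.
Proof. by rewrite -unitfE -unitmxE; case: g => M /= /andP[]. Qed.

Lemma Kgrp_wf n : block_wf 0 (- n%:Z) n n n.
Proof. by do 2!split; lia. Qed.

Lemma KgrpM n g h : Kgrp n g -> Kgrp n h -> Kgrp n (g * h)%g.
Proof. exact: (block_grpM (Kgrp_wf n)). Qed.

Lemma KgrpV n g : Kgrp n g -> Kgrp n g^-1%g.
Proof. exact: block_grpV. Qed.

End Subgroups.

(** * Bottom rows and the cells B gamma_i K_n *)

Section BottomRow.
Context (D : unramified_quadratic) (w : uqF D) (hw : is_uniformizer w).
Local Notation E := (uqE D).
Local Notation conj := (@uq_conj D).
Local Notation v := (lval (uqE_local D)).
Local Notation G := (u3 D).
Local Notation W := (w%:A : E).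
Implicit Types (g h b k : G) (x y z c : E).

Lemma unif_neq0 : W != 0.
Proof. by rewrite -in_algE fmorph_eq0; case: hw. Qed.

Lemma unifX_neq0 (i : int) : W ^ i != 0.
Proof. by rewrite expfz_neq0 // unif_neq0. Qed.

Lemma conj_unifX (i : int) : conj (W ^ i) = W ^ i.
Proof. by rewrite fmorphXz /= conj_alg. Qed.

Lemma lval_unifX (i : int) : v (W ^ i) = i.
Proof. by rewrite lvalXz ?unif_neq0 // uqE_unramified ?(hw.1) // hw.2 mulr1. Qed.

Lemma ideal_unifX (n i : int) : in_ideal n (W ^ i) = (n <= i).
Proof. by rewrite idealE ?unifX_neq0 // lval_unifX. Qed.

Lemma idealM_unifX (n i : int) x : in_ideal n (x * W ^ i) = in_ideal (n - i) x.
Proof.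
have [->|x0] := eqVneq x 0; first by rewrite mul0r !ideal0.
by rewrite !idealE ?mulf_neq0 ?unifX_neq0 // lvalM ?unifX_neq0 // lval_unifX; lia.
Qed.

(** The bottom row determines the coset of B, and its scalar determines the outer diagonal entries
    of b by unitarity. The middle entry is invisible in the row and is recovered from the
    determinants. *)
Lemma row_borel g h c : c != 0 -> (forall j, u3_mx g 2 j = c * u3_mx h 2 j) ->
  exists b, [/\ borel b, g = (b * h)%g, u3_mx b 0 0 = (conj c)^-1
    & u3_mx b 1 1 = \det (u3_mx g) / \det (u3_mx h) * (conj c / c)].
Proof.
move=> c0 rows; pose b := (g * h^-1)%g.
have bE : g = (b * h)%g by rewrite /b -mulgA mulVg mulg1.
have b2 j : u3_mx b 2 j = c * (2 == j)%:R.
  rewrite u3_mulE !rows -!mulrA -!mulrDr -[in RHS]u3_oneE -(mulgV h).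
  by rewrite u3_mulE.
have b20 : u3_mx b 2 0 = 0 by rewrite b2 mulr0.
have b21 : u3_mx b 2 1 = 0 by rewrite b2 mulr0.
have b22 : u3_mx b 2 2 = c by rewrite b2 mulr1.
have b10 : u3_mx b 1 0 = 0.
  have := hermE b 0 0; rewrite b20 rmorph0 !mxE /= mulr0 mul0r add0r addr0.
  by move/eqP; rewrite mulf_eq0 fmorph_eq0 orbb => /eqP.
have cc0 : conj c != 0 by rewrite fmorph_eq0.
have b00 : u3_mx b 0 0 = (conj c)^-1.
  have := hermE b 2 0; rewrite b20 b22 b10 !mxE /= !mulr0 !add0r => cb.
  by apply: (mulfI cc0); rewrite cb mulfV.
exists b; split=> //.
  move=> i j; move: i j; do 2! apply: ord3P => //.
have h0 := u3_det_neq0 h.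
rewrite bE u3_detM mulfK // det_mx3 b00 b10 b20 b21 b22.
have alg (K : fieldType) (p q r s t u : K) : t != 0 -> u != 0 ->
    r = (t^-1 * (r * u - s * 0) - p * (0 * u - s * 0) + q * (0 * 0 - r * 0))
      * (t / u) by move=> t0 u0; field; rewrite t0 u0.
exact: alg.
Qed.

Lemma row_isotropic g :
  u3_mx g 2 0 * conj (u3_mx g 2 2) + u3_mx g 2 1 * conj (u3_mx g 2 1)
  + u3_mx g 2 2 * conj (u3_mx g 2 0) = 0.
Proof. by rewrite herm_rowE !mxE. Qed.

(** Scaled so as to end in 1, an isotropic row is the bottom row of a lower unipotent matrix; these
    are the two parameters of that matrix for [lo]. *)
Lemma isotropic_skew_pair x y z : z != 0 ->
  x * conj z + y * conj y + z * conj x = 0 -> skew_pair (- conj (y / z)) (x / z).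
Proof.
move=> z0 h; have cz0 : conj z != 0 by rewrite fmorph_eq0.
rewrite /skew_pair !(rmorphM, rmorphN, fmorphV) /= !conjK.
transitivity ((x * conj z + y * conj y + z * conj x) / (z * conj z)).
  have alg (K : fieldType) (p q r p' q' r' : K) : r != 0 -> r' != 0 ->
    p / r + p' / r' + - (q' / r') * - (q / r) =
    (p * r' + q * q' + r * p') / (r * r') by move=> *; field; apply/andP.
  exact: alg.
by rewrite h mul0r.
Qed.

Lemma row_skew_pair g : u3_mx g 2 2 != 0 ->
  skew_pair (- conj (u3_mx g 2 1 / u3_mx g 2 2)) (u3_mx g 2 0 / u3_mx g 2 2).
Proof. by move=> g22; apply: isotropic_skew_pair => //; apply: row_isotropic. Qed.

Lemma row_near g (n : nat) : u3_mx g 2 2 != 0 ->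
  in_ideal n (u3_mx g 2 0 / u3_mx g 2 2) ->
  in_ideal n (u3_mx g 2 1 / u3_mx g 2 2) ->
  exists k, [/\ Kgrp n k, \det (u3_mx k) = 1
    & forall j, u3_mx g 2 j = u3_mx g 2 2 * u3_mx k 2 j].
Proof.
move=> g22 n0 n1; have sp := row_skew_pair g22.
exists (lo (- conj (u3_mx g 2 1 / u3_mx g 2 2)) (u3_mx g 2 0 / u3_mx g 2 2)).
split; last 1 first.
- rewrite loE //; apply: ord3P; rewrite !mx3E ?rmorphN /= ?conjK ?opprK;
    by rewrite ?mulr1 // mulrC mulfVK.
- by rewrite KgrpE; apply: block_grp_lo => //; rewrite idealN ideal_conj.
- exact: det_lo.
Qed.

Lemma gammaE (i : int) :
  u3_mx (gamma w i) = mx3 1 0 0 (W ^ i) 1 0 (- ((W ^ i) ^+ 2 / 2)) (- W ^ i) 1.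
Proof. by []. Qed.

Lemma gammaVE (i : int) : u3_mx (gamma w i)^-1%g =
  mx3 1 0 0 (- W ^ i) 1 0 (- ((W ^ i) ^+ 2 / 2)) (W ^ i) 1.
Proof.
rewrite u3_invE gammaE !mx3E rmorph1 rmorph0 !rmorphN /= rmorphM fmorphV rmorphXn.
by rewrite /= conj_unifX conj2.
Qed.

Lemma det_gamma (i : int) : \det (u3_mx (gamma w i)) = 1.
Proof. by rewrite gammaE det_mx3 !mx3E; ring. Qed.

(** A diagonal element of K_n corrects the unit by which y / z differs from - W ^ i. The ratio x / z
    is then right up to a trace-zero element of p^n, which [lo 0 t] absorbs. The determinant is
    recorded because the argument of mu2 depends on it. *)
Lemma gamma_row_gen x y z (n : nat) (i : int) : z != 0 ->
  skew_pair (- conj (y / z)) (x / z) -> n%:Z <= i + i -> in_ideal n (x / z) ->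
  y != 0 -> v y = i + v z -> let c := - y / W ^ i in
  exists k, [/\ Kgrp n k,
    [/\ x = c * u3_mx (gamma w i * k)%g 2 0, y = c * u3_mx (gamma w i * k)%g 2 1
      & z = c * u3_mx (gamma w i * k)%g 2 2]
    & \det (u3_mx (gamma w i * k)%g) * (c / conj c) = z / conj z].
Proof.
move=> z0 sp ni n0 y0 vi c; have dg1 := det_gamma i; have gE := gammaE i.
have Wi := unifX_neq0 i; have cW := conj_unifX i.
have vW := lval_unifX i.
have iW2 u : in_ideal n (u * (W ^ i * W ^ i)) = in_ideal (n%:Z - i - i) u.
  by rewrite mulrA !idealM_unifX.
set X := W ^ i in c Wi cW vW gE iW2 *; clearbody X.
have cz0 : conj z != 0 by rewrite fmorph_eq0.
have c0 : c != 0 by rewrite mulf_neq0 ?oppr_eq0 // invr_neq0.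
have cc0 : conj c != 0 by rewrite fmorph_eq0.
have vc : v c = v z.
  rewrite lvalM ?oppr_eq0 ?invr_neq0 // lvalN // lvalV // vW vi.
  by move: (v z) => ?; ilia.
(* [e] is the unit with y / z = - e * W ^ i. *)
pose e := c / z.
have ue : unitE e.
  by rewrite /unitE mulf_neq0 ?invr_neq0 //= lvalM ?invr_neq0 // lvalV // vc subrr.
have ua : unitE (conj e) by rewrite unit_conj.
have e0 := unit_neq0 ue; have ce0 := unit_neq0 ua.
have yE : y = - c * X by rewrite /c; field.
have zE : z = c / e by rewrite /e invf_div mulrC divfK.
clearbody e; clearbody c.
have [t ct tE] := skew_pair_split sp.
have st := skew_pair_skew ct.
have one1 : 1 * conj 1 = 1 :> E by rewrite rmorph1 mulr1.
have hn : half_norm (- conj (y / z)) = - (conj e * e) * (X * X) / 2.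
  rewrite /half_norm yE zE !(rmorphM, rmorphN, fmorphV) /= !(conjK, cW).
  have alg (K : fieldType) (p p' q q' r : K) : (2 : K) != 0 -> p != 0 ->
      p' != 0 -> q != 0 -> q' != 0 ->
    - (- (- p' * r / (p' / q')) * - (- p * r / (p / q))) / 2 =
    - (q' * q) * (r * r) / 2.
    by move=> *; field; do ?[apply/andP; split].
  by apply: alg => //; exact: two_neq0.
(* t is x / z minus the [half_norm] of an element of valuation i; the latter lies in p^(2i), inside
   p^n. *)
have nt : in_ideal n t.
  have -> : t = x / z + (conj e * e) * (X * X) / 2 by rewrite tE hn; ring.
  apply: ideal_add => //; rewrite ideal_half iW2.
  by apply: ideal_le (unit_ideal0 (unitM ua ue)); ilia.
have xE : x = c / e * (- (conj e * e) * (X * X) / 2 + t).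
  by rewrite -hn -tE -zE mulrC divfK.
exists (dg (conj e) 1 * lo 0 t)%g; split.
- apply: KgrpM.
    by rewrite KgrpE; apply: block_grp_dg => //; rewrite subrr ideal0.
  by rewrite KgrpE; apply: block_grp_lo => //; rewrite ?ideal0.
- rewrite !mulgA !u3_mulE gE dgE // loE // !mx3E conjK rmorph0 xE yE zE.
  split; first by field; rewrite ?two_neq0 ?e0.
    by ring.
  by ring.
- rewrite !u3_detM dg1 det_dg // det_lo // conjK zE.
  rewrite !(rmorphM, fmorphV) /=.
  have alg (K : fieldType) (p p' q q' : K) : p' != 0 -> q != 0 -> q' != 0 ->
    1 * (q' * 1 / q * 1) * (p / p') = p / q / (p' / q').
    by move=> *; field; do ?[apply/andP; split].
  exact: alg.
Qed.

Lemma gamma_row g (n : nat) (i : int) : u3_mx g 2 2 != 0 ->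
  n%:Z <= i + i ->
  in_ideal n (u3_mx g 2 0 / u3_mx g 2 2) ->
  u3_mx g 2 1 != 0 -> v (u3_mx g 2 1) = i + v (u3_mx g 2 2) ->
  let c := - u3_mx g 2 1 / W ^ i in
  exists k, [/\ Kgrp n k, forall j, u3_mx g 2 j = c * u3_mx (gamma w i * k)%g 2 j
    & \det (u3_mx (gamma w i * k)%g) * (c / conj c) =
      u3_mx g 2 2 / conj (u3_mx g 2 2)].
Proof.
move=> g22 ni n0 g21 vi c.
have [k [kK [r0 r1 r2] dk]] := gamma_row_gen g22 (row_skew_pair g22) ni n0 g21 vi.
by exists k; split=> //; apply: ord3P.
Qed.

Lemma uphalf_leP (n : nat) (i : int) : (uphalf n)%:Z <= i <-> n%:Z <= i + i.
Proof. split; lia. Qed.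

Lemma gamma_cell g (n : nat) : u3_mx g 2 2 != 0 ->
  in_ideal n (u3_mx g 2 0 / u3_mx g 2 2) ->
  exists (i : int) b k, [/\ (uphalf n)%:Z <= i <= n%:Z, borel b, Kgrp n k
    & g = (b * gamma w i * k)%g].
Proof.
move=> g22 n0; have [n1|n1] := boolP (in_ideal n (u3_mx g 2 1 / u3_mx g 2 2)).
  have [k [kK _ rows]] := row_near g22 n0 n1.
  have [b [bB gE _ _]] := row_borel g22 rows.
  (* gamma_n lies in K_n, so the cell of the identity is the cell i = n. *)
  exists n%:Z, b, ((gamma w n%:Z)^-1 * k)%g; split=> //; first ilia.
    apply: KgrpM => //; apply: KgrpV; rewrite KgrpE.
    rewrite /block_grp /mkset gammaE !mx3E subrr !ideal0 !idealN ideal_half.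
    by rewrite expr2 idealM_unifX !ideal_unifX !ideal1 //; split; split=> //; ilia.
  by rewrite -mulgA [(gamma w n%:Z * _)%g]mulgA mulgV mul1g.
have g21 : u3_mx g 2 1 != 0.
  by apply: contraNneq n1 => ->; rewrite mul0r ideal0.
set i := v (u3_mx g 2 1) - v (u3_mx g 2 2).
have v1 : v (u3_mx g 2 1 / u3_mx g 2 2) = i.
  by rewrite lvalM ?invr_neq0 // lvalV.
have vi : v (u3_mx g 2 1) = i + v (u3_mx g 2 2) by rewrite /i addrNK.
clearbody i.
have q0 : u3_mx g 2 1 / u3_mx g 2 2 != 0 by rewrite mulf_neq0 ?invr_neq0.
have iltn : i < n by move: n1; rewrite idealE // v1 -ltNge.
(* By isotropy the norm of g21 / g22, of valuation 2i, is minus the trace of g20 / g22, which lies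
   in p^n. *)
have ni : n%:Z <= i + i.
  have sp := row_skew_pair g22.
  have : in_ideal n ((u3_mx g 2 1 / u3_mx g 2 2) * conj (u3_mx g 2 1 / u3_mx g 2 2)).
    have := ideal_add n0 (_ : in_ideal n (conj (u3_mx g 2 0 / u3_mx g 2 2))).
    rewrite ideal_conj => /(_ n0); rewrite -idealN; congr in_ideal.
    move: sp; rewrite /skew_pair rmorphN /= conjK.
    move: (_ / _) (_ / _) => x y xy; apply/eqP; rewrite -subr_eq0 -oppr_eq0 -xy.
    by apply/eqP; ring.
  move: q0 v1; move: (_ / _) => q q0 v1.
  by rewrite idealE ?mulf_neq0 ?fmorph_eq0 // lvalM ?fmorph_eq0 // lval_conj // v1.
have [k [kK rows _]] := gamma_row g22 ni n0 g21 vi.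
have [|b [bB gE _ _]] := row_borel _ rows.
  by rewrite mulf_neq0 ?oppr_eq0 // invr_neq0 ?unifX_neq0.
exists i, b, k; split=> //; last by rewrite -mulgA.
by apply/andP; split; [apply/uphalf_leP | apply: ltW].
Qed.

Lemma weyl_sq x : x != 0 -> conj x = x -> (weyl x * weyl x)%g = 1%g.
Proof.
move=> x0 cx; apply: u3_ext; split; rewrite u3_mulE u3_oneE weylE // !mx3E /=
  ?(mul0r, mulr0, addr0, add0r, mulr1, mulfV, mulVf) //.
Qed.

Lemma weylV x : x != 0 -> conj x = x -> (weyl x)^-1%g = weyl x.
Proof.
by move=> x0 cx; rewrite -[LHS]mul1g -(weyl_sq x0 cx) -mulgA mulgV mulg1.
Qed.

Lemma weyl_K (n : nat) : Kgrp n (weyl (W ^ n%:Z)).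
Proof.
rewrite KgrpE /block_grp /mkset weylE ?conj_unifX ?unifX_neq0 // !mx3E subrr.
by rewrite !ideal0 invr_expz !ideal_unifX; split; split=> //; ilia.
Qed.

(** When [gamma_cell] does not apply to g, a Weyl element of K_n exchanges g20 and g22 up to powers
    of w, and it applies to the product. *)
Lemma gamma_decomposition g (n : nat) :
  exists (i : int) b k, [/\ (uphalf n)%:Z <= i <= n%:Z, borel b, Kgrp n k
    & g = (b * gamma w i * k)%g].
Proof.
have [/andP[g22 n0]|far] := boolP ((u3_mx g 2 2 != 0) &&
    in_ideal n (u3_mx g 2 0 / u3_mx g 2 2)); first exact: gamma_cell.
have Wn := unifX_neq0 n; have cW := conj_unifX n.
pose s := weyl (W ^ n%:Z); have ss : (s * s = 1)%g by apply: weyl_sq.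
have gs : u3_mx (g * s)%g 2 0 = u3_mx g 2 2 * W ^ n%:Z /\
    u3_mx (g * s)%g 2 2 = u3_mx g 2 0 / W ^ n%:Z.
  by rewrite !u3_mulE weylE // !mx3E; split; ring.
have g20 : u3_mx g 2 0 != 0.
  (* If g20 = 0 then g22 <> 0, since otherwise isotropy would annihilate the whole bottom row; so g
     is in the case already treated. *)
  apply: contraNneq far => g20; rewrite g20 mul0r ideal0 andbT.
  apply/eqP => g22; have := row_isotropic g; rewrite g20 g22 rmorph0.
  rewrite !mul0r add0r addr0 => /eqP; rewrite mulf_eq0 fmorph_eq0 orbb => /eqP g21.
  have /eqP := u3_det_neq0 g; apply; rewrite det_mx3 g20 g21 g22; ring.
have gs22 : u3_mx (g * s)%g 2 2 != 0.
  by rewrite gs.2 mulf_neq0 ?invr_neq0.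
have gs0 : in_ideal n (u3_mx (g * s)%g 2 0 / u3_mx (g * s)%g 2 2).
  rewrite gs.1 gs.2; move: far g20; move: (u3_mx g 2 2) (u3_mx g 2 0) => y x far x0.
  have [->|y0] := eqVneq y 0; first by rewrite !mul0r ideal0.
  have q0 : x / y != 0 by rewrite mulf_neq0 ?invr_neq0.
  have q'0 : y * W ^ n%:Z / (x / W ^ n%:Z) != 0.
    by rewrite !mulf_neq0 ?invr_neq0 ?mulf_neq0 ?invr_neq0.
  move: far; rewrite y0 /= (idealE _ q0) (idealE _ q'0) invf_div.
  rewrite !lvalM ?mulf_neq0 ?invr_neq0 // !lvalV // lval_unifX //.
  by move: (v y) (v x) => *; ilia.
have [i [b [k [hi bB kK gsE]]]] := gamma_cell gs22 gs0.
exists i, b, (k * s)%g; split=> //.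
  by apply: KgrpM => //; apply: weyl_K.
by rewrite mulgA -gsE -mulgA ss mulg1.
Qed.

End BottomRow.

(** * Values of B-equivariant, K_n-invariant functions, read off bottom row and determinant *)

Section InducedFunctions.
Local Open Scope complex_scope.
Context (R : realType) (D : unramified_quadratic).
Context (w : uqF D) (hw : is_uniformizer w).
Local Notation E := (uqE D).
Local Notation C := R[i].
Local Notation conj := (@uq_conj D).
Local Notation v := (lval (uqE_local D)).
Local Notation G := (u3 D).
Local Notation W := (w%:A : E).
Implicit Types (g h b k : G) (x y z c : E).

Lemma card_res_gt0 : (0 : R) < #|lres (uqE_local D)|%:R.
Proof. by rewrite ltr0n; apply/card_gt0P; exists 0. Qed.

Lemma absE_gt0 x : x != 0 -> 0 < absE R x.
Proof. by move=> x0; rewrite /absE (negPf x0) exprz_gt0 // card_res_gt0. Qed.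

Lemma absE_ge0 x : 0 <= absE R x.
Proof.
by have [->|/absE_gt0/ltW //] := eqVneq x 0; rewrite /absE eqxx.
Qed.

Lemma absE_unit x : unitE x -> absE R x = 1.
Proof. by case/andP=> x0 /eqP vx; rewrite /absE (negPf x0) vx oppr0 expr0z. Qed.

Section MulChar.
Context (A : set E) (chi : E -> C) (hchi : mul_char_on A chi) (A1 : A 1).

Lemma mul_char1 : chi 1 = 1.
Proof.
have [nz mM _] := hchi; apply: (mulfI (nz _ A1)).
by rewrite -mM // !mulr1.
Qed.

Lemma mul_charV x : A x -> A x^-1 -> x != 0 -> chi x^-1 = (chi x)^-1.
Proof.
move=> Ax AVx x0; have [nz mM _] := hchi; apply: (mulfI (nz _ Ax)).
by rewrite -mM // mulfV // mulfV ?mul_char1 //; apply: nz.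
Qed.

End MulChar.

Context (mu1 mu2 : E -> C).
Context (hmu1 : mul_char_on (@Estar D) mu1) (hmu2 : mul_char_on (@E1 D) mu2).

Lemma Estar1 : @Estar D 1.
Proof. exact: oner_neq0. Qed.

Lemma E11 : @E1 D 1.
Proof. by rewrite /E1 /= rmorph1 mulr1. Qed.

Context (f : G -> C).
Hypothesis equivariant : forall b g, borel b ->
  f (b * g)%g = (Num.sqrt (delta_B R b))%:C * mu_B mu1 mu2 b * f g.

Lemma equivariantE b g : borel b -> f (b * g)%g =
  (absE R (u3_mx b 0 0))%:C * (mu1 (u3_mx b 0 0) * mu2 (u3_mx b 1 1)) * f g.
Proof.
by move=> bB; rewrite equivariant // /delta_B sqrtr_sqr ger0_norm ?absE_ge0.
Qed.

Lemma row_value g h c : c != 0 -> (forall j, u3_mx g 2 j = c * u3_mx h 2 j) ->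
  f g = (absE R (conj c)^-1)%:C * (mu1 (conj c)^-1 *
    mu2 (\det (u3_mx g) / \det (u3_mx h) * (conj c / c))) * f h.
Proof.
move=> c0 /(row_borel c0)[b [bB -> b00 b11]].
by rewrite equivariantE // b00 b11.
Qed.

Lemma row_value1 g h : (forall j, u3_mx g 2 j = u3_mx h 2 j) ->
  \det (u3_mx g) = \det (u3_mx h) -> f g = f h.
Proof.
move=> rows dets; rewrite (@row_value g h 1) ?oner_neq0 //; last first.
  by move=> j; rewrite mul1r.
rewrite dets divff ?u3_det_neq0 // rmorph1 divr1 mulr1 invr1.
rewrite absE_unit ?unit1 // (mul_char1 hmu1 Estar1) (mul_char1 hmu2 E11).
by rewrite !mul1r.
Qed.

Context (n : nat) (Kinv : forall g k, Kgrp n k -> f (g * k)%g = f g).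

Lemma value_near1 g : u3_mx g 2 2 = 1 -> \det (u3_mx g) = 1 ->
  in_ideal n (u3_mx g 2 0) -> in_ideal n (u3_mx g 2 1) -> f g = f 1%g.
Proof.
move=> g22 dg1; have g22n : u3_mx g 2 2 != 0 by rewrite g22 oner_neq0.
rewrite -[u3_mx g 2 0]divr1 -[u3_mx g 2 1]divr1 -g22 => n0 n1.
have [k [kK kd rows]] := row_near g22n n0 n1.
rewrite (@row_value1 g k) ?kd // ?dg1 //; last first.
  by move=> j; rewrite rows g22 mul1r.
by rewrite -(Kinv 1%g kK) mul1g.
Qed.

Lemma value_gamma g (i : int) : u3_mx g 2 2 != 0 -> n%:Z <= i + i ->
  in_ideal n (u3_mx g 2 0 / u3_mx g 2 2) ->
  u3_mx g 2 1 != 0 -> v (u3_mx g 2 1) = i + v (u3_mx g 2 2) ->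
  let c := conj (- u3_mx g 2 1 / W ^ i) in
  f g = (absE R c^-1)%:C * (mu1 c^-1 *
    mu2 (\det (u3_mx g) * (conj (u3_mx g 2 2) / u3_mx g 2 2))) * f (gamma w i).
Proof.
move=> g22 ni n0 g21 vi c; have [k [kK rows dets]] := gamma_row hw g22 ni n0 g21 vi.
have c0 : - u3_mx g 2 1 / W ^ i != 0.
  by rewrite mulf_neq0 ?oppr_eq0 // invr_neq0 ?unifX_neq0.
rewrite (row_value c0 rows) Kinv //; congr (_ * (_ * mu2 _) * _).
rewrite -mulrA; congr (_ * _); apply: invr_inj.
by rewrite invfM invrK invf_div dets invf_div.
Qed.

(** The conjugate of [dg x 1] by gamma_i lies in K_n. Moving it across gamma_i therefore multiplies
    the value by mu1 x on one side and by 1 on the other. *)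
Lemma cond_mu1_of_value (i : int) x : n%:Z <= i + i -> i <= n ->
  f (gamma w i) != 0 -> unitE x -> in_ideal (n%:Z - i) (x - 1) -> mu1 x = 1.
Proof.
move=> ni iltn fi ux nx; have x0 := unit_neq0 ux.
have one1 : 1 * conj 1 = 1 :> E by rewrite rmorph1 mulr1.
pose k := ((gamma w i)^-1 * (dg x 1 * gamma w i))%g.
have ux' : unitE (conj x)^-1 by rewrite unitV unit_conj.
have nx' : in_ideal (n%:Z - i) ((conj x)^-1 - 1).
  have -> : (conj x)^-1 - 1 = - conj (x - 1) / conj x.
    rewrite rmorphB rmorph1 /= mulNr mulrBl mulfV ?fmorph_eq0 //.
    by rewrite mul1r opprB.
  by rewrite idealV ?unit_conj // idealN ideal_conj.
have kK : Kgrp n k.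
  have iX z : in_ideal n (z * W ^ i) = in_ideal (n%:Z - i) z.
    exact: idealM_unifX.
  have X0 : in_ideal 0 (W ^ i) by rewrite ideal_unifX //; ilia.
  have gE := gammaE w i; have gVE := gammaVE w i; have dE := dgE x0 one1.
  rewrite KgrpE /block_grp /mkset /k !u3_mulE gE gVE dE !mx3E.
  set X := W ^ i in iX X0 *; set x' := (conj x)^-1 in ux' nx' *.
  clear gE gVE dE k; clearbody X x'.
  rewrite !(mul0r, mulr0, mul1r, mulr1, addr0, add0r, oppr0, subrr) !ideal0.
  rewrite !unit_ideal0 //; split; split=> //.
  - have -> : - X * x + X = - ((x - 1) * X) by ring.
    by rewrite idealN iX.
  - have -> : - (X ^+ 2 / 2) * x + X * X + x' * - (X ^+ 2 / 2) =
       - (((x - 1) + (x' - 1)) * X * X) / 2.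
      have alg (K : fieldType) (p p' q : K) : (2 : K) != 0 ->
        - (q ^+ 2 / 2) * p + q * q + p' * - (q ^+ 2 / 2) =
        - (((p - 1) + (p' - 1)) * q * q) / 2 by move=> *; field.
      by apply: alg; exact: two_neq0.
    rewrite ideal_half idealN; apply: (idealM _ X0); last first.
      by rewrite addr0.
    by rewrite iX ideal_add.
  - have -> : X + x' * - X = - ((x' - 1) * X) by ring.
    by rewrite idealN iX.
have dB : borel (dg x 1).
  by move=> i' j; move: i' j; do 2! apply: ord3P => //; rewrite dgE // !mx3E.
have := Kinv (gamma w i) kK; rewrite /k mulgA mulgV mul1g equivariantE //.
rewrite dgE // !mx3E absE_unit // (mul_char1 hmu2 E11) mulr1 mul1r => h.
by apply: (mulIf fi); rewrite h mul1r.
Qed.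

(* In the Hermitian plane spanned by e_0 and e_2, the element k below fixes the
   projection of the bottom row of gamma_i and multiplies its orthogonal by x. *)
Lemma cond_mu2_of_value (i : int) x : n%:Z <= i + i ->
  f (gamma w i) != 0 -> E1 x -> in_ideal (i + i - n%:Z) (x - 1) -> mu2 x = 1.
Proof.
move=> ni fi x1 nx; pose X := W ^ i; have X0 : X != 0 := unifX_neq0 hw i.
have cX : conj X = X := conj_unifX w i.
have x0 : x != 0.
  by apply: contra_eq_neq x1 => ->; rewrite mul0r eq_sym oner_neq0.
have cx : conj x = x^-1 by apply: (mulfI x0); rewrite x1 mulfV.
(* a, b, c solve: the row (- X ^ 2 / 2, 0, 1) is fixed by M and the row (X ^ 2 / 2, 0, 1) is
   multiplied by x. *)
pose a := (x + 1) / 2; pose b := (x - 1) / X ^+ 2.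
pose c := (x - 1) * X ^+ 2 / 2 / 2; pose M := mx3 a 0 b 0 1 0 c 0 a.
have cX2 : conj (X ^+ 2) = X ^+ 2 by rewrite rmorphXn /= cX.
have ca : conj a = (x^-1 + 1) / 2.
  by rewrite rmorphM fmorphV rmorphD rmorph1 /= conj2 cx.
have cb : conj b = (x^-1 - 1) / X ^+ 2.
  by rewrite rmorphM fmorphV /= cX2 rmorphB rmorph1 /= cx.
have cc : conj c = (x^-1 - 1) * X ^+ 2 / 2 / 2.
  rewrite 3!rmorphM fmorphV /= conj2 cX2 rmorphB rmorph1 /= cx.
  by [].
have [ac aa bc ba] : [/\ conj a * c + conj c * a = 0, conj a * a + conj c * b = 1,
    conj b * c + conj a * a = 1 & conj b * a + conj a * b = 0].
  rewrite ca cb cc /a /b /c.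
  have alg (K : fieldType) (p q : K) : (2 : K) != 0 -> p != 0 -> q != 0 ->
    [/\ (p^-1 + 1) / 2 * ((p - 1) * q ^+ 2 / 2 / 2)
         + (p^-1 - 1) * q ^+ 2 / 2 / 2 * ((p + 1) / 2) = 0,
       (p^-1 + 1) / 2 * ((p + 1) / 2)
         + (p^-1 - 1) * q ^+ 2 / 2 / 2 * ((p - 1) / q ^+ 2) = 1,
       (p^-1 - 1) / q ^+ 2 * ((p - 1) * q ^+ 2 / 2 / 2)
         + (p^-1 + 1) / 2 * ((p + 1) / 2) = 1 &
       (p^-1 - 1) / q ^+ 2 * ((p + 1) / 2)
         + (p^-1 + 1) / 2 * ((p - 1) / q ^+ 2) = 0].
    by move=> *; split; field; do ?[apply/andP; split].
  exact: alg (two_neq0 D) x0 X0.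
have kE : u3_mx (mk_u3 M) = M.
  apply: mk_u3E; do 2! apply: ord3P; rewrite !mx3E ?rmorph0 ?rmorph1;
    by rewrite ?(mul0r, mulr0, mul1r, addr0, add0r).
have kd : \det (u3_mx (mk_u3 M)) = x.
  rewrite kE det_mx3 !mx3E /a /b /c.
  have alg (K : fieldType) (p q : K) : (2 : K) != 0 -> q != 0 ->
    (p + 1) / 2 * (1 * ((p + 1) / 2) - 0 * 0) - 0 * (0 * ((p + 1) / 2)
     - 0 * ((p - 1) * q ^+ 2 / 2 / 2))
    + (p - 1) / q ^+ 2 * (0 * 0 - 1 * ((p - 1) * q ^+ 2 / 2 / 2)) = p.
    by move=> *; field; do ?[apply/andP; split].
  exact: alg (two_neq0 D) X0.
have i2 : in_ideal 0 a.
  rewrite ideal_half; have -> : x + 1 = (x - 1) + 2 by ring.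
  by apply: ideal_add; [apply: ideal_le nx; ilia | exact: unit_ideal0 (unit2 _)].
have XX z : z * X ^+ 2 = z * W ^ i * W ^ i by rewrite expr2 mulrA.
have kK : Kgrp n (mk_u3 M).
  rewrite KgrpE /block_grp /mkset kE !mx3E subrr !ideal0.
  split; split=> //.
    have -> : b = (x - 1) * W ^ (- i) * W ^ (- i).
      by rewrite /b expr2 -invr_expz invfM mulrA.
    by rewrite !idealM_unifX //; apply: ideal_le nx; ilia.
  rewrite /c !ideal_half XX !idealM_unifX //; apply: ideal_le nx; ilia.
have rows j : u3_mx (gamma w i * mk_u3 M)%g 2 j = 1 * u3_mx (gamma w i) 2 j.
  rewrite u3_mulE kE gammaE -/X /a /b /c; move: j; apply: ord3P; rewrite !mx3E.
  - have alg (K : fieldType) (p q : K) : (2 : K) != 0 ->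
      - (q ^+ 2 / 2) * ((p + 1) / 2) + - q * 0 + 1 * ((p - 1) * q ^+ 2 / 2 / 2)
      = 1 * (- (q ^+ 2 / 2)) by move=> *; field.
    exact: alg (two_neq0 D).
  - ring.
  - have alg (K : fieldType) (p q : K) : (2 : K) != 0 -> q != 0 ->
      - (q ^+ 2 / 2) * ((p - 1) / q ^+ 2) + - q * 0 + 1 * ((p + 1) / 2) = 1 * 1.
      by move=> *; field; do ?[apply/andP; split].
    exact: alg (two_neq0 D) X0.
(* The bottom row of gamma_i is unchanged, so the element acts only through its determinant x, as
   argument of mu2. *)
have := Kinv (gamma w i) kK; rewrite (row_value (oner_neq0 _) rows).
have -> : \det (u3_mx (gamma w i * mk_u3 M)%g) / \det (u3_mx (gamma w i))
    * (conj 1 / 1) = x.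
  by rewrite u3_detM det_gamma kd rmorph1 !divr1 mul1r mulr1.
rewrite rmorph1 invr1 absE_unit ?unit1 // (mul_char1 hmu1 Estar1) !mul1r => h.
by apply: (mulIf fi); rewrite h mul1r.
Qed.

End InducedFunctions.

(** * Coset decompositions *)

Section Cosets.
Context (D : unramified_quadratic) (w : uqF D) (hw : is_uniformizer w).
Local Notation E := (uqE D).
Local Notation conj := (@uq_conj D).
Local Notation v := (lval (uqE_local D)).
Local Notation k := (lres (uqE_local D)).
Local Notation G := (u3 D).
Local Notation W := (w%:A : E).
Implicit Types (g h : G) (x y z : E) (e m : int).

(** Representatives of p^e modulo p^(e+1); [skew_digit] does the same for trace-zero elements. *)
Definition digit e (a : k) : E := residue_lift a * W ^ e.

Definition skew_digit e (a : skew_residue D) : E := skew_lift (val a) * W ^ e.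

Lemma digit_ideal e a : in_ideal e (digit e a).
Proof. by rewrite idealM_unifX // subrr residue_lift_ideal. Qed.

Lemma digit_inj e a b : in_ideal (e + 1) (digit e a - digit e b) -> a = b.
Proof.
rewrite -mulrBl idealM_unifX // addrC addKr; exact: residue_lift_inj.
Qed.

Lemma digitP e x : in_ideal e x -> exists a, in_ideal (e + 1) (x - digit e a).
Proof.
move=> ex; pose t := x * W ^ (- e).
have tE : x = t * W ^ e by rewrite /t -mulrA -expfzDr ?unif_neq0 // addNr mulr1.
have t0 : in_ideal 0 t by rewrite idealM_unifX // sub0r opprK.
exists (lred _ t); rewrite {1}tE -mulrBl idealM_unifX // addrC addKr.
exact: residue_liftP.
Qed.

Lemma skew_digit_ideal e a : in_ideal e (skew_digit e a).
Proof. by rewrite idealM_unifX // subrr skew_lift_ideal. Qed.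

Lemma conj_skew_digit e a : conj (skew_digit e a) = - skew_digit e a.
Proof. by rewrite rmorphM /= conj_skew_lift conj_unifX mulNr. Qed.

Lemma skew_digit_inj e a b :
  in_ideal (e + 1) (skew_digit e a - skew_digit e b) -> a = b.
Proof.
rewrite -mulrBl idealM_unifX // addrC addKr; exact: skew_lift_inj.
Qed.

Lemma skew_digitP e x : in_ideal e x -> conj x = - x ->
  exists a, in_ideal (e + 1) (x - skew_digit e a).
Proof.
move=> ex cx; pose t := x * W ^ (- e).
have tE : x = t * W ^ e by rewrite /t -mulrA -expfzDr ?unif_neq0 // addNr mulr1.
have t0 : in_ideal 0 t by rewrite idealM_unifX // sub0r opprK.
have [|a ha] := skew_liftP t0.
  by rewrite /t rmorphM /= conj_unifX cx mulNr.
by exists a; rewrite {1}tE -mulrBl idealM_unifX // addrC addKr.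
Qed.

(** x differs from its trace-zero part (x - conj x) / 2 by half its trace, which is negligible
    here. *)
Lemma skew_digit_near e x : in_ideal e x -> in_ideal (e + 1) (x + conj x) ->
  exists a, in_ideal (e + 1) (x - skew_digit e a).
Proof.
move=> ex tx; have [||a ha] := @skew_digitP e ((x - conj x) / 2).
- by rewrite ideal_half idealB ?ideal_conj.
- rewrite rmorphM fmorphV /= conj2 rmorphB /= conjK.
  by rewrite -mulNr opprB.
exists a; have := ideal_add ha (_ : in_ideal _ ((x + conj x) / 2)).
rewrite ideal_half => /(_ tx); congr in_ideal.
by move: (skew_digit _ _) (conj x) => *; field; exact: two_neq0.
Qed.

Lemma loVE x y : skew_pair x y ->
  u3_mx (lo x y)^-1%g = mx3 1 0 0 (- x) 1 0 (conj y) (conj x) 1.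
Proof.
by move=> xy; rewrite u3_invE loE // !mx3E rmorph0 rmorph1 rmorphN /= conjK.
Qed.

Lemma upVE x y : skew_pair x y ->
  u3_mx (up x y)^-1%g = mx3 1 (- x) (conj y) 0 1 (conj x) 0 0 1.
Proof.
by move=> xy; rewrite u3_invE upE // !mx3E rmorph0 rmorph1 rmorphN /= conjK.
Qed.

Lemma skew_pair_half x : skew_pair x (half_norm x).
Proof.
by rewrite -[half_norm x]addr0; apply: skew_pair_half_norm; rewrite rmorph0 oppr0.
Qed.

(** Unitarity makes the norm of g11 equal to 1 up to products of the (0,1) and (2,1) entries, which
    lie in p because x + x' > 0. *)
Lemma block_unit11 (x z x' z' : int) m g : block_wf x z x' z' m -> 0 < x + x' ->
  block_grp x z x' z' m g -> unitE (u3_mx g 1 1).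
Proof.
move=> wf xx gB; have g11 := block_near1 wf gB.
case: gB => -[_ g01 _] [_ _ _] [_ g21 _].
have := hermE g 1 1; rewrite mx3E; move: g01 g21 g11.
move: (u3_mx g 0 1) (u3_mx g 1 1) (u3_mx g 2 1) => a b c a1 c1 b0 h.
have n1 : in_ideal 1 (conj b * b - 1).
  have -> : conj b * b - 1 = - (conj a * c + conj c * a) by rewrite -h; ring.
  rewrite idealN; apply: ideal_add.
    by apply: idealM c1 _; [rewrite ideal_conj; exact: a1 | ilia].
  by apply: (idealM _ a1); [rewrite ideal_conj; exact: c1 | ilia].
have := unit_near (unit1 D) n1; rewrite !unit_ideal b0 => /andP[_].
by apply: contra => b1; apply: (idealM _ b1); [rewrite ideal_conj; exact: b0 | ].
Qed.

(* Membership in K_n is decided by the middle column, unitarity giving the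
   middle row. *)
Lemma block_of_column (n : nat) m g : unitE (u3_mx g 1 1) ->
  in_ideal 0 (u3_mx g 0 0) -> in_ideal 0 (u3_mx g 0 1) ->
  in_ideal (- n%:Z) (u3_mx g 0 2) -> in_ideal m (u3_mx g 1 1 - 1) ->
  in_ideal n (u3_mx g 2 0) -> in_ideal n (u3_mx g 2 1) ->
  in_ideal 0 (u3_mx g 2 2) -> block_grp 0 (- n%:Z) n n m g.
Proof.
move=> u11 g00 g01 g02 g11 g20 g21 g22.
have h10 := hermE g 1 0; have h12 := hermE g 1 2; rewrite !mx3E in h10 h12.
have uc11 : unitE (conj (u3_mx g 1 1)) by rewrite unit_conj.
rewrite -ideal_conj in g01; rewrite -ideal_conj in g21.
have g10 : in_ideal n (u3_mx g 1 0).
  rewrite -(idealMu _ _ uc11) mulrC; move: h10 g01 g20 g21 g00.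
  move: (conj (u3_mx g 0 1)) (u3_mx g 2 0) (conj (u3_mx g 1 1)).
  move: (u3_mx g 1 0) (conj (u3_mx g 2 1)) (u3_mx g 0 0).
  move=> d e f a b c h a0 bn en f0.
  have -> : c * d = - (a * b + e * f).
    by apply/eqP; rewrite -subr_eq0 -h; apply/eqP; ring.
  rewrite idealN ideal_add //.
    by apply: (idealM a0 bn); ilia.
  by apply: (idealM en f0); ilia.
have g12 : in_ideal 0 (u3_mx g 1 2).
  rewrite -(idealMu _ _ uc11) mulrC; move: h12 g01 g22 g21 g02.
  move: (conj (u3_mx g 0 1)) (u3_mx g 2 2) (conj (u3_mx g 1 1)).
  move: (u3_mx g 1 2) (conj (u3_mx g 2 1)) (u3_mx g 0 2).
  move=> d e f a b c h a0 bn en f0.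
  have -> : c * d = - (a * b + e * f).
    by apply/eqP; rewrite -subr_eq0 -h; apply/eqP; ring.
  rewrite idealN ideal_add //.
    by apply: (idealM a0 bn); ilia.
  by apply: (idealM en f0); ilia.
by rewrite !ideal_conj in g01 g21 *; split.
Qed.

Context (n : nat) (n2 : (2 <= n)%N).

(* Kplus and Kprev are K_n and K_(n-1) with the (1,1) congruence relaxed to
   modulus n-2; Hgrp is so obtained from the conjugate of K_(n-2) by
   diag(w^-1, 1, w), which contains K_n, and Jgrp is the intersection of Kprev
   and Hgrp. *)
Definition Kplus : set G := block_grp 0 (- n%:Z) n n (n%:Z - 2).
Definition Kprev : set G := block_grp 0 (1 - n%:Z) (n%:Z - 1) (n%:Z - 1) (n%:Z - 2).
Definition Jgrp : set G := block_grp 0 (1 - n%:Z) (n%:Z - 1) n (n%:Z - 2).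
Definition Hgrp : set G := block_grp (-1) (- n%:Z) (n%:Z - 1) n (n%:Z - 2).

Lemma Kplus_wf : block_wf 0 (- n%:Z) n n (n%:Z - 2).
Proof. by do 2!split; ilia. Qed.
Lemma Kprev_wf : block_wf 0 (1 - n%:Z) (n%:Z - 1) (n%:Z - 1) (n%:Z - 2).
Proof. by do 2!split; ilia. Qed.
Lemma Jgrp_wf : block_wf 0 (1 - n%:Z) (n%:Z - 1) n (n%:Z - 2).
Proof. by do 2!split; ilia. Qed.
Lemma Hgrp_wf : block_wf (-1) (- n%:Z) (n%:Z - 1) n (n%:Z - 2).
Proof. by do 2!split; ilia. Qed.

(** These represent [Jgrp] modulo its intersection with [Kplus]. [Kplus] itself is not inside
    [Jgrp], which asks for one more power of p at (0,2). *)
Definition lo_rep (a : k) : G :=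
  let x := digit (n%:Z - 1) a in lo x (half_norm x).

Lemma lo_repE a : let x := digit (n%:Z - 1) a in
  u3_mx (lo_rep a) = mx3 1 0 0 x 1 0 (half_norm x) (- conj x) 1.
Proof. exact: loE (skew_pair_half _). Qed.

Lemma lo_rep_J a : Jgrp (lo_rep a).
Proof.
apply: block_grp_lo (skew_pair_half _) _ _; [ilia | exact: digit_ideal |].
by apply: ideal_le (ideal_half_norm (digit_ideal _ _)); ilia.
Qed.

Lemma lo_rep_cover g : Jgrp g -> exists a, Kplus ((lo_rep a)^-1 * g)%g.
Proof.
move=> gJ; have u11 : unitE (u3_mx g 1 1).
  by apply: (block_unit11 Jgrp_wf) => //; ilia.
have [[g00 g01 g02] [g10 g11 g12] [g20 g21 g22]] := gJ.
(* Up to p^n, left multiplication by the inverse of [lo_rep a] adds conj x * g11 to g21; the digit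
   is chosen to cancel the leading term. *)
have [|a ha] := @digitP (n%:Z - 1) (- conj (u3_mx g 2 1 / u3_mx g 1 1)).
  by rewrite idealN ideal_conj idealV.
exists a; set x := digit _ a in ha.
set h := ((lo_rep a)^-1 * g)%g.
have hJ : Jgrp h.
  by apply: (block_grpM Jgrp_wf) => //; apply: block_grpV (lo_rep_J a).
have uh : unitE (u3_mx h 1 1) by apply: (block_unit11 Jgrp_wf) => //; ilia.
have h21 : in_ideal n (u3_mx h 2 1).
  rewrite u3_mulE (loVE (skew_pair_half _)) !mx3E -/x mul1r.
  rewrite -addrA; apply: ideal_add.
    apply: (idealM _ g01); last by rewrite addr0; exact: lexx.
    rewrite ideal_conj; apply: ideal_le (ideal_half_norm (digit_ideal _ _)); ilia.
  move: ha u11; move: (u3_mx g 2 1) (u3_mx g 1 1) => p q.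
  rewrite addrNK => ha uq; rewrite -(idealV _ _ uq) mulrDl mulfK ?unit_neq0 //.
  by rewrite -ideal_conj -idealN rmorphD /= conjK opprD addrC.
have [[h00 h01 h02] [h10 h11 h12] [h20 _ h22]] := hJ.
by apply: block_of_column => //; apply: ideal_le h02; ilia.
Qed.

Lemma lo_rep_uniq a b : Kplus ((lo_rep a)^-1 * lo_rep b)%g -> a = b.
Proof.
move=> [_ [h10 _ _] _]; apply: (@digit_inj (n%:Z - 1)).
rewrite -idealN opprB addrNK; move: h10.
rewrite u3_mulE (loVE (skew_pair_half _)) lo_repE !mx3E.
by congr in_ideal; ring.
Qed.

(** Cosets of [Jgrp] in [Kprev] form a projective line with tau + 1 points: g20 / g00 gives the
    finite points, trace-zero classes, and the Weyl element is the point at infinity. *)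
Definition prev_rep (o : option (skew_residue D)) : G :=
  if o is Some a then lo 0 (skew_digit (n%:Z - 1) a) else weyl (W ^ (n%:Z - 1)).

Lemma prev_rep_K o : Kprev (prev_rep o).
Proof.
case: o => [a|] /=.
  apply: block_grp_lo; rewrite ?ideal0 ?skew_digit_ideal //; first ilia.
  exact: skew_pair_skew (conj_skew_digit _ _).
rewrite /Kprev /block_grp /mkset weylE ?conj_unifX ?unifX_neq0 // !mx3E subrr.
rewrite !ideal0 invr_expz !ideal_unifX //; split; split=> //; ilia.
Qed.

Lemma prev_rep_cover g : Kprev g -> exists o, Jgrp ((prev_rep o)^-1 * g)%g.
Proof.
move=> gK; have [[g00 g01 g02] [g10 g11 g12] [g20 g21 g22]] := gK.
suff [o ho] : exists o, in_ideal n (u3_mx ((prev_rep o)^-1 * g)%g 2 0).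
  exists o; have := block_grpM Kprev_wf (block_grpV (prev_rep_K o)) gK.
  by move=> [[? ? ?] [? ? ?] [? ? ?]]; split.
(* If g00 is not a unit, the Weyl element puts W ^ (n - 1) * g00, an element of p^n, at (2,0). *)
have [u00|] := boolP (unitE (u3_mx g 0 0)); last first.
  rewrite unit_ideal g00 andTb negbK => n00; exists None.
  rewrite u3_mulE u3_invE [prev_rep _]/= weylE ?conj_unifX ?unifX_neq0 // !mx3E.
  rewrite rmorph0 conj_unifX !mul0r !addr0 mulrC idealM_unifX //.
  by apply: ideal_le n00; ilia.
(* The trace of g20 / g00 is, up to a unit, the norm of g10; it lies in p^(2n-2), inside p^n as n >=
   2. *)
have [||a ha] := @skew_digit_near (n%:Z - 1) (u3_mx g 2 0 / u3_mx g 0 0).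
- by rewrite idealV.
- have := hermE g 0 0; rewrite mx3E.
  have := unit_neq0 u00; have u00' : unitE (conj (u3_mx g 0 0)) by rewrite unit_conj.
  have g10' : in_ideal n (conj (u3_mx g 1 0) * u3_mx g 1 0).
    by apply: (idealM _ g10); [rewrite ideal_conj; exact: g10 | ilia].
  have := unit_neq0 u00'; move: g10' u00 u00'; rewrite rmorphM fmorphV /=.
  move: (conj (u3_mx g 1 0) * _) (u3_mx g 2 0) (conj (u3_mx g 2 0)).
  move: (u3_mx g 0 0) (conj (u3_mx g 0 0)) => a a' r c c' rn ua ua' a0' a0 h.
  have -> : c / a + c' / a' = - (r / (a * a')).
    have -> : r = - (a' * c + c' * a).
      by apply/eqP; rewrite -subr_eq0 -h; apply/eqP; ring.
    have alg (K : fieldType) (p p' q q' : K) : p != 0 -> p' != 0 ->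
      q / p + q' / p' = - (- (p' * q + q' * p) / (p * p')).
      by move=> *; field; apply/andP.
    exact: alg.
  by rewrite idealN idealV ?unitM // addrNK.
exists (Some a); rewrite u3_mulE [prev_rep _]/= loVE; last first.
  exact: skew_pair_skew (conj_skew_digit _ _).
rewrite !mx3E rmorph0 mul0r addr0 mul1r conj_skew_digit.
move: ha u00; rewrite addrNK; move: (u3_mx g 2 0) (u3_mx g 0 0) => p q ha uq.
by rewrite -(idealV _ _ uq) mulrDl mulfK ?unit_neq0 // addrC.
Qed.

Lemma prev_rep_uniq o o' : Jgrp ((prev_rep o)^-1 * prev_rep o')%g -> o = o'.
Proof.
have sk a := skew_pair_skew (conj_skew_digit (n%:Z - 1) a).
case: o o' => [a|] [b|] [_ _ [h20 _ _]] //; move: h20;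
  rewrite u3_mulE ![prev_rep _]/=.
- rewrite loVE // loE // !mx3E conj_skew_digit.
  rewrite !(rmorph0, mul0r, mulr0, mulr1, mul1r, addr0).
  rewrite addrC -{1}[n%:Z](addrNK 1) => h; congr Some.
  by apply/esym/(@skew_digit_inj (n%:Z - 1)).
- rewrite loVE // weylE ?conj_unifX ?unifX_neq0 // !mx3E.
  by rewrite !(mulr0, mul1r, add0r) ideal_unifX //; ilia.
- rewrite u3_invE loE // weylE ?conj_unifX ?unifX_neq0 // !mx3E.
  by rewrite conj_unifX rmorph0 !(mul0r, mulr1, addr0) ideal_unifX //; ilia.
Qed.

End Cosets.

(** * Cosets in [Hgrp], for n >= 3 and for n = 2 *)

Section CosetsH.
Context (D : unramified_quadratic) (w : uqF D) (hw : is_uniformizer w).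
Local Notation E := (uqE D).
Local Notation conj := (@uq_conj D).
Local Notation v := (lval (uqE_local D)).
Local Notation k := (lres (uqE_local D)).
Local Notation G := (u3 D).
Local Notation W := (w%:A : E).
Implicit Types (g h : G) (x y z : E) (e m : int).

Local Notation digit := (digit w).
Local Notation skew_digit := (skew_digit w).

Definition up_rep (a : k) : G := let x := digit (-1) a in up x (half_norm x).

Lemma up_rep_H n a : (2 <= n)%N -> Hgrp n (up_rep a).
Proof.
move=> n2; apply: block_grp_up (skew_pair_half _) _ _; [ilia | exact: digit_ideal |].
by apply: ideal_le (ideal_half_norm (digit_ideal hw _ _)); ilia.
Qed.

Section LevelAtLeast3.
Context (n : nat) (n3 : (3 <= n)%N).
Let n2 : (2 <= n)%N := ltnW n3.

(** For n >= 3 the exponents -1 and n - 1 have positive sum, so middle entries are units and two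
    digits, at (0,1) and (2,1), label the cosets. For n = 2 this breaks down: [Hgrp] is then
    conjugate to the whole of K_0. *)
Definition H_rep (o : k * k) : G := (up_rep o.1 * lo_rep w n o.2)%g.

Lemma lo_rep_H a : Hgrp n (lo_rep w n a).
Proof.
have [[? ? ?] [? ? ?] [? ? ?]] := lo_rep_J hw n2 a.
by split; split=> //; [apply: ideal_le (_ : in_ideal 0 _) |
  apply: ideal_le (_ : in_ideal (1 - n%:Z) _) |
  apply: ideal_le (_ : in_ideal 0 _)] => //; ilia.
Qed.

Lemma H_rep_H o : Hgrp n (H_rep o).
Proof. exact: (block_grpM (Hgrp_wf n2) (up_rep_H _ n2) (lo_rep_H _)). Qed.

Lemma H_rep_cover g : Hgrp n g -> exists o, Kplus n ((H_rep o)^-1 * g)%g.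
Proof.
move=> gH; have wfH := Hgrp_wf n2.
have u11 h : Hgrp n h -> unitE (u3_mx h 1 1).
  by move=> hH; apply: (block_unit11 wfH _ hH); ilia.
have ug := u11 _ gH.
have [[g00 g01 g02] [g10 g11 g12] [g20 g21 g22]] := gH.
have [|a ha] := @digitP _ _ hw (-1) (u3_mx g 0 1 / u3_mx g 1 1).
  by rewrite idealV.
set h := ((up_rep a)^-1 * g)%g.
have hH : Hgrp n h.
  by apply: (block_grpM wfH) => //; apply: block_grpV (up_rep_H a n2).
have h01 : in_ideal 0 (u3_mx h 0 1).
  rewrite u3_mulE (upVE (skew_pair_half _)) !mx3E mul1r; apply: ideal_add.
    move: ha ug; rewrite addNr; move: (u3_mx g 0 1) (u3_mx g 1 1) (digit _ _).
    move=> p q x ha uq; rewrite -(idealV _ _ uq) mulrDl mulfK ?unit_neq0 //.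
  apply: (idealM _ g21).
    by rewrite ideal_conj; apply: ideal_half_norm (digit_ideal hw _ _).
  by ilia.
have uh := u11 _ hH; have [_ _ [_ h21 _]] := hH.
have [|b hb] := @digitP _ _ hw (n%:Z - 1) (- conj (u3_mx h 2 1 / u3_mx h 1 1)).
  by rewrite idealN ideal_conj idealV.
exists (a, b).
have -> : ((H_rep (a, b))^-1 * g = (lo_rep w n b)^-1 * h)%g by rewrite invgM mulgA.
set l := ((lo_rep w n b)^-1 * h)%g.
have lH : Hgrp n l by apply: (block_grpM wfH) => //; apply: block_grpV (lo_rep_H b).
have ul := u11 _ lH.
have l01 : in_ideal 0 (u3_mx l 0 1).
  by rewrite u3_mulE (loVE (skew_pair_half _)) !mx3E mul1r !mul0r !addr0.
have l21 : in_ideal n (u3_mx l 2 1).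
  rewrite u3_mulE (loVE (skew_pair_half _)) !mx3E mul1r -addrA; apply: ideal_add.
    apply: (idealM _ h01); last by rewrite addr0; exact: lexx.
    by rewrite ideal_conj; apply: ideal_le (ideal_half_norm (digit_ideal hw _ _)); ilia.
  move: hb uh; rewrite addrNK; move: (u3_mx h 2 1) (u3_mx h 1 1) (digit _ _).
  move=> p q x hx uq; rewrite -(idealV _ _ uq) mulrDl mulfK ?unit_neq0 //.
  by rewrite -ideal_conj -idealN rmorphD /= conjK opprD addrC.
have [[l00 _ l02] [l10 l11 l12] [l20 _ l22]] := lH.
exact: block_of_column.
Qed.

Lemma H_rep_uniq o o' : Kplus n ((H_rep o)^-1 * H_rep o')%g -> o = o'.
Proof.
case: o o' => [a b] [a' b'].
have -> : ((H_rep (a, b))^-1 * H_rep (a', b') =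
    (lo_rep w n b)^-1 * ((up_rep a)^-1 * up_rep a' * lo_rep w n b'))%g.
  by rewrite invgM !mulgA.
move=> rK; suff aa : a = a'.
  rewrite -aa mulVg mul1g in rK; congr (_, _); first by [].
  exact: (lo_rep_uniq hw rK).
have [[_ h01 _] _ _] := rK; move: h01.
rewrite u3_mulE (loVE (skew_pair_half _)) !mx3E !u3_mulE.
rewrite (upVE (skew_pair_half _)) (upE (skew_pair_half _)) lo_repE.
rewrite !mx3E !(mul0r, mulr0, mul1r, mulr1, addr0, add0r).
set x := digit _ a; set x' := digit _ a'; set y := digit _ b' => h.
(* The cross term between upper and lower digits lies in p^(-2) p^(n-1), which is integral exactly
   because n >= 3. *)
have small : in_ideal 0
    ((half_norm x' + - x * - conj x' + conj (half_norm x)) * - conj y).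
  have x1 : in_ideal (-1) x by apply: digit_ideal.
  have x1' : in_ideal (-1) x' by apply: digit_ideal.
  have hA : in_ideal (-1 + -1) (half_norm x' + - x * - conj x' + conj (half_norm x)).
    rewrite ideal_add ?ideal_add ?ideal_conj ?ideal_half_norm //.
    by apply: (idealM (m := -1) (n := -1)); rewrite ?idealN ?ideal_conj.
  have hB : in_ideal (n%:Z - 1) (- conj y).
    by rewrite idealN ideal_conj; apply: digit_ideal.
  by apply: (idealM hA hB); ilia.
apply/esym/(@digit_inj _ _ hw (-1)); rewrite addNr -/x -/x'.
have := idealB h small; congr in_ideal; ring.
Qed.

End LevelAtLeast3.

Section Level2.

Local Notation H2 := (Hgrp (D := D) 2).
Local Notation J2 := (Jgrp (D := D) 2).

(** Conjugated into K_0 and reduced modulo p, this is the Bruhat decomposition of a flag variety of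
    a finite unitary group: q tau points from the unipotent radical, and one at infinity. The
    descent from [Jgrp] to [Kplus] is left to [lo_rep]. *)
Definition H2_rep (o : option (k * skew_residue D)) : G :=
  if o is Some (a, c) then
    (up_rep a * up 0 (skew_digit (- 2) c))%g
  else weyl (W ^ 2).

Let sk c := skew_pair_skew (conj_skew_digit w (- 2) c).

Lemma H2_rep_H o : H2 (H2_rep o).
Proof.
have wfH : block_wf (-1) (- 2%:Z) (2%:Z - 1) 2 (2%:Z - 2) := @Hgrp_wf 2 isT.
case: o => [[a c]|].
  apply: (block_grpM wfH); first exact: up_rep_H.
  by apply: block_grp_up; rewrite ?ideal0 ?skew_digit_ideal.
rewrite [H2_rep _]/= /Hgrp /block_grp /mkset.
rewrite weylE ?(conj_unifX _ 2) ?(unifX_neq0 hw 2) // !mx3E !subrr.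
by rewrite !ideal0 invr_expz !ideal_unifX.
Qed.

Lemma H2_rep_cover g : H2 g -> exists o, J2 ((H2_rep o)^-1 * g)%g.
Proof.
move=> gH; have wfH : block_wf (-1) (- 2%:Z) (2%:Z - 1) 2 (2%:Z - 2) := @Hgrp_wf 2 isT.
have JP h : H2 h -> in_ideal 0 (u3_mx h 0 1) -> in_ideal (-1) (u3_mx h 0 2) ->
    in_ideal 0 (u3_mx h 1 2) -> J2 h.
  by move=> [[? ? ?] [? ? ?] [? ? ?]] *; split.
(* When h22 is a unit, the relation between columns 1 and 2 bounds h01 by the other entries. *)
have herm_small h : H2 h -> unitE (u3_mx h 2 2) -> in_ideal (-1) (u3_mx h 0 2) ->
    in_ideal 0 (u3_mx h 1 2) -> J2 h.
  move=> hH u22 h02 h12; apply: JP => //.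
  have h11 := block_near1 wfH hH; have [_ _ [_ h21 _]] := hH.
  have := hermE h 1 2; rewrite mx3E; move: h11 h21 h02 h12 u22.
  rewrite -(ideal_conj 0 (u3_mx h 1 1)) -(ideal_conj _ (u3_mx h 2 1)).
  rewrite -(ideal_conj 0 (u3_mx h 0 1)).
  move: (conj (u3_mx h 1 1)) (conj (u3_mx h 2 1)) (conj (u3_mx h 0 1)).
  move: (u3_mx h 0 2) (u3_mx h 1 2) (u3_mx h 2 2) => a b c p q r p0 q1 a1 b0 uc h0.
  rewrite -(idealMu _ _ uc); have -> : r * c = - (p * b + q * a).
    by apply/eqP; rewrite -subr_eq0 -h0; apply/eqP; ring.
  rewrite idealN ideal_add //.
    by apply: (idealM p0 b0); ilia.
  by apply: (idealM q1 a1); ilia.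
have [[g00 g01 g02] [g10 g11 g12] [g20 g21 g22]] := gH.
have [u22|] := boolP (unitE (u3_mx g 2 2)); last first.
  rewrite unit_ideal g22 andTb negbK => n22; exists None.
  set h := ((H2_rep None)^-1 * g)%g.
  have hH : H2 h by apply: (block_grpM wfH) => //; apply: block_grpV (H2_rep_H None).
  (* The norm of g12 is minus the trace of conj g02 * g22, hence in p^(-1); parity of its valuation
     makes g12 integral. *)
  have g12' : in_ideal 0 (u3_mx g 1 2).
    apply: norm_ideal; rewrite mulrC; have := hermE g 2 2; rewrite mx3E.
    have n22c : in_ideal 1 (conj (u3_mx g 2 2)) by rewrite ideal_conj.
    have g02c : in_ideal (- 2) (conj (u3_mx g 0 2)) by rewrite ideal_conj.
    move=> h0; have -> : conj (u3_mx g 1 2) * u3_mx g 1 2 =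
        - (conj (u3_mx g 0 2) * u3_mx g 2 2 + conj (u3_mx g 2 2) * u3_mx g 0 2).
      by apply/eqP; rewrite -subr_eq0 -h0; apply/eqP; ring.
    rewrite idealN ideal_add //.
      exact: (idealM g02c n22).
    exact: (idealM n22c g02).
  have WE := weylE (unifX_neq0 hw 2) (conj_unifX w 2).
  have WV := weylV (unifX_neq0 hw 2) (conj_unifX w 2).
  have hE j : u3_mx h 0 j = u3_mx g 2 j * W ^ (- 2) /\
      u3_mx h 1 j = u3_mx g 1 j.
    rewrite /h [H2_rep _]/= WV !u3_mulE WE !mx3E !mul0r !add0r !addr0 mul1r.
    by split=> //; rewrite mulrC -invr_expz.
  have h02 : in_ideal (-1) (u3_mx h 0 2).
    by rewrite (hE 2).1 idealM_unifX.
  have h12 : in_ideal 0 (u3_mx h 1 2) by rewrite (hE 2).2.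
  apply: herm_small => //.
  have [[h00 _ _] [h10 _ _] [h20 _ h22]] := hH.
  have := hermE h 0 2; rewrite mx3E => h1.
  have n1 : in_ideal 1 (conj (u3_mx h 0 0) * u3_mx h 2 2 - 1).
    have h10c : in_ideal 1 (conj (u3_mx h 1 0)) by rewrite ideal_conj.
    have h20c : in_ideal 2 (conj (u3_mx h 2 0)) by rewrite ideal_conj.
    have -> : conj (u3_mx h 0 0) * u3_mx h 2 2 - 1 =
      - (conj (u3_mx h 1 0) * u3_mx h 1 2 + conj (u3_mx h 2 0) * u3_mx h 0 2).
      by rewrite -h1; ring.
    rewrite idealN ideal_add //.
      exact: (idealM h10c h12).
    exact: (idealM h20c h02).
  have := unit_near (unit1 D) n1; rewrite !unit_ideal h22 => /andP[_].
  have h00c : in_ideal 0 (conj (u3_mx h 0 0)) by rewrite ideal_conj.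
  by apply: contra => h22'; apply: (idealM h00c h22').
have [|a ha] := @digitP _ _ hw (-1) (- conj (u3_mx g 1 2 / u3_mx g 2 2)).
  by rewrite idealN ideal_conj idealV.
rewrite addNr in ha; set h := ((up_rep a)^-1 * g)%g.
have hH : H2 h by apply: (block_grpM wfH) => //; apply: block_grpV (up_rep_H _ _).
have h22E : u3_mx h 2 2 = u3_mx g 2 2.
  by rewrite u3_mulE (upVE (skew_pair_half _)) !mx3E !mul0r !add0r mul1r.
have h12 : in_ideal 0 (u3_mx h 1 2).
  rewrite u3_mulE (upVE (skew_pair_half _)) !mx3E mul0r add0r mul1r.
  move: ha u22; move: (u3_mx g 1 2) (u3_mx g 2 2) (digit _ _) => p q x hx uq.
  rewrite -(idealV _ _ uq) mulrDl mulfK ?unit_neq0 //.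
  by rewrite -ideal_conj -idealN rmorphD /= conjK opprD.
have [[_ _ h02] _ _] := hH.
have u22h : unitE (u3_mx h 2 2) by rewrite h22E.
have [||c hc] := @skew_digit_near _ _ hw (- 2) (u3_mx h 0 2 / u3_mx h 2 2).
- by rewrite idealV.
- have := hermE h 2 2; rewrite mx3E.
  have u22' : unitE (conj (u3_mx h 2 2)) by rewrite unit_conj.
  have nh12 : in_ideal (-1) (conj (u3_mx h 1 2) * u3_mx h 1 2).
    by apply: (idealM _ h12); [rewrite ideal_conj; exact: h12 | ilia].
  have := unit_neq0 u22'; have := unit_neq0 u22h; move: nh12 u22h u22'.
  rewrite rmorphM fmorphV /=.
  move: (conj (u3_mx h 1 2) * _) (u3_mx h 0 2) (conj (u3_mx h 0 2)).
  move: (u3_mx h 2 2) (conj (u3_mx h 2 2)) => p p' r q q' rn up up' p0 p0' h0.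
  have -> : q / p + q' / p' = - (r / (p * p')).
    have -> : r = - (q' * p + p' * q).
      by apply/eqP; rewrite -subr_eq0 -h0; apply/eqP; ring.
    have alg (K : fieldType) (a1 a2 b1 b2 : K) : a1 != 0 -> a2 != 0 ->
      b1 / a1 + b2 / a2 = - (- (b2 * a1 + a2 * b1) / (a1 * a2)).
      by move=> *; field; apply/andP.
    exact: alg.
  by rewrite idealN idealV ?unitM.
exists (Some (a, c)).
have -> : ((H2_rep (Some (a, c)))^-1 * g =
    (up 0 (skew_digit (- 2) c))^-1 * h)%g by rewrite /h /= invgM mulgA.
set l := (_ * h)%g.
have lH : H2 l.
  apply: (block_grpM wfH) => //; apply: block_grpV.
  by apply: block_grp_up; rewrite ?ideal0 ?skew_digit_ideal.
have l22 : u3_mx l 2 2 = u3_mx h 2 2.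
  by rewrite u3_mulE upVE // !mx3E !mul0r !add0r mul1r.
apply: herm_small => //; first by rewrite l22.
  rewrite u3_mulE upVE // !mx3E oppr0 mul0r addr0 mul1r conj_skew_digit.
  move: hc u22h; move: (u3_mx h 0 2) (u3_mx h 2 2) (skew_digit _ _) => p q x hx uq.
  by rewrite -(idealV _ _ uq) mulrDl mulfK ?unit_neq0.
by rewrite u3_mulE upVE // !mx3E rmorph0 !mul0r add0r addr0 mul1r.
Qed.

Lemma H2_rep_uniq o o' : J2 ((H2_rep o)^-1 * H2_rep o')%g -> o = o'.
Proof.
have WE := weylE (unifX_neq0 hw 2) (conj_unifX w 2).
have WV := weylV (unifX_neq0 hw 2) (conj_unifX w 2).
have upupE a c : u3_mx (H2_rep (Some (a, c))) =
    let x := digit (-1) a in u_mx x (half_norm x + skew_digit (- 2) c).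
  rewrite [H2_rep _]/=; apply: mx3P; split;
  rewrite u3_mulE (upE (skew_pair_half _)) upE // !mx3E;
  by rewrite ?rmorph0 ?oppr0 !(mul0r, mulr0, mul1r, mulr1, addr0, add0r) // addrC.
case: o o' => [[a c]|] [[a' c']|] // [[_ h01 h02] _ _]; last 2 first.
- move: h02; rewrite u3_mulE u3_invE [H2_rep None]/= upupE WE !mx3E.
  by rewrite rmorph1 !(mul1r, mulr0, addr0) invr_expz ideal_unifX.
- move: h02; rewrite u3_mulE [H2_rep None]/= WV upupE WE !mx3E.
  by rewrite !mul0r !add0r mulr1 invr_expz ideal_unifX.
- have aa : a = a'.
    apply/esym/(@digit_inj _ _ hw (-1)); rewrite addNr; move: h01.
    rewrite u3_mulE u3_invE !upupE !mx3E rmorph1 rmorphN /= conjK.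
    by congr in_ideal; rewrite mulr0 addr0 mul1r mulr1.
  congr (Some (_, _)) => //; apply/esym/(@skew_digit_inj _ _ hw (- 2)).
  move: h02; rewrite u3_mulE u3_invE !upupE !mx3E aa rmorph1 rmorphN /= conjK.
  rewrite rmorphD /= conj_half_norm conj_skew_digit /half_norm; congr in_ideal.
  move: (digit _ _) (skew_digit _ c) (skew_digit _ c') => x z z'.
  have alg (K : fieldType) (p q r s : K) : (2 : K) != 0 ->
    1 * (- (p * q) / 2 + r) + - p * - q + (- (p * q) / 2 - s) * 1 = r - s.
    by move=> *; field.
  exact: alg (two_neq0 D).
Qed.

End Level2.
End CosetsH.

(** * Averages of vectors of minimal level *)

Arguments act {R D r} g : rename.

Section Averages.
Context (R : realType) (D : unramified_quadratic) (rho : rep R D).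
Local Notation G := (u3 D).

Definition fixed_by (L : set G) (u : rho) : Prop :=
  forall g, L g -> act g u = u.

(** K need not lie in L: the s t represent L modulo the intersection of L and K, and left
    translation by L permutes these cosets. *)
Lemma fixed_by_sum (T : finType) (s : T -> G) (L K : set G) (u : rho) :
  (forall g h, L g -> L h -> L (g * h)%g) -> (forall t, L (s t)) ->
  (forall g h, K g -> K h -> K (g * h)%g) -> (forall g, K g -> K g^-1%g) ->
  (forall g, L g -> exists t, K ((s t)^-1 * g)%g) ->
  (forall t t', K ((s t)^-1 * s t')%g -> t = t') ->
  fixed_by K u -> fixed_by L (\sum_t act (s t) u).
Proof.
move=> LM Ls KM KV cover uniq_s Ku g Lg; rewrite linear_sum.
have [p pK] := choice (fun t => cover (g * s t)%g (LM _ _ Lg (Ls t))).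
have p_inj : injective p.
  move=> t t' ptt'; apply: uniq_s.
  have -> : ((s t)^-1 * s t' =
      ((s (p t))^-1 * (g * s t))^-1 * ((s (p t'))^-1 * (g * s t')))%g.
    by rewrite ptt' !invgM invgK -!mulgA !(mulVKg, mulKg).
  by apply: KM => //; apply: KV.
rewrite [RHS](reindex_inj p_inj); apply: eq_bigr => t _.
rewrite -actM -[in RHS](Ku _ (pK t)) -actM; congr (act _ u).
by rewrite mulVKg.
Qed.

End Averages.

Section Evaluation.
Local Open Scope complex_scope.
Context (R : realType) (D : unramified_quadratic).
Local Notation E := (uqE D).
Local Notation C := R[i].
Local Notation G := (u3 D).
Context (pi : rep R D) (mu1 mu2 : E -> C).
Context (iota : {linear pi -> ind mu1 mu2}).
Hypotheses (iota_inj : injective iota) (iota_hom : intertwining iota).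

Definition eval_at (u : pi) (g : G) : C := ind_fun (iota u) g.

Lemma eval_atD u u' g : eval_at (u + u') g = eval_at u g + eval_at u' g.
Proof. by rewrite /eval_at linearD. Qed.

Lemma eval_at0 g : eval_at 0 g = 0.
Proof. by rewrite /eval_at linear0. Qed.

Lemma eval_at_sum (T : finType) (u : T -> pi) g :
  eval_at (\sum_t u t) g = \sum_t eval_at (u t) g.
Proof.
exact: (big_morph (eval_at^~ g) (fun u u' => eval_atD u u' g) (eval_at0 g)).
Qed.

Lemma eval_at_act h u g : eval_at (act h u) g = eval_at u (g * h)%g.
Proof. by rewrite /eval_at iota_hom. Qed.

Lemma eval_at_inj u u' : eval_at u =1 eval_at u' -> u = u'.
Proof.
by move=> uu'; apply/iota_inj/val_inj/funext => g; apply: uu'.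
Qed.

Lemma eval_at_equivariant u b g : borel b -> eval_at u (b * g)%g =
  (Num.sqrt (delta_B R b))%:C * mu_B mu1 mu2 b * eval_at u g.
Proof.
move=> bB; rewrite /eval_at /ind_fun; case: (iota u) => f /= /subrep_predP[_].
exact.
Qed.

End Evaluation.

(** * Averages that vanish by minimality of the level *)

Section Lowering.
Context (R : realType) (D : unramified_quadratic) (rho : rep R D).
Context (w : uqF D) (hw : is_uniformizer w).
Local Notation E := (uqE D).
Local Notation conj := (@uq_conj D).
Local Notation G := (u3 D).
Local Notation W := (w%:A : E).
Context (n : nat) (n2 : (2 <= n)%N).
Hypothesis minimal : forall (m : nat) (u : rho), (m < n)%N -> fixed rho m u -> u = 0.

(** With t = diag(w^-1, 1, w), conjugation by t carries K_(n-2) into [Hgrp]. So t^-1 u is fixed by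
    K_(n-2), and minimality applies to it. *)
Lemma fixed_by_H0 (u : rho) : fixed_by (Hgrp n) u -> u = 0.
Proof.
move=> Hu; have W0 : W ^ (-1) != 0 := unifX_neq0 hw (-1).
have one1 : 1 * conj 1 = 1 :> E by rewrite rmorph1 mulr1.
have cW := conj_unifX w (-1).
pose t := dg (W ^ (-1)) 1.
have tE : u3_mx t = mx3 (W ^ (-1)) 0 0 0 1 0 0 0 (W ^ 1).
  by rewrite dgE // cW invr_expz opprK.
have tVE : u3_mx t^-1%g = mx3 (W ^ 1) 0 0 0 1 0 0 0 (W ^ (-1)).
  by rewrite u3_invE tE !mx3E !conj_unifX rmorph0 rmorph1.
have : act t^-1%g u = 0.
  apply: (@minimal (n - 2)%N); first by rewrite -subn_gt0 subKn.
  move=> k kK; rewrite -actM.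
  have -> : (k * t^-1 = t^-1 * (t * k * t^-1))%g by rewrite -!mulgA mulKg.
  rewrite actM Hu //.
  have n2z : (n - 2)%N%:Z = n%:Z - 2 by rewrite subzn.
  move: kK; rewrite KgrpE n2z => -[[k00 k01 k02] [k10 k11 k12] [k20 k21 k22]].
  have tk i j : u3_mx (t * k * t^-1)%g i j =
      u3_mx t i i * u3_mx k i j * u3_mx t^-1%g j j.
    rewrite !u3_mulE tVE tE; move: i j; do 2! apply: ord3P; rewrite !mx3E;
    by rewrite !(mul0r, mulr0, addr0, add0r).
  have iW e a b (x : E) : in_ideal e (W ^ a * x * W ^ b) = in_ideal (e - b - a) x.
    by rewrite idealM_unifX // mulrC idealM_unifX.
  have iWl e a (x : E) : in_ideal e (W ^ a * x) = in_ideal (e - a) x.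
    by rewrite mulrC idealM_unifX.
  rewrite /Hgrp /block_grp /mkset !tk tVE tE !mx3E !(mul1r, mulr1).
  rewrite !(iW, iWl, idealM_unifX hw); split; split=> //.
  - by apply: ideal_le k02; ilia.
  - by apply: ideal_le k10; ilia.
  - by apply: ideal_le k20; ilia.
  - by apply: ideal_le k21; ilia.
by move/(congr1 (act t)); rewrite -actM mulgV act1 linear0.
Qed.

Lemma fixed_by_prev0 (u : rho) : fixed_by (Kprev n) u -> u = 0.
Proof.
move=> Ku; apply: (@minimal n.-1); first by rewrite prednK // ltnW.
have n1z : n.-1%:Z = n%:Z - 1 by rewrite -subn1 subzn // ltnW.
move=> k; rewrite KgrpE n1z => -[[k00 k01 k02] [k10 k11 k12] k2].
apply: Ku; split=> //; split=> //; first by apply: ideal_le k02; ilia.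
by apply: ideal_le k11; ilia.
Qed.

Context (u : rho) (Ku : fixed_by (Kplus n) u).

Lemma sum_lo_fixed : fixed_by (Jgrp n) (\sum_a act (lo_rep w n a) u).
Proof.
apply: (fixed_by_sum _ _ _ _ _ _ Ku).
- exact: (block_grpM (Jgrp_wf n2)).
- exact: lo_rep_J.
- exact: (block_grpM (Kplus_wf n2)).
- exact: block_grpV.
- exact: (lo_rep_cover hw n2).
- exact: (lo_rep_uniq hw).
Qed.

Lemma sum_prev0 :
  \sum_o act (prev_rep w n o) (\sum_a act (lo_rep w n a) u) = 0.
Proof.
apply: fixed_by_prev0; apply: (fixed_by_sum _ _ _ _ _ _ sum_lo_fixed).
- exact: (block_grpM (Kprev_wf n2)).
- exact: prev_rep_K.
- exact: (block_grpM (Jgrp_wf n2)).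
- exact: block_grpV.
- exact: (prev_rep_cover hw n2).
- exact: (prev_rep_uniq hw n2).
Qed.

Lemma sum_H0 : (3 <= n)%N -> \sum_o act (H_rep w n o) u = 0.
Proof.
move=> n3; apply: fixed_by_H0; apply: (fixed_by_sum _ _ _ _ _ _ Ku).
- exact: (block_grpM (Hgrp_wf n2)).
- exact: H_rep_H.
- exact: (block_grpM (Kplus_wf n2)).
- exact: block_grpV.
- exact: (H_rep_cover hw n3).
- exact: (H_rep_uniq hw n3).
Qed.

Lemma sum_H20 : n = 2%N ->
  \sum_o act (H2_rep w o) (\sum_a act (lo_rep w n a) u) = 0.
Proof.
move=> n2E; apply: fixed_by_H0; rewrite n2E.
have := sum_lo_fixed; rewrite n2E => Ju.
apply: (fixed_by_sum _ _ _ _ _ _ Ju).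
- exact: (block_grpM (Hgrp_wf (n := 2) isT)).
- exact: H2_rep_H.
- exact: (block_grpM (Jgrp_wf (n := 2) isT)).
- exact: block_grpV.
- exact: (H2_rep_cover hw).
- exact: (H2_rep_uniq hw).
Qed.

End Lowering.

(** * Invariance and values gained from a_i <> 0 with i < n - c(mu1) *)

Section KeyLemma.
Local Open Scope complex_scope.
Context (R : realType) (D : unramified_quadratic).
Context (w : uqF D) (hw : is_uniformizer w).
Local Notation E := (uqE D).
Local Notation C := R[i].
Local Notation conj := (@uq_conj D).
Local Notation v := (lval (uqE_local D)).
Local Notation k := (lres (uqE_local D)).
Local Notation G := (u3 D).
Local Notation W := (w%:A : E).
Context (pi : rep R D) (mu1 mu2 : E -> C).
Context (hmu1 : mul_char_on (@Estar D) mu1) (hmu2 : mul_char_on (@E1 D) mu2).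
Context (iota : {linear pi -> ind mu1 mu2}).
Hypotheses (iota_inj : injective iota) (iota_hom : intertwining iota).
Context (n : nat) (u : pi) (hu : fixed pi n u).
Local Notation f := (eval_at iota u).

Let fE := fun b g => @eval_at_equivariant _ _ _ _ _ iota u b g.

Lemma eval_at_fixed g h : Kgrp n h -> f (g * h)%g = f g.
Proof. by move=> hK; rewrite -(eval_at_act iota_hom) hu. Qed.

Let fK := eval_at_fixed.

Lemma E1_unit (x : E) : E1 x -> unitE x.
Proof.
rewrite /E1 /= => x1; have x0 : x != 0.
  by apply: contra_eq_neq x1 => ->; rewrite mul0r eq_sym oner_neq0.
have := congr1 v x1; rewrite lvalM ?fmorph_eq0 // lval_conj // lval1E /unitE x0.
by move: (v x) => *; ilia.
Qed.

Section LowValue.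
Context (i : int) (n2 : (2 <= n)%N) (ni : n%:Z <= i + i) (iltn : i <= n%:Z - 1).
Hypothesis fi : f (gamma w i) != 0.
Hypothesis triv1 : forall x : E, unitE x -> in_ideal (n%:Z - 1 - i) (x - 1) -> mu1 x = 1.

Lemma triv2 (x : E) : E1 x -> in_ideal (i + i - n%:Z) (x - 1) -> mu2 x = 1.
Proof. exact: (cond_mu2_of_value hw hmu1 fE fK). Qed.

(** A scalar commutes with g, so right translation becomes left translation by an element of B and
    yields mu1 z * mu2 z. The level n - 2 is at least both n - 1 - i and 2i - n, because 1 <= i <= n
    - 1. *)
Lemma centre_fixed (z : E) : E1 z -> in_ideal (n%:Z - 2) (z - 1) -> act (dg z z) u = u.
Proof.
move=> z1 nz; have uz := E1_unit z1; have z0 := unit_neq0 uz.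
have zE : u3_mx (dg z z) = mx3 z 0 0 0 z 0 0 0 z.
  rewrite dgE //; congr mx3; have cz0 : conj z != 0 by rewrite fmorph_eq0.
  by apply: (mulIf cz0); rewrite mulVf.
apply: (eval_at_inj iota_inj) => g; rewrite (eval_at_act iota_hom).
have -> : (g * dg z z = dg z z * g)%g.
  by apply: u3_ext; split; rewrite !u3_mulE zE !mx3E
    !(mul0r, mulr0, addr0, add0r) mulrC.
rewrite (equivariantE fE); last first.
  by move=> a b; move: a b; do 2! apply: ord3P => //; rewrite zE !mx3E.
rewrite zE !mx3E absE_unit // triv1 ?triv2 ?mul1r //.
  by apply: ideal_le nz; ilia.
by apply: ideal_le nz; ilia.
Qed.

(** The norm of g11 is 1 modulo p^n, so g11 is congruent modulo p^n to some z of norm one. Dividing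
    g by the scalar z, which fixes u, leaves an element of K_n. *)
Lemma Kplus_fixed : fixed_by (Kplus n) u.
Proof.
move=> g gK; have wf := Kplus_wf (n := n) n2.
have u11 : unitE (u3_mx g 1 1) by apply: (block_unit11 wf _ gK); ilia.
have [[g00 g01 g02] [g10 g11 g12] [g20 g21 g22]] := gK.
have n11 : in_ideal n (u3_mx g 1 1 * conj (u3_mx g 1 1) - 1).
  have g01c : in_ideal 0 (conj (u3_mx g 0 1)) by rewrite ideal_conj.
  have g21c : in_ideal n (conj (u3_mx g 2 1)) by rewrite ideal_conj.
  have := hermE g 1 1; rewrite mx3E => h.
  have -> : u3_mx g 1 1 * conj (u3_mx g 1 1) - 1 =
     - (conj (u3_mx g 0 1) * u3_mx g 2 1 + conj (u3_mx g 2 1) * u3_mx g 0 1).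
    by rewrite -h; ring.
  rewrite idealN ideal_add //.
    by apply: (idealM g01c g21); ilia.
  by apply: (idealM g21c g01); ilia.
have [|z [z1 zn]] := E1_lift _ u11 n11; first by ilia.
have uz := E1_unit z1; have z0 := unit_neq0 uz.
have ucz : unitE (conj z) by rewrite unit_conj.
have zK : act (dg z z) u = u.
  apply: centre_fixed => //; have -> : z - 1 = (z - u3_mx g 1 1) + (u3_mx g 1 1 - 1).
    by ring.
  by rewrite ideal_add //; apply: ideal_le zn; ilia.
have -> : (g = dg z z * ((dg z z)^-1 * g))%g by rewrite mulVKg.
rewrite actM hu // KgrpE.
have zE : u3_mx (dg z z)^-1%g = mx3 (conj z) 0 0 0 (conj z) 0 0 0 (conj z).
  rewrite u3_invE dgE // !mx3E !rmorph0 fmorphV /= conjK; congr mx3.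
  by apply: (mulIf z0); rewrite mulVf // mulrC.
rewrite /block_grp /mkset !u3_mulE zE !mx3E !(mul0r, addr0, add0r).
rewrite ![conj z * _]mulrC !(idealMu _ _ ucz); split; split=> //.
have -> : u3_mx g 1 1 * conj z - 1 = - ((z - u3_mx g 1 1) * conj z).
  by rewrite -z1; ring.
by rewrite idealN idealMu.
Qed.

(** The congruences on g22 and c are those that put every argument of mu1 and mu2 in [value_gamma]
    where these characters are trivial. *)
Lemma value_gamma1 g (c : E) : \det (u3_mx g) = 1 -> unitE (u3_mx g 2 2) ->
  in_ideal (i + i - n%:Z) (u3_mx g 2 2 - 1) -> in_ideal n (u3_mx g 2 0) ->
  u3_mx g 2 1 = - W ^ i * c -> unitE c -> in_ideal (n%:Z - 1 - i) (c - 1) ->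
  f g = f (gamma w i).
Proof.
move=> dg1 u22 n22 n20 g21 uc nc; have X0 := unifX_neq0 hw i.
have c0 := unit_neq0 uc; have ucc : unitE (conj c) by rewrite unit_conj.
have g22 := unit_neq0 u22.
have cg22 : conj (u3_mx g 2 2) != 0 by rewrite fmorph_eq0.
rewrite (value_gamma hw fE fK g22 ni) ?idealV //.
- have -> : - u3_mx g 2 1 / W ^ i = c by rewrite g21 -mulNr opprK mulrAC mulfV ?mul1r.
  rewrite dg1 mul1r absE_unit ?unitV // triv1 ?unitV // ?triv2 ?mul1r //.
  + rewrite /E1 /= rmorphM fmorphV /= conjK mulrA divfK // mulfV //.
  + have -> : conj (u3_mx g 2 2) / u3_mx g 2 2 - 1 =
        (conj (u3_mx g 2 2 - 1) - (u3_mx g 2 2 - 1)) / u3_mx g 2 2.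
      rewrite rmorphB rmorph1 /= opprB addrA addrNK mulrBl mulfV //.
    by rewrite idealV // idealB ?ideal_conj.
  + have -> : (conj c)^-1 - 1 = - conj (c - 1) / conj c.
      by rewrite rmorphB rmorph1 /= opprB mulrBl mul1r mulfV ?unit_neq0.
    by rewrite idealV // idealN ideal_conj.
- by rewrite g21 mulf_neq0 ?oppr_eq0.
- rewrite g21 lvalM ?oppr_eq0 // lvalN // lval_unifX //.
  by case/andP: uc => _ /eqP ->; case/andP: u22 => _ /eqP ->.
Qed.

(* Hence averaging over Hgrp does not mix a_i, i <= n - 2, with other values. *)
Lemma value_H_rep o : i <= n%:Z - 2 -> f (gamma w i * H_rep w n o)%g = f (gamma w i).
Proof.
move=> iltn2; case: o => a b.
pose x := digit w (-1) a; pose y := digit w (n%:Z - 1) b.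
have x1 : in_ideal (-1) x by apply: digit_ideal.
have y1 : in_ideal (n%:Z - 1) y by apply: digit_ideal.
have hx2 := ideal_half_norm x1; have hy2 := ideal_half_norm y1.
have dets : \det (u3_mx (gamma w i * H_rep w n (a, b))%g) = 1.
  rewrite !u3_detM det_gamma det_up ?det_lo ?mul1r //; exact: skew_pair_half.
have X0 := unifX_neq0 hw i.
have Xi : in_ideal i (W ^ i) by rewrite ideal_unifX.
have iX e z : in_ideal e (z / W ^ i) = in_ideal (e + i) z.
  by rewrite invr_expz idealM_unifX // opprK.
have rowE : let X := W ^ i in let s := - (X ^+ 2 / 2) * x - X in
    let t := - (X ^+ 2 / 2) * half_norm x + X * conj x + 1 in
    [/\ u3_mx (gamma w i * H_rep w n (a, b))%g 2 0 =
         - (X ^+ 2 / 2) + s * y + t * half_norm y,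
       u3_mx (gamma w i * H_rep w n (a, b))%g 2 1 = s - t * conj y
     & u3_mx (gamma w i * H_rep w n (a, b))%g 2 2 = t].
  rewrite /H_rep mulgA !u3_mulE gammaE (upE (skew_pair_half _)) lo_repE !mx3E.
  by rewrite /= -/x -/y; split; ring.
move: rowE; set g := (_ * _)%g; set X := W ^ i; move=> /= [g20 g21 g22].
set s := _ * x - X in g20 g21; set t := _ + 1 in g20 g21 g22.
have cy1 : in_ideal (n%:Z - 1) (conj y) by rewrite ideal_conj.
have cx1 : in_ideal (-1) (conj x) by rewrite ideal_conj.
have XX : in_ideal (i + i) (- (X ^+ 2 / 2)).
  by rewrite idealN ideal_half expr2; apply: (idealM Xi Xi).
have t1 : in_ideal (i - 1) (t - 1).
  rewrite /t addrK; apply: ideal_add.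
    by apply: (idealM XX hx2); ilia.
  by apply: (idealM Xi cx1); ilia.
have ut : unitE t.
  by apply: (unit_near (unit1 D)); apply: ideal_le t1; ilia.
have t0 := unit_ideal0 ut.
have si : in_ideal i s.
  apply: idealB => //.
  by apply: (idealM XX x1); ilia.
(* The entry (2,1) is - X up to p^(2i-1) and p^(n-1), both inside p^(n-1). Its quotient by - X is
   thus 1 to the depth needed for mu1, and i <= n - 2 makes this quotient a unit. *)
have nc : in_ideal (n%:Z - 1 - i) (- (s - t * conj y) / X - 1).
  move: (iX); rewrite -/X => iX'.
  have -> : - (s - t * conj y) / X - 1 = (X ^+ 2 / 2 * x + t * conj y) / X.
    have -> : - (s - t * conj y) = (X ^+ 2 / 2 * x + t * conj y) + X.
      by rewrite /s; ring.
    by rewrite [LHS]addrC mulrDl mulfV // addrC addrK.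
  rewrite iX'; apply: ideal_add.
    by rewrite -idealN -mulNr; apply: (idealM XX x1); ilia.
  by apply: (idealM t0 cy1); ilia.
apply: (@value_gamma1 g (- (s - t * conj y) / X)) => //.
- by rewrite g22.
- by rewrite g22; apply: ideal_le t1; ilia.
- rewrite g20; apply: ideal_add; first apply: ideal_add.
  + by apply: ideal_le XX; ilia.
  + by apply: (idealM si y1); ilia.
  + by apply: (idealM t0 hy2); ilia.
- by rewrite g21 -/X mulrA mulrNN [X * _]mulrC mulfK.
- by apply: (unit_near (unit1 D)); apply: ideal_le nc; ilia.
Qed.

End LowValue.
End KeyLemma.

(** * The linear relations between a_(n-1) and a_n = f(1) when mu1 is unramified *)

Section TopValues.
Local Open Scope complex_scope.
Context (R : realType) (D : unramified_quadratic).
Context (w : uqF D) (hw : is_uniformizer w).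
Local Notation E := (uqE D).
Local Notation C := R[i].
Local Notation conj := (@uq_conj D).
Local Notation v := (lval (uqE_local D)).
Local Notation k := (lres (uqE_local D)).
Local Notation G := (u3 D).
Local Notation W := (w%:A : E).
Context (pi : rep R D) (mu1 mu2 : E -> C).
Context (hmu1 : mul_char_on (@Estar D) mu1) (hmu2 : mul_char_on (@E1 D) mu2).
Context (iota : {linear pi -> ind mu1 mu2}).
Hypotheses (iota_inj : injective iota) (iota_hom : intertwining iota).
Context (n : nat) (n2 : (2 <= n)%N) (u : pi) (hu : fixed pi n u).
Local Notation f := (eval_at iota u).
Local Notation q := (#|k|%:R : C).
Local Notation tau := (#|{: skew_residue D}|%:R : C).

Let fE := fun b g => @eval_at_equivariant _ _ _ _ _ iota u b g.
Let fK := eval_at_fixed iota_hom hu.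

Lemma value_up_left g h : borel g -> u3_mx g 0 0 = 1 -> u3_mx g 1 1 = 1 ->
  f (g * h)%g = f h.
Proof.
move=> gB g0 g1; rewrite (equivariantE fE) // g0 g1 absE_unit ?unit1 //.
by rewrite (mul_char1 hmu1 (Estar1 D)) (mul_char1 hmu2 (E11 D)) !mul1r.
Qed.

Lemma borel_up (x y : E) : skew_pair x y -> [/\ borel (up x y),
  u3_mx (up x y) 0 0 = 1 & u3_mx (up x y) 1 1 = 1].
Proof.
move=> xy; rewrite /borel /mkset upE // !mx3E; split=> // a b.
by move: a b; do 2! apply: ord3P => //; rewrite !mx3E.
Qed.

Lemma value_up_rep a h : f (up_rep w a * h)%g = f h.
Proof.
have [B b0 b1] := borel_up (skew_pair_half (digit w (-1) a)).
exact: value_up_left.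
Qed.

Lemma weyl_row (m : int) h j :
  u3_mx (weyl (W ^ m) * h)%g 2 j = W ^ m * u3_mx h 0 j.
Proof.
by rewrite u3_mulE weylE ?unifX_neq0 ?conj_unifX // !mx3E !mul0r !addr0.
Qed.

Lemma det_weylX (m : int) : \det (u3_mx (weyl (W ^ m))) = -1.
Proof. by rewrite det_weyl ?unifX_neq0 ?conj_unifX. Qed.

(** The bottom row of the product is the multiple by W ^ n of the first row of h, so h is invisible;
    the Weyl element lies in K_n. *)
Lemma value_weyl h : u3_mx h 0 0 = 1 -> u3_mx h 0 1 = 0 -> u3_mx h 0 2 = 0 ->
  \det (u3_mx h) = 1 -> f (weyl (W ^ n%:Z) * h)%g = f 1%g.
Proof.
move=> h0 h1 h2 dh; rewrite -(fK 1%g (weyl_K hw n)) mul1g.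
apply: (row_value1 hmu1 hmu2 fE); last by rewrite u3_detM dh mulr1.
move=> j; rewrite -[in RHS](mulg1 (weyl _)) !weyl_row; congr (_ * _).
by move: j; apply: ord3P; rewrite ?h0 ?h1 ?h2 u3_oneE.
Qed.

(** The bottom row is W ^ (-1) times that of [value_weyl]; this scalar contributes |W| = q^-1 and
    mu1 W. *)
Lemma value_weyl_prev h : u3_mx h 0 0 = 1 -> u3_mx h 0 1 = 0 -> u3_mx h 0 2 = 0 ->
  \det (u3_mx h) = 1 -> f (weyl (W ^ (n%:Z - 1)) * h)%g = q^-1 * mu1 W * f 1%g.
Proof.
move=> h0 h1 h2 dh; have W1 := unifX_neq0 hw (-1).
rewrite (@row_value _ _ _ _ _ fE _ (weyl (W ^ n%:Z) * h)%g _ W1); last first.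
  move=> j; rewrite !weyl_row mulrA -expfzDr ?(unif_neq0 hw) //.
have -> : \det (u3_mx (weyl (W ^ (n%:Z - 1)) * h)%g) =
    \det (u3_mx (weyl (W ^ n%:Z) * h)%g) by rewrite !u3_detM !det_weylX.
rewrite value_weyl // conj_unifX !divff ?u3_det_neq0 // mulr1.
rewrite (mul_char1 hmu2 (E11 D)) mulr1 invr_expz opprK expr1z.
congr (_ * _ * _); rewrite /absE (negPf (unif_neq0 hw)).
have := lval_unifX hw 1; rewrite expr1z => ->.
rewrite -invr_expz expr1z rmorphV ?rmorph_nat // unitfE.
exact: lt0r_neq0 (card_res_gt0 _ _).
Qed.

Lemma lo_rep_row a : [/\ u3_mx (lo_rep w n a) 0 0 = 1, u3_mx (lo_rep w n a) 0 1 = 0,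
  u3_mx (lo_rep w n a) 0 2 = 0 & \det (u3_mx (lo_rep w n a)) = 1].
Proof. by rewrite lo_repE !mx3E -lo_repE det_lo //; apply: skew_pair_half. Qed.

(** [residue_lift 0] is some element of p, not necessarily 0, but that suffices to put the digit in
    p^n. *)
Lemma value_lo_rep0 : f (lo_rep w n 0) = f 1%g.
Proof.
have x0 : in_ideal n (digit w (n%:Z - 1) 0).
  by rewrite idealM_unifX // subKr residue_lift_near0.
have [_ _ _ d1] := lo_rep_row 0.
apply: (value_near1 hmu1 hmu2 fE fK) => //; rewrite lo_repE mx3E //.
  by apply: ideal_le (ideal_half_norm x0); ilia.
by rewrite idealN ideal_conj.
Qed.

Hypothesis fi : f (gamma w (n%:Z - 1)) != 0.
Hypothesis mu1_unit : forall x : E, unitE x -> mu1 x = 1.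

(** A non-zero digit of p^(n-1) has valuation exactly n - 1 and differs from W ^ (n - 1) by a unit,
    which the unramified mu1 ignores. *)
Lemma value_lo_rep a : a != 0 -> f (lo_rep w n a) = f (gamma w (n%:Z - 1)).
Proof.
move=> a0; have [_ _ _ d1] := lo_rep_row a.
have ni : n%:Z <= (n%:Z - 1) + (n%:Z - 1) by ilia.
have triv (x : E) : unitE x -> in_ideal (n%:Z - 1 - (n%:Z - 1)) (x - 1) -> mu1 x = 1.
  by move=> ux _; apply: mu1_unit.
apply: (value_gamma1 hw hmu1 iota_hom hu ni fi triv (c := conj (residue_lift a))) => //.
- by rewrite lo_repE mx3E unit1.
- by rewrite lo_repE mx3E subrr ideal0.
- rewrite lo_repE mx3E; apply: ideal_le (ideal_half_norm (digit_ideal hw _ _)); ilia.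
- by rewrite lo_repE mx3E rmorphM /= conj_unifX mulNr mulrC.
- by rewrite unit_conj residue_lift_unit.
- rewrite subrr -(rmorph1 conj) -rmorphB ideal_conj idealB ?ideal1 //.
  exact: residue_lift_ideal.
Qed.

Lemma sum_value_lo_rep : \sum_a f (lo_rep w n a) =
  f 1%g + (q - 1) * f (gamma w (n%:Z - 1)).
Proof.
rewrite (bigD1 0) //= value_lo_rep0; congr (_ + _).
rewrite (eq_bigr (fun=> f (gamma w (n%:Z - 1)))) => [|a a0]; last exact: value_lo_rep.
rewrite sumr_const -[X in _ *+ X]/(#|predC1 (0 : k)|) cardC1.
have k0 : (0 < #|k|)%N by apply/card_gt0P; exists 0.
by rewrite -[in RHS](prednK k0) -natr1 addrK mulr_natl.
Qed.

Hypothesis minimal : forall (m : nat) (u' : pi), (m < n)%N -> fixed pi m u' -> u' = 0.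
Hypothesis Ku : fixed_by (Kplus n) u.

Lemma sum_prev_value g :
  \sum_o \sum_a f (g * prev_rep w n o * lo_rep w n a)%g = 0.
Proof.
have := congr1 (fun x => eval_at iota x g) (sum_prev0 hw n2 minimal Ku).
rewrite /= eval_at0 eval_at_sum => h; rewrite -[RHS]h; apply: eq_bigr => o _.
rewrite eval_at_act // eval_at_sum; apply: eq_bigr => a _.
by rewrite eval_at_act // mulgA.
Qed.

(** The [Kprev] average is evaluated at the Weyl element of level n - 1. This cancels the
    representative at infinity and leaves the sum over [lo_rep]; each of the tau others gives q
    equal terms q^-1 * mu1 W * f 1. *)
Lemma prev_relation : tau * mu1 W * f 1%g + \sum_a f (lo_rep w n a) = 0.
Proof.
have q0 : q != 0 by rewrite pnatr_eq0 -lt0n; apply/card_gt0P; exists 0.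
rewrite -[RHS](sum_prev_value (weyl (W ^ (n%:Z - 1)))).
rewrite [RHS](bigD1 None) //= [RHS]addrC; congr (_ + _); last first.
  apply: eq_bigr => a _; congr (f _).
  by rewrite weyl_sq ?unifX_neq0 ?conj_unifX // mul1g.
rewrite [RHS](reindex_omap Some id) => [|[a|] //].
rewrite [RHS](eq_bigr (fun=> q * (q^-1 * mu1 W * f 1%g))) => [|c _].
  rewrite sumr_const -[RHS]mulr_natl !mulrA mulfK //; congr (_%:R * _ * _).
  by apply: eq_card => a; exact: esym (eqxx _).
rewrite (eq_bigr (fun=> q^-1 * mu1 W * f 1%g)) => [|a _].
  by rewrite sumr_const [RHS]mulr_natl.
have sk := skew_pair_skew (conj_skew_digit w (n%:Z - 1) c).
have [l0 l1 l2 ld] := lo_rep_row a.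
rewrite -mulgA; apply: value_weyl_prev; last by rewrite u3_detM det_lo ?ld ?mul1r.
all: by rewrite u3_mulE [prev_rep _ _ _]/= loE // !mx3E ?l0 ?l1 ?l2
  !(mul0r, mulr0, addr0, mul1r).
Qed.

(** At the identity the factors [up_rep] stand on the left and disappear, leaving q copies of the
    sum. *)
Lemma H_relation : (3 <= n)%N -> \sum_a f (lo_rep w n a) = 0.
Proof.
move=> n3; have q0 : q != 0 by rewrite pnatr_eq0 -lt0n; apply/card_gt0P; exists 0.
have := congr1 (fun x => eval_at iota x 1%g) (sum_H0 hw n2 minimal Ku n3).
rewrite /= eval_at0 eval_at_sum => h; apply: (mulfI q0); rewrite mulr0 -[RHS]h.
rewrite -(pair_bigA _ (fun a b => eval_at iota (act (H_rep w n (a, b)) u) 1%g)) /=.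
rewrite [RHS](eq_bigr (fun=> \sum_a f (lo_rep w n a))) => [|a _].
  by rewrite sumr_const -[RHS]mulr_natl.
apply: eq_bigr => b _; rewrite eval_at_act // mul1g; exact: value_up_rep.
Qed.

(** At the identity the q tau unipotent representatives disappear on the left, and the Weyl one
    contributes q times f 1. The common factor q is divided out. *)
Lemma H2_relation : n = 2%N -> tau * \sum_a f (lo_rep w n a) + f 1%g = 0.
Proof.
move=> n2E; have q0 : q != 0 by rewrite pnatr_eq0 -lt0n; apply/card_gt0P; exists 0.
have := congr1 (fun x => eval_at iota x 1%g) (sum_H20 hw n2 minimal Ku n2E).
rewrite /= eval_at0 eval_at_sum => h; apply: (mulfI q0); rewrite mulr0 -[RHS]h.
rewrite [RHS](bigD1 None) //= [RHS]addrC mulrDr; congr (_ + _).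
  rewrite [RHS](reindex_omap Some id) => [|[a|] //].
  rewrite [RHS](eq_bigr (fun=> \sum_a f (lo_rep w n a))) => [|[a c] _].
    rewrite sumr_const -[RHS]mulr_natl mulrA -natrM; congr (_%:R * _).
    rewrite -card_prod; apply: eq_card => -[a c].
    by rewrite [RHS]unfold_in /= !eqxx.
  rewrite eval_at_act // mul1g eval_at_sum; apply: eq_bigr => b _.
  rewrite eval_at_act // -mulgA value_up_rep.
  have [B b0 b1] := borel_up (skew_pair_skew (conj_skew_digit w (- 2) c)).
  exact: value_up_left.
rewrite eval_at_act // mul1g eval_at_sum.
rewrite [RHS](eq_bigr (fun=> f 1%g)) => [|a _].
  by rewrite sumr_const -[RHS]mulr_natl.
rewrite eval_at_act //; have [l0 l1 l2 ld] := lo_rep_row a.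
by rewrite -[X in W ^ X]/(2%:Z) -[in weyl _]n2E value_weyl.
Qed.

(* With alpha the sum of f over lo_rep, the relations are tau s f(1) + alpha = 0
   and tau alpha + f(1) = 0 for n = 2, resp. alpha = 0 for n > 2, where s = mu1 w
   and tau ^ 2 = q; they are independent unless n = 2 and s = 1 / q. *)
Lemma top_value : n = 2%N /\ q * mu1 W = 1.
Proof.
have q0 : q != 0 by rewrite pnatr_eq0 -lt0n; apply/card_gt0P; exists 0.
have q1 : q - 1 != 0.
  rewrite subr_eq0 pnatr_eq1; apply/eqP => k1.
  have /eqP := card_le1_eqP (eq_leq k1) 0 1 isT isT.
  exact/negP/oner_neq0.
have tau2 : tau ^+ 2 = q by rewrite -natrX (card_skew_residue hw).
have tau0 : tau != 0 by move: q0; rewrite -tau2 expf_eq0.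
have mu0 : mu1 W != 0 by case: hmu1 => nz _ _; apply: nz; exact: unif_neq0.
have prev := prev_relation; have sumE := sum_value_lo_rep.
(* If f 1 vanished, the first relation would reduce to (q - 1) a_(n-1) = 0. *)
have f10 : f 1%g != 0.
  apply/negP => /eqP f10; move: prev; rewrite f10 mulr0 add0r sumE f10 add0r.
  by move/eqP; rewrite mulf_eq0 (negPf q1) (negPf fi).
have n2E : n = 2%N.
  apply/eqP; rewrite eqn_leq n2 andbT leqNgt; apply/negP => n3.
  move: prev; rewrite (H_relation n3) addr0 => /eqP.
  by rewrite !mulf_eq0 (negPf tau0) (negPf mu0) (negPf f10).
split=> //; have := H2_relation n2E; move/eqP: prev.
rewrite addrC addr_eq0 => /eqP -> /eqP; rewrite mulrN addrC subr_eq0 => /eqP h.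
apply: (mulIf f10); rewrite mul1r [RHS]h -tau2; ring.
Qed.

End TopValues.

(** * The Steinberg case and the newform *)

Lemma irreducible_iso (R : realType) (D : unramified_quadratic)
  (rho sigma : rep R D) (phi : {linear rho -> sigma}) :
  bijective phi -> intertwining phi -> irreducible rho -> irreducible sigma.
Proof.
move=> [psi phiK psiK] phi_hom [[u u0] irr]; split.
  exists (phi u); apply: contra_neq u0 => pu0.
  by rewrite -[u]phiK pu0 -(linear0 phi) phiK.
move=> S; pose P (u : rho) := S (phi u).
have P0 : P 0 by rewrite /P linear0; apply: subrep0.
have PP (a : R[i]) u1 u2 : P u1 -> P u2 -> P (a *: u1 + u2).
  by move=> h1 h2; rewrite /P linearP; apply: subrepP.
have Pact g u1 : P u1 -> P (act g u1).
  by move=> h1; rewrite /P phi_hom; apply: subrep_act.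
have [S0|S1] := irr (Subrep P0 PP Pact); [left|right] => x; last first.
  by rewrite -[x]psiK; apply: S1.
by rewrite -[x]psiK => Sx; rewrite (S0 _ Sx) linear0.
Qed.

(** * Replacing the inducing characters by equal ones *)

Section SteinbergTransport.
Local Open Scope complex_scope.
Context (R : realType) (D : unramified_quadratic).
Local Notation E := (uqE D).
Local Notation C := R[i].
Local Notation G := (u3 D).
Context (pi : rep R D) (mu1 mu2 nu1 nu2 : E -> C).
Context (iota : {linear pi -> ind mu1 mu2}).
Hypotheses (iota_inj : injective iota) (iota_hom : intertwining iota).
Hypothesis eq1 : forall x, x != 0 -> mu1 x = nu1 x.
Hypothesis eq2 : forall x, E1 x -> mu2 x = nu2 x.

Lemma borel_diag (b : G) : borel b -> u3_mx b 0 0 != 0 /\ E1 (u3_mx b 1 1).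
Proof.
move=> bB; have b10 : u3_mx b 1 0 = 0 by apply: bB.
have b20 : u3_mx b 2 0 = 0 by apply: bB.
have b21 : u3_mx b 2 1 = 0 by apply: bB.
split.
  apply: contraNneq (u3_det_neq0 b) => b00.
  by rewrite det_mx3 b00 b10 b20 b21; apply/eqP; ring.
have := hermE b 1 1; rewrite b21 mx3E rmorph0 mulr0 mul0r add0r addr0.
by rewrite /E1 /= mulrC.
Qed.

(** The characters are functions on all of E that agree only on the groups where they matter, so the
    two induced representations are different types. The underlying functions on G are the same, as
    the diagonal of B meets only those groups. *)
Lemma transport_mem (u : pi) :
  (subrep_val (iota u) : function_rep R D) \in subrep_pred (ind_subrep nu1 nu2).
Proof.
case: (iota u) => f /= /subrep_predP[lf hf]; apply/subrep_predP; split=> // b g bB.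
have [b0 b1] := borel_diag bB.
by rewrite hf // /mu_B eq1 // eq2.
Qed.

Definition transport (u : pi) : ind nu1 nu2 := SubrepElt (transport_mem u).

Lemma transport_linear : linear transport.
Proof. by move=> a u u'; apply: val_inj; rewrite /= linearP. Qed.

Lemma transport_act g u : transport (act g u) = act g (transport u).
Proof. by apply: val_inj; rewrite /= iota_hom. Qed.

Lemma transport_inj : injective transport.
Proof. by move=> u u' /(congr1 val) /= uu'; apply/iota_inj/val_inj. Qed.

Definition image_set (x : ind nu1 nu2) : Prop := exists u, x = transport u.

Lemma image0 : image_set 0.
Proof. by exists 0; apply: val_inj; rewrite /= linear0. Qed.

Lemma imageP (a : C) x y : image_set x -> image_set y -> image_set (a *: x + y).
Proof. by move=> [u ->] [u' ->]; exists (a *: u + u'); rewrite transport_linear. Qed.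

Lemma image_act g x : image_set x -> image_set (act g x).
Proof. by move=> [u ->]; exists (act g u); rewrite transport_act. Qed.

Definition image_subrep : subrep (ind nu1 nu2) := Subrep image0 imageP image_act.

Lemma transport_image u : transport u \in subrep_pred image_subrep.
Proof. by apply/subrep_predP; exists u. Qed.

Definition to_image (u : pi) : subrep_rep image_subrep :=
  SubrepElt (transport_image u).

Lemma to_image_linear : linear to_image.
Proof. by move=> a u u'; apply: val_inj; rewrite /= transport_linear. Qed.

HB.instance Definition _ := GRing.isLinear.Build C pi (subrep_rep image_subrep)
  *:%R to_image to_image_linear.

Lemma to_image_bij : bijective to_image.
Proof.
have surj (x : subrep_rep image_subrep) : exists u, to_image u = x.
  case: x => x xP; have /subrep_predP[u uE] := xP.
  by exists u; apply: val_inj; rewrite /= uE.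
have [inv invK] := choice surj; exists inv => // u.
apply: transport_inj; have := congr1 val (invK (to_image u)); exact.
Qed.

Lemma to_image_hom : intertwining (to_image : {linear _ -> _}).
Proof. by move=> g u; apply: val_inj; rewrite /= transport_act. Qed.

End SteinbergTransport.

(** [cond_mu1] is chosen by [xget]; some trivializing level must be supplied to rule out its default
    value 0. *)
Lemma cond_mu1P (R : realType) (D : unramified_quadratic) (chi : uqE D -> R[i]) :
  let P (n : nat) := forall x : uqE D, unitE x -> in_ideal n (x - 1) -> chi x = 1 in
  (exists n, P n) -> P (cond_mu1 chi) /\ forall m, P m -> (cond_mu1 chi <= m)%N.
Proof.
move=> P [n0 Pn0]; rewrite /cond_mu1.
set Q := [set n | _]%classic.
have PQ m : P m <-> Q m.
  split=> h x; first by move=> x0 vx; apply: h; rewrite /unitE x0 vx eqxx.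
  by case/andP=> x0 /eqP vx; apply: h.
have ex : exists m, `[< P m >] by exists n0; apply/asboolP.
have : is_least Q (ex_minn ex).
  case: ex_minnP => m /asboolP Pm min; split; first exact/PQ.
  by move=> m' /PQ Pm'; apply/min/asboolP.
move=> /(xgetI 0%N) [Qc min]; split; first exact/PQ.
by move=> m /PQ /min.
Qed.

(** * A non-zero value below n - c(mu1) forces the Steinberg characters *)

Section Newform.
Local Open Scope complex_scope.
Context (R : realType) (D : unramified_quadratic).
Context (w : uqF D) (hw : is_uniformizer w).
Local Notation E := (uqE D).
Local Notation C := R[i].
Local Notation v := (lval (uqE_local D)).
Local Notation k := (lres (uqE_local D)).
Local Notation G := (u3 D).
Local Notation W := (w%:A : E).
Context (pi : rep R D) (mu1 mu2 : E -> C).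
Context (hmu1 : mul_char_on (@Estar D) mu1) (hmu2 : mul_char_on (@E1 D) mu2).
Context (iota : {linear pi -> ind mu1 mu2}).
Hypotheses (iota_inj : injective iota) (iota_hom : intertwining iota).

Lemma mu1_unifX (j : int) : mu1 (W ^ j) = mu1 W ^ j.
Proof.
have [nz mM _] := hmu1; have W0 : W != 0 := unif_neq0 hw.
have hX (m : nat) : mu1 (W ^+ m) = mu1 W ^+ m.
  elim: m => [|m IH]; first exact: mul_char1 hmu1 (Estar1 D).
  by rewrite !exprS mM ?IH //; exact: expf_neq0.
case: j => m; first exact: hX.
rewrite NegzE -!exprnN (mul_charV hmu1 (Estar1 D)) ?hX //;
  by rewrite /Estar /= ?invr_neq0 // expf_neq0.
Qed.

Lemma mu1_unramified x : (forall y : E, unitE y -> mu1 y = 1) ->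
  #|k|%:R * mu1 W = 1 -> x != 0 -> mu1 x = (absE R x)%:C.
Proof.
move=> unr qs x0; have [nz mM _] := hmu1.
have Wv0 := unifX_neq0 hw (v x).
have ux : unitE (x / W ^ v x).
  rewrite /unitE mulf_neq0 ?invr_neq0 //= lvalM ?invr_neq0 // lvalV //.
  by rewrite lval_unifX // subrr.
rewrite -[in LHS](divfK Wv0 x) (mM _ _ (unit_neq0 ux) Wv0) unr // mul1r.
have q0 : #|k|%:R != 0 :> C.
  by apply: contra_eq_neq qs => ->; rewrite mul0r eq_sym oner_neq0.
have sE : mu1 W = #|k|%:R^-1 by apply: (mulfI q0); rewrite qs mulfV.
rewrite mu1_unifX sE exprz_inv /absE (negPf x0).
have qR0 : (#|k|%:R : R) != 0 by apply: lt0r_neq0 (card_res_gt0 _ _).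
by rewrite fmorphXz rmorph_nat.
Qed.

Context (n : nat) (u : pi) (hu : fixed pi n u).
Hypothesis minimal : forall (m : nat) (u' : pi), (m < n)%N -> fixed pi m u' -> u' = 0.
Local Notation f := (eval_at iota u).

Let fE := fun b g => @eval_at_equivariant _ _ _ _ _ iota u b g.
Let fK := eval_at_fixed iota_hom hu.

(** For i <= n - 2 the hypotheses are contradictory: the vanishing [Hgrp] average takes the value q
    ^ 2 * a_i at gamma_i. Only i = n - 1 can yield the conclusion. *)
Lemma low_value (i : int) (c : nat) : n%:Z <= i + i -> i < n%:Z - c%:Z ->
  (forall x : E, unitE x -> in_ideal c (x - 1) -> mu1 x = 1) ->
  f (gamma w i) != 0 ->
  (forall x, x != 0 -> mu1 x = (absE R x)%:C) /\ (forall x, E1 x -> mu2 x = 1).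
Proof.
move=> ni ic triv fi; have n2 : (2 <= n)%N by ilia.
have iltn : i <= n%:Z - 1 by ilia.
have triv1 (x : E) : unitE x -> in_ideal (n%:Z - 1 - i) (x - 1) -> mu1 x = 1.
  by move=> ux nx; apply: triv => //; apply: ideal_le nx; ilia.
have Ku := Kplus_fixed hw hmu1 iota_inj iota_hom hu n2 ni iltn fi triv1.
have q0 : #|{: k * k}|%:R != 0 :> C.
  by rewrite pnatr_eq0 -lt0n; apply/card_gt0P; exists (0, 0).
have [iltn2|] := boolP (i <= n%:Z - 2).
  have n3 : (3 <= n)%N by ilia.
  have := congr1 (fun x => eval_at iota x (gamma w i)) (sum_H0 hw n2 minimal Ku n3).
  rewrite /= eval_at0 eval_at_sum (eq_bigr (fun=> f (gamma w i))) => [|o _].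
    by move/eqP; rewrite sumr_const -mulr_natl mulf_eq0 (negPf q0) (negPf fi).
  rewrite eval_at_act //.
  exact: (value_H_rep hw hmu1 iota_hom hu n2 ni iltn fi triv1).
(* The depth n - 1 - i is now 0, so mu1 is trivial on all units. *)
move=> iltn2; have iE : i = n%:Z - 1 by ilia.
have mu1_unit (x : E) : unitE x -> mu1 x = 1.
  move=> ux; apply: triv1 => //; rewrite iE subrr.
  by rewrite idealB ?ideal1 ?unit_ideal0.
rewrite iE in fi.
have [n2E qs] := top_value hw hmu1 hmu2 iota_hom n2 hu fi mu1_unit minimal Ku.
split=> x; first exact: mu1_unramified.
(* With n = 2 and i = 1 the depth 2i - n is 0, so mu2 is trivial on the whole of E^1. *)
move=> x1; apply: (cond_mu2_of_value hw hmu1 fE fK _ fi x1); first by ilia.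
rewrite n2E; apply: (@ideal_le _ 0) => //.
by rewrite idealB ?ideal1 // unit_ideal0 // E1_unit.
Qed.

End Newform.

Lemma fni_unique (R : realType) (D : unramified_quadratic) (mu1 mu2 : uqE D -> R[i])
  (w : uqF D) (n : nat) (i : int) (f f' : ind mu1 mu2) :
  is_fni w n i f -> is_fni w n i f' -> f = f'.
Proof.
move=> [_ fK f1 supp] [_ fK' f1' supp']; apply/val_inj/funext => g.
have inv (h : ind mu1 mu2) : fixed (ind mu1 mu2) n h -> ind_fun h (gamma w i) = 1 ->
    forall b k, borel b -> Kgrp n k -> ind_fun h (b * gamma w i * k)%g =
      (Num.sqrt (delta_B R b))%:C%C * mu_B mu1 mu2 b.
  move=> hK h1 b k bB kK.
  have <- : ind_fun (act k h) (b * gamma w i)%g = ind_fun h (b * gamma w i * k)%g by [].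
  rewrite (hK _ kK); case: h {hK} h1 => h /= /subrep_predP[_ hE] h1.
  by rewrite /ind_fun /= hE // -[h _]/(h (gamma w i)) [h _]h1 mulr1.
change (ind_fun f g = ind_fun f' g).
have [z|nz] := eqVneq (ind_fun f g) 0.
  have [-> //|/supp' nz'] := eqVneq (ind_fun f' g) 0.
  by have /supp := nz'; rewrite z eqxx.
by have /supp[b [k [bB kK ->]]] := nz; rewrite !inv.
Qed.

Unset Implicit Arguments.

Theorem proposition4p1 (R : realType) (D : unramified_quadratic)
  (varpi : uqF D) (hvarpi : is_uniformizer varpi)
  (psiE : uqE D -> R[i])
  (hpsiE : add_char psiE) (hpsiE_cond : add_conductor_oE psiE)
  (pi : rep R D) (pi_smooth : smooth pi) (pi_irr : irreducible pi)
  (pi_generic : generic psiE pi) (pi_nsc : ~ supercuspidal pi)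
  (pi_nst : ~ is_steinberg pi)
  (N : nat) (hN : has_conductor pi N)
  (mu1 mu2 : uqE D -> R[i])
  (hmu1 : mul_char_on (@Estar D) mu1) (hmu2 : mul_char_on (@E1 D) mu2)
  (iota : {linear pi -> ind mu1 mu2})
  (iota_inj : injective iota) (iota_hom : intertwining iota) :
  exists f : ind mu1 mu2,
    unique (is_fni varpi N (N%:Z - (cond_mu1 mu1)%:Z)) f /\
    exists v : pi, [/\ iota v = f, fixed pi N v & v != 0].
Proof.
have [[u hu u0] least] := hN.
have minimal (m : nat) (u' : pi) : (m < N)%N -> fixed pi m u' -> u' = 0.
  move=> mN hu'; apply/eqP/negPn/negP => u'0.
  by have := least m; rewrite leqNgt mN => /(_ (ex_intro2 _ _ u' hu' u'0)).
pose f := eval_at iota u.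
have fE b g := @eval_at_equivariant _ _ _ _ _ iota u b g.
have fK := eval_at_fixed iota_hom hu.
have fdec b k (i : int) : borel b -> Kgrp N k -> f (b * gamma varpi i * k)%g =
    (absE R (u3_mx b 0 0))%:C%C * (mu1 (u3_mx b 0 0) * mu2 (u3_mx b 1 1))
      * f (gamma varpi i).
  by move=> bB kK; rewrite /f fK // (equivariantE fE).
have [j jN fj] : exists2 j : int, (uphalf N)%:Z <= j <= N%:Z & f (gamma varpi j) != 0.
  apply: contrapT => none; case/eqP: u0; apply: (eval_at_inj iota_inj) => g.
  rewrite eval_at0; have [j [b [k [jN bB kK ->]]]] := gamma_decomposition hvarpi g N.
  rewrite -/f fdec //; apply/eqP; rewrite mulf_eq0; apply/orP; right.
  by apply/negPn/negP => fj; apply: none; exists j.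
have bound (i : int) : (uphalf N)%:Z <= i <= N%:Z -> f (gamma varpi i) != 0 ->
    forall x : uqE D, unitE x -> in_ideal (N%:Z - i) (x - 1) -> mu1 x = 1.
  by move=> /andP[/uphalf_leP Ni iN] fi x; apply: (cond_mu1_of_value hvarpi hmu2 fE fK).
(* The non-zero value at gamma_j already provides a level where mu1 is trivial, so continuity is not
   invoked. *)
have [|cond_triv cond_min] := @cond_mu1P R D mu1.
  exists `|N%:Z - j|%N => x ux nx; apply: (bound j jN fj) => //.
  by move: nx; congr in_ideal; ilia.
have support (i : int) : (uphalf N)%:Z <= i <= N%:Z -> f (gamma varpi i) != 0 ->
    i = N%:Z - (cond_mu1 mu1)%:Z.
  move=> iN fi; have le_c : (cond_mu1 mu1)%:Z <= N%:Z - i.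
    have := cond_min `|N%:Z - i|%N; rewrite -lez_nat => h.
    apply: le_trans (h _) _; last by ilia.
    move=> x ux nx; apply: (bound i iN fi) => //.
    by move: nx; congr in_ideal; ilia.
  apply/eqP; rewrite eq_le; apply/andP; split; first by ilia.
  (* A smaller i would give mu1 = |.| and mu2 = 1 on their groups, and the image of pi in Ind(|.|
     (x) 1) would be an irreducible subrepresentation isomorphic to pi. *)
  rewrite leNgt; apply/negP => lt_i; apply: pi_nst.
  have /andP[/uphalf_leP Ni _] := iN.
  have [e1 e2] := low_value hvarpi hmu1 hmu2 iota_inj iota_hom hu minimal Ni
    lt_i cond_triv fi.
  exists (image_subrep iota_hom e1 e2); split.
    by apply: irreducible_iso (to_image_bij _ _ _ _) (to_image_hom _ _ _) pi_irr.
  by exists (to_image iota_hom e1 e2); split; [apply: to_image_bij|apply: to_image_hom].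
set i0 := N%:Z - _.
have j0 := support j jN fj; rewrite -/i0 in j0; subst j.
(* By [support] the function of u lives on the single cell of gamma_(i0); scaling makes its value
   there 1. *)
pose v := (f (gamma varpi i0))^-1 *: u.
have vE g : eval_at iota v g = (f (gamma varpi i0))^-1 * f g.
  by rewrite /eval_at /v linearZ.
have hv : fixed pi N v by move=> k kK; rewrite linearZ /= hu.
have v0 : v != 0 by rewrite scaler_eq0 invr_eq0 negb_or fj.
have fni : is_fni varpi N i0 (iota v).
  split=> //.
  - by move=> k kK; rewrite -iota_hom hv.
  - by rewrite -[LHS]/(eval_at iota v _) vE mulVf.
  - move=> g; rewrite -[ind_fun _ _]/(eval_at iota v g) vE mulf_eq0 invr_eq0 (negPf fj) /=.
    split=> [fg|[b [k [bB kK ->]]]].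
      have [i [b [k [iN bB kK gE]]]] := gamma_decomposition hvarpi g N.
      exists b, k; split=> //; rewrite gE; congr (_ * gamma _ _ * _)%g.
      apply: support => //; move: fg; rewrite gE fdec //.
      by apply: contraNneq => ->; rewrite mulr0.
    have [b0 b1] := borel_diag bB; rewrite fdec // !mulf_neq0 //.
    + by rewrite fmorph_eq0; apply: lt0r_neq0 (absE_gt0 _ b0).
    + by case: hmu1 => nz _ _; apply: nz.
    + by case: hmu2 => nz _ _; apply: nz.
exists (iota v); split; last by exists v.
by split=> // f'; apply: fni_unique.
Qed.
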